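(* Assume Hypothesis (H) and fix $t_0\in(\alpha,\beta)$. Suppose $\lambda_{t_0}$ is a simple eigenvalue of $H_{t_0}$ with normalized eigenfunction $u_{t_0}$, and let $t\mapsto\lambda_t$ be the (differentiable) eigenvalue curve of $H_t$ through $\lambda_{t_0}$. Let $\mathcal K_{\lambda}:=\{(\gamma_Df,\gamma_Nf): f\in\widehat H^2(\Gamma),\ -f''+qf=\lambda f\}$. Then $$\frac{d\lambda_t}{dt}\Big|_{t=t_0}=\big\langle (A_{t_0}\dot B_{t_0}^*-B_{t_0}\dot A_{t_0}^* )\phi_{t_0},\phi_{t_0}\big\rangle_{\mathbb C^{2|\mathcal E|}}=\mathfrak m_{t_0,\mathcal K_{\lambda_{t_0}}}(\operatorname{Tr}u_{t_0},\operatorname{Tr}u_{t_0}),$$ where $\phi_{t_0}:=(A_{t_0}A_{t_0}^*-B_{t_0}B_{t_0}^* )^{-1}(B_{t_0}\gamma_Du_{t_0}+A_{t_0}\gamma_Nu_{t_0})$ (the matrix $A_{t_0}A_{t_0}^*-B_{t_0}B_{t_0}^*$ being invertible) and a dot denotes the derivative in $t$.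
   Context: Let $\Gamma$ be a compact metric graph with finitely many vertices and a finite edge set $\mathcal E$; each edge $e$ is identified with an interval $[a_e,b_e]$ of positive length. Let $\partial\Gamma$ be the $2|\mathcal E|$ edge endpoints (counted per edge), $L^2(\partial\Gamma)\cong\mathbb C^{2|\mathcal E|}$, $L^2(\Gamma)=\bigoplus_eL^2(e)$, $\widehat H^2(\Gamma)=\bigoplus_eH^2(e)$. For $f\in\widehat H^2(\Gamma)$, $\gamma_Df$ is the vector of endpoint values and $\gamma_Nf$ the vector of endpoint derivatives taken in the direction pointing into the edge; $\operatorname{Tr}f:=(\gamma_Df,\gamma_Nf)$. Symplectic form on $\mathbb C^{2|\mathcal E|}\oplus\mathbb C^{2|\mathcal E|}$: $\omega((\phi_1,\phi_2),(\psi_1,\psi_2)):=\sum_{p\in\partial\Gamma}(\phi_2(p)\overline{\psi_1(p)}-\phi_1(p)\overline{\psi_2(p)})$; Lagrangian subspaces are those equal to their $\omega$-annihilator. Fix $q\in L^\infty(\Gamma;\mathbb R)$. Hypothesis (H): $t\mapsto(A_t,B_t)$ is $C^1$ on $[\alpha,\beta]$ with values in pairs of complex $2|\mathcal E|\times2|\mathcal E|$ matrices, $\operatorname{rank}(A_t\ B_t)=2|\mathcal E|$, $A_tB_t^*=B_tA_t^*$. $\mathcal L_t:=\{(\phi,\psi):A_t\phi+B_t\psi=0\}=\{(-B_t^*g,A_t^*g):g\in\mathbb C^{2|\mathcal E|}\}$ (Lagrangian). $H_t:=-\frac{d^2}{dx^2}+q$ with domain $\{f\in\widehat H^2(\Gamma):A_t\gamma_Df+B_t\gamma_Nf=0\}$,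 self-adjoint in $L^2(\Gamma)$. Crossing form: since $t\mapsto\mathcal L_t$ is $C^1$, near $t_0$ there are operators $R_t:\mathcal L_{t_0}\to\mathcal L_{t_0}^\perp$, $C^1$ in $t$, $R_{t_0}=0$, with $\mathcal L_t=\{v+R_tv:v\in\mathcal L_{t_0}\}$. For a Lagrangian plane $\mathcal K$ with $\mathcal K\cap\mathcal L_{t_0}\ne\{0\}$, the crossing form of the pair of paths ($\mathcal K$ constant, $\mathcal L_t$) at $t_0$ is $\mathfrak m_{t_0,\mathcal K}(v,v):=-\frac{d}{dt}\omega(v,R_tv)\big|_{t=t_0}=-\omega(v,\dot R_{t_0}v)$ for $v\in\mathcal K\cap\mathcal L_{t_0}$.
   Formalization: Invertibility of A A* − B B* at t_0 is assumed rather than asserted, since it does not follow from (H): for constant A_t = B_t = I the matrix is zero and φ is undefined. *)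

(* Defs.v *)
From Stdlib Require Import Reals Lra.
Open Scope R_scope.

Definition Cx := (R * R)%type.
Definition C0 : Cx := (0, 0).
Definition C1 : Cx := (1, 0).
Definition RtoC (r : R) : Cx := (r, 0).
Definition Cadd (x y : Cx) : Cx := (fst x + fst y, snd x + snd y).
Definition Copp (x : Cx) : Cx := (- fst x, - snd x).
Definition Csub (x y : Cx) : Cx := Cadd x (Copp y).
Definition Cmul (x y : Cx) : Cx :=
  (fst x * fst y - snd x * snd y, fst x * snd y + snd x * fst y).
Definition Cconj (x : Cx) : Cx := (fst x, - snd x).
Definition Cscale (r : R) (x : Cx) : Cx := (r * fst x, r * snd x).
Definition Cnorm (x : Cx) : R := sqrt (fst x ^ 2 + snd x ^ 2).

Fixpoint csum (n : nat) (f : nat -> Cx) : Cx :=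
  match n with O => C0 | S k => Cadd (csum k f) (f k) end.
Fixpoint rsum (n : nat) (f : nat -> R) : R :=
  match n with O => 0 | S k => rsum k f + f k end.

(* ---------- vectors / matrices in Cx^N (indices < N are relevant) ---------- *)
Definition vec := nat -> Cx.
Definition mat := nat -> nat -> Cx.
Definition veq (N : nat) (v w : vec) : Prop := forall i, (i < N)%nat -> v i = w i.
Definition meq (N : nat) (M P : mat) : Prop :=
  forall i j, (i < N)%nat -> (j < N)%nat -> M i j = P i j.
Definition vzero : vec := fun _ => C0.
Definition vadd (v w : vec) : vec := fun i => Cadd (v i) (w i).
Definition vscale (c : Cx) (v : vec) : vec := fun i => Cmul c (v i).
Definition mulmv (N : nat) (M : mat) (v : vec) : vec :=
  fun i => csum N (fun j => Cmul (M i j) (v j)).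
Definition mulmm (N : nat) (M P : mat) : mat :=
  fun i k => csum N (fun j => Cmul (M i j) (P j k)).
Definition adj (M : mat) : mat := fun i j => Cconj (M j i).
Definition msub (M P : mat) : mat := fun i j => Csub (M i j) (P i j).
Definition idm : mat := fun i j => if Nat.eqb i j then C1 else C0.
Definition cinner (N : nat) (x y : vec) : Cx := csum N (fun p => Cmul (x p) (Cconj (y p))).

Definition Icc (a b x : R) : Prop := a <= x <= b.
Definition Ioo (a b x : R) : Prop := a < x < b.

Definition cderiv_pt (D : R -> Prop) (g : R -> Cx) (x : R) (l : Cx) : Prop :=
  forall eps, eps > 0 -> exists delta, delta > 0 /\
    forall y, D y -> y <> x -> Rabs (y - x) < delta ->
      Cnorm (Csub (Cscale (/ (y - x)) (Csub (g y) (g x))) l) < eps.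
Definition cderiv_on (D : R -> Prop) (g dg : R -> Cx) : Prop :=
  forall x, D x -> cderiv_pt D g x (dg x).
Definition ccont_on (D : R -> Prop) (g : R -> Cx) : Prop :=
  forall x, D x -> forall eps, eps > 0 -> exists delta, delta > 0 /\
    forall y, D y -> Rabs (y - x) < delta -> Cnorm (Csub (g y) (g x)) < eps.

Definition null_set (P : R -> Prop) : Prop :=
  forall eps, eps > 0 -> exists c d : nat -> R,
    (forall n, c n <= d n) /\
    (forall x, P x -> exists n, c n < x < d n) /\
    (forall n, rsum n (fun k => d k - c k) <= eps).
Definition ae_on (a b : R) (P : R -> Prop) : Prop :=
  null_set (fun x => a <= x <= b /\ ~ P x).

Definition abs_cont (a b : R) (g : R -> Cx) : Prop :=
  forall eps, eps > 0 -> exists delta, delta > 0 /\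
    forall (n : nat) (x y : nat -> R),
      (forall i, (i < n)%nat -> a <= x i /\ x i <= y i /\ y i <= b) ->
      (forall i, (S i < n)%nat -> y i <= x (S i)) ->
      rsum n (fun i => y i - x i) < delta ->
      rsum n (fun i => Cnorm (Csub (g (y i)) (g (x i)))) < eps.

(* q_e in L^infty(a,b; R): Lebesgue measurable (a.e. limit of continuous
   functions) and essentially bounded *)
Definition Linf_on (a b : R) (q : R -> R) : Prop :=
  (exists gs : nat -> R -> R, (forall n, continuity (gs n)) /\
     ae_on a b (fun x => Un_cv (fun n => gs n x) (q x))) /\
  (exists M, ae_on a b (fun x => Rabs (q x) <= M)).

(* ---------- the metric graph: m edges, edge e = [a e, b e];
   endpoint index 2e <-> a e, 2e+1 <-> b e; N = 2m ---------- *)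
Definition gammaD (f : nat -> R -> Cx) (a b : nat -> R) : vec :=
  fun p => if Nat.odd p then f (Nat.div2 p) (b (Nat.div2 p))
           else f (Nat.div2 p) (a (Nat.div2 p)).
(* derivative in the direction pointing into the edge *)
Definition gammaN (df : nat -> R -> Cx) (a b : nat -> R) : vec :=
  fun p => if Nat.odd p then Copp (df (Nat.div2 p) (b (Nat.div2 p)))
           else df (Nat.div2 p) (a (Nat.div2 p)).

(* f (with derivative df) lies in \hat H^2 and solves -f'' + q f = lam f *)
Definition eigfun (m : nat) (a b : nat -> R) (q : nat -> R -> R) (lam : R)
    (f df : nat -> R -> Cx) : Prop :=
  forall e, (e < m)%nat ->
    cderiv_on (Icc (a e) (b e)) (f e) (df e) /\
    abs_cont (a e) (b e) (df e) /\
    ae_on (a e) (b e) (fun x =>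
      cderiv_pt (Icc (a e) (b e)) (df e) x (Cscale (q e x - lam) (f e x))).

Definition in_bc (N : nat) (A B : mat) (v w : vec) : Prop :=
  forall i, (i < N)%nat -> csum N (fun j => Cadd (Cmul (A i j) (v j)) (Cmul (B i j) (w j))) = C0.

Definition bc (m : nat) (a b : nat -> R) (A B : mat) (f df : nat -> R -> Cx) : Prop :=
  in_bc (2 * m) A B (gammaD f a b) (gammaN df a b).

Definition nonzero_fun (m : nat) (a b : nat -> R) (f : nat -> R -> Cx) : Prop :=
  exists e x, (e < m)%nat /\ Icc (a e) (b e) x /\ f e x <> C0.

Definition is_eigenvalue (m : nat) (a b : nat -> R) (q : nat -> R -> R)
    (A B : mat) (lam : R) : Prop :=
  exists f df, eigfun m a b q lam f df /\ bc m a b A B f df /\ nonzero_fun m a b f.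

Definition is_simple_eigenvalue (m : nat) (a b : nat -> R) (q : nat -> R -> R)
    (A B : mat) (lam : R) : Prop :=
  is_eigenvalue m a b q A B lam /\
  forall f df g dg,
    eigfun m a b q lam f df -> bc m a b A B f df -> nonzero_fun m a b f ->
    eigfun m a b q lam g dg -> bc m a b A B g dg ->
    exists c : Cx, forall e x, (e < m)%nat -> Icc (a e) (b e) x -> g e x = Cmul c (f e x).

Definition normalized (m : nat) (a b : nat -> R) (f : nat -> R -> Cx) : Prop :=
  exists I : nat -> R,
    (forall e, (e < m)%nat -> exists pr : Riemann_integrable
        (fun x => Cnorm (f e x) ^ 2) (a e) (b e), RiemannInt pr = I e) /\
    rsum m I = 1.

Definition hypH (N : nat) (A B dA dB : R -> mat) (al be : R) : Prop :=
  al < be /\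
  (forall i j, (i < N)%nat -> (j < N)%nat ->
     cderiv_on (Icc al be) (fun t => A t i j) (fun t => dA t i j) /\
     ccont_on (Icc al be) (fun t => dA t i j) /\
     cderiv_on (Icc al be) (fun t => B t i j) (fun t => dB t i j) /\
     ccont_on (Icc al be) (fun t => dB t i j)) /\
  (forall t, Icc al be t ->
     (* rank (A_t B_t) = N : the N rows of (A_t B_t) are linearly independent *)
     (forall g : vec, veq N (mulmv N (adj (A t)) g) vzero ->
                      veq N (mulmv N (adj (B t)) g) vzero -> veq N g vzero) /\
     meq N (mulmm N (A t) (adj (B t))) (mulmm N (B t) (adj (A t)))).

Definition vec2 := (vec * vec)%type.
Definition v2eq (N : nat) (v w : vec2) : Prop := veq N (fst v) (fst w) /\ veq N (snd v) (snd w).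
Definition v2add (v w : vec2) : vec2 := (vadd (fst v) (fst w), vadd (snd v) (snd w)).
Definition v2scale (c : Cx) (v : vec2) : vec2 := (vscale c (fst v), vscale c (snd v)).
Definition v2zero : vec2 := (vzero, vzero).
Definition omega (N : nat) (v w : vec2) : Cx :=
  csum N (fun p => Csub (Cmul (snd v p) (Cconj (fst w p))) (Cmul (fst v p) (Cconj (snd w p)))).
Definition inner2 (N : nat) (v w : vec2) : Cx :=
  Cadd (cinner N (fst v) (fst w)) (cinner N (snd v) (snd w)).

Definition Lplane (N : nat) (A B : mat) (v : vec2) : Prop := in_bc N A B (fst v) (snd v).

Definition Kplane (m : nat) (a b : nat -> R) (q : nat -> R -> R) (lam : R) (v : vec2) : Prop :=
  exists f df, eigfun m a b q lam f df /\
    veq (2 * m) (fst v) (gammaD f a b) /\ veq (2 * m) (snd v) (gammaN df a b).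

(* R_t : L_{t0} -> L_{t0}^perp (t near t0), Cx^1 in t with derivative dR,
   R_{t0} = 0 and L_t = {v + R_t v : v in L_{t0}} *)
Definition admissible_R (N : nat) (A B : R -> mat) (t0 : R)
    (Rt dR : R -> vec2 -> vec2) (delta : R) : Prop :=
  let L0 := Lplane N (A t0) (B t0) in
  delta > 0 /\
  (forall t, Rabs (t - t0) < delta ->
     (forall w w', L0 w -> v2eq N w w' -> v2eq N (Rt t w) (Rt t w')) /\
     (forall w, L0 w -> forall z, L0 z -> inner2 N (Rt t w) z = C0) /\
     (forall w1 w2 c, L0 w1 -> L0 w2 ->
        v2eq N (Rt t (v2add (v2scale c w1) w2)) (v2add (v2scale c (Rt t w1)) (Rt t w2))) /\
     (forall z, Lplane N (A t) (B t) z <-> exists w, L0 w /\ v2eq N z (v2add w (Rt t w)))) /\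
  (forall w, L0 w -> v2eq N (Rt t0 w) v2zero) /\
  (forall w, L0 w -> forall k, (k < N)%nat ->
     cderiv_on (Ioo (t0 - delta) (t0 + delta)) (fun t => fst (Rt t w) k) (fun t => fst (dR t w) k) /\
     ccont_on (Ioo (t0 - delta) (t0 + delta)) (fun t => fst (dR t w) k) /\
     cderiv_on (Ioo (t0 - delta) (t0 + delta)) (fun t => snd (Rt t w) k) (fun t => snd (dR t w) k) /\
     ccont_on (Ioo (t0 - delta) (t0 + delta)) (fun t => snd (dR t w) k)).

(* "m_{t0,K}(v,v) = z": v in K /\ L_{t0}, such R_t exist, and for any such R_t,
   z = - d/dt omega(v, R_t v)|_{t0} = - omega(v, dR_{t0} v) *)
Definition crossing_form_is (N : nat) (A B : R -> mat) (t0 : R) (K : vec2 -> Prop)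
    (v : vec2) (z : Cx) : Prop :=
  K v /\ Lplane N (A t0) (B t0) v /\
  (exists Rt dR delta, admissible_R N A B t0 Rt dR delta) /\
  (forall Rt dR delta, admissible_R N A B t0 Rt dR delta ->
     z = Copp (omega N v (dR t0 v))).

(* Main.v *)
(** By Green's formula, [omega (Tr f) (Tr u) = (lam - lam0) <f, u>] for an eigenfunction [f] of
    [H_t] to [lam] and [u] of [H_t0] to [lam0]; writing [Tr u = (- B^* g, A^* g)] at [t0], the
    boundary condition of [f] turns the left side into [<(A_t - A) gammaD f + (B_t - B) gammaN f, g>].
    Dividing by [t - t0] gives the derivative as soon as the eigenfunctions converge along some
    sequence [t_n -> t0]. This follows from compactness (Gronwall and Bolzano-Weierstrass) and
    simplicity. The potential is only used through its essential bound: absolutely continuous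
    functions with a.e. derivative at most [L] grow at rate at most [L], and no integral other than
    that of the continuous function [|u|^2] is needed. The crossing form is computed by
    differentiating the equation of the plane at [v + R_t v]. With [T_t g = (- B_t^* g, A_t^* g)],
    the operators [R_t w = T_t (T_0^* T_t)^-1 T_0^* w - w] are admissible. *)
From Stdlib Require Import Reals Lra Lia Psatz Setoid Morphisms List.
From Stdlib Require FunctionalExtensionality ClassicalEpsilon.
Require Import Defs.
Open Scope R_scope.

(** * Complex numbers and finite sums *)

(** No continuity of eigenfunctions in t is assumed, and at different t they are chosen
    independently. They are scaled so that the boundary trace has l^1 norm 1: this bounds the
    initial data on every edge, as compactness requires, and it passes to the limit, which is
    therefore c u with c nonzero. The value of c stays unknown, but both evaluations of the limit of
    omega(Tr f_n, Tr u) / (t_n - t_0) carry it as a factor, so it cancels.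

    The equation holds only almost everywhere, with q merely bounded. Limits of solutions are still
    solutions because the differences f_n' - f_k' have small Lipschitz constants; hence derivatives
    pass to the limit at each point where all members of the sequence satisfy the equation, and such
    points have full measure by countable subadditivity.

    On the algebraic side, inverses come from injectivity of all leading blocks, a condition that
    both positive definite Gram matrices and matrices close to the identity satisfy. That a
    Lagrangian plane is exhausted by its parametrization is a dimension statement; a trace argument
    proves it. *)

Lemma Cx_eq (x y : Cx) : fst x = fst y -> snd x = snd y -> x = y.
Proof. destruct x, y; simpl; intros; subst; reflexivity. Qed.

Ltac cx := intros; apply Cx_eq;
  unfold Csub, Cadd, Cmul, Copp, Cconj, Cscale, RtoC, C0, C1; simpl; try ring.

Lemma Cx_ring_theory : ring_theory C0 C1 Cadd Cmul Csub Copp (@eq Cx).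
Proof. split; cx. Qed.
Add Ring Cx_ring : Cx_ring_theory.

Lemma Cconj_add x y : Cconj (Cadd x y) = Cadd (Cconj x) (Cconj y).
Proof. cx. Qed.
Lemma Cconj_mul x y : Cconj (Cmul x y) = Cmul (Cconj x) (Cconj y).
Proof. cx. Qed.
Lemma Cconj_opp x : Cconj (Copp x) = Copp (Cconj x).
Proof. cx. Qed.
Lemma Cconj_sub x y : Cconj (Csub x y) = Csub (Cconj x) (Cconj y).
Proof. cx. Qed.
Lemma Cconj_conj x : Cconj (Cconj x) = x.
Proof. cx. Qed.
Lemma Cscale_mul r x : Cscale r x = Cmul (RtoC r) x.
Proof. cx. Qed.
Lemma Csub_eq0 x y : Csub x y = C0 -> x = y.
Proof. intros H. replace x with (Cadd (Csub x y) y) by ring. rewrite H; ring. Qed.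

Lemma Cmul_inv (c : Cx) : c <> C0 -> exists d, Cmul d c = C1.
Proof.
  intros H. set (s := fst c * fst c + snd c * snd c).
  assert (s <> 0).
  { intros E. apply H, Cx_eq; unfold C0; simpl; unfold s in E; nra. }
  exists (Cscale (/ s) (Cconj c)).
  cx; unfold s in *; field; assumption.
Qed.

Lemma Cmul_cancel c x y : c <> C0 -> Cmul c x = Cmul c y -> x = y.
Proof.
  intros Hc E. destruct (Cmul_inv c Hc) as [d Hd].
  replace x with (Cmul (Cmul d c) x) by (rewrite Hd; ring).
  replace y with (Cmul (Cmul d c) y) by (rewrite Hd; ring).
  replace (Cmul (Cmul d c) x) with (Cmul d (Cmul c x)) by ring.
  rewrite E; ring.
Qed.

Lemma csum_ext n f g : (forall i, (i < n)%nat -> f i = g i) -> csum n f = csum n g.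
Proof.
  induction n as [|n IH]; intros H; simpl; [reflexivity|].
  rewrite IH, H by (intros; try apply H; lia). reflexivity.
Qed.

Lemma csum_add n f g : csum n (fun i => Cadd (f i) (g i)) = Cadd (csum n f) (csum n g).
Proof. induction n as [|n IH]; simpl; [|rewrite IH]; ring. Qed.
Lemma csum_sub n f g : csum n (fun i => Csub (f i) (g i)) = Csub (csum n f) (csum n g).
Proof. induction n as [|n IH]; simpl; [|rewrite IH]; ring. Qed.
Lemma csum_opp n f : csum n (fun i => Copp (f i)) = Copp (csum n f).
Proof. induction n as [|n IH]; simpl; [|rewrite IH]; ring. Qed.
Lemma csum_mul_l n c f : csum n (fun i => Cmul c (f i)) = Cmul c (csum n f).
Proof. induction n as [|n IH]; simpl; [|rewrite IH]; ring. Qed.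
Lemma csum_mul_r n c f : csum n (fun i => Cmul (f i) c) = Cmul (csum n f) c.
Proof. induction n as [|n IH]; simpl; [|rewrite IH]; ring. Qed.
Lemma csum_conj n f : Cconj (csum n f) = csum n (fun i => Cconj (f i)).
Proof. induction n as [|n IH]; simpl; [cx|rewrite Cconj_add, IH]; reflexivity. Qed.
Lemma csum_zero n f : (forall i, (i < n)%nat -> f i = C0) -> csum n f = C0.
Proof.
  induction n as [|n IH]; intros H; simpl; [reflexivity|].
  rewrite IH, H by (intros; try apply H; lia). ring.
Qed.
Lemma csum_swap n k (f : nat -> nat -> Cx) :
  csum n (fun i => csum k (fun j => f i j)) = csum k (fun j => csum n (fun i => f i j)).
Proof.
  induction n as [|n IH]; simpl.
  - symmetry; apply csum_zero; reflexivity.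
  - rewrite IH, <- csum_add. reflexivity.
Qed.

Lemma csum_delta n i (f : nat -> Cx) : (i < n)%nat ->
  csum n (fun j => Cmul (idm i j) (f j)) = f i.
Proof.
  unfold idm. induction n as [|n IH]; intros H; [lia|simpl].
  destruct (Nat.eqb_spec i n) as [->|E].
  - rewrite csum_zero; [ring|]. intros j Hj.
    destruct (Nat.eqb_spec n j); [lia|ring].
  - rewrite IH by lia. ring.
Qed.

Lemma csum_re n f : fst (csum n f) = rsum n (fun i => fst (f i)).
Proof. induction n as [|n IH]; simpl; [|rewrite IH]; reflexivity. Qed.

Lemma rsum_ext n f g : (forall i, (i < n)%nat -> f i = g i) -> rsum n f = rsum n g.
Proof.
  induction n as [|n IH]; intros H; simpl; [reflexivity|].
  rewrite IH, H by (intros; try apply H; lia). reflexivity.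
Qed.
Lemma rsum_le n f g : (forall i, (i < n)%nat -> f i <= g i) -> rsum n f <= rsum n g.
Proof.
  induction n as [|n IH]; intros H; simpl; [lra|].
  apply Rplus_le_compat; [apply IH; intros|]; apply H; lia.
Qed.
Lemma rsum_const n c : rsum n (fun _ => c) = INR n * c.
Proof. induction n as [|n IH]; [simpl; ring|]. rewrite S_INR; simpl; rewrite IH; ring. Qed.
Lemma rsum_nonneg n f : (forall i, (i < n)%nat -> 0 <= f i) -> 0 <= rsum n f.
Proof.
  intros H. replace 0 with (rsum n (fun _ => 0)) by (rewrite rsum_const; ring).
  apply rsum_le, H.
Qed.
Lemma rsum_add n f g : rsum n (fun i => f i + g i) = rsum n f + rsum n g.
Proof. induction n as [|n IH]; simpl; [|rewrite IH]; ring. Qed.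
Lemma rsum_mul_l n c f : rsum n (fun i => c * f i) = c * rsum n f.
Proof. induction n as [|n IH]; simpl; [|rewrite IH]; ring. Qed.
Lemma rsum_term_le n f i : (forall i, (i < n)%nat -> 0 <= f i) -> (i < n)%nat -> f i <= rsum n f.
Proof.
  induction n as [|n IH]; intros H Hi; [lia|simpl].
  assert (0 <= rsum n f) by (apply rsum_nonneg; intros; apply H; lia).
  assert (0 <= f n) by (apply H; lia).
  destruct (Nat.eq_dec i n) as [->|E]; [lra|].
  assert (f i <= rsum n f) by (apply IH; [intros; apply H|]; lia). lra.
Qed.
Lemma rsum_zero_inv n f : (forall i, (i < n)%nat -> 0 <= f i) -> rsum n f = 0 ->
  forall i, (i < n)%nat -> f i = 0.
Proof.
  intros H E i Hi. pose proof (rsum_term_le n f i H Hi). pose proof (H i Hi). lra.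
Qed.
Lemma rsum_mono_n n k f : (forall i, 0 <= f i) -> (n <= k)%nat -> rsum n f <= rsum k f.
Proof.
  intros H L. induction L as [|k L IH]; [lra|]. simpl. specialize (H k). lra.
Qed.

Lemma Rabs_le_iff x y : Rabs x <= y <-> - y <= x <= y.
Proof. split; [|apply Rabs_le]. unfold Rabs; destruct (Rcase_abs x); lra. Qed.

Lemma Cnorm_ge0 x : 0 <= Cnorm x.
Proof. apply sqrt_pos. Qed.
Lemma Cnorm_sqr x : Cnorm x * Cnorm x = fst x * fst x + snd x * snd x.
Proof. unfold Cnorm. rewrite sqrt_sqrt by nra. ring. Qed.
Lemma Cnorm_re x : Rabs (fst x) <= Cnorm x.
Proof.
  pose proof (Cnorm_ge0 x). pose proof (Cnorm_sqr x).
  apply Rabs_le. nra.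
Qed.
Lemma Cnorm_im x : Rabs (snd x) <= Cnorm x.
Proof.
  pose proof (Cnorm_ge0 x). pose proof (Cnorm_sqr x).
  apply Rabs_le. nra.
Qed.
Lemma Cnorm_le_add x : Cnorm x <= Rabs (fst x) + Rabs (snd x).
Proof.
  pose proof (Cnorm_ge0 x). pose proof (Cnorm_sqr x).
  pose proof (Rabs_pos (fst x)). pose proof (Rabs_pos (snd x)).
  pose proof (Rsqr_abs (fst x)) as E1. pose proof (Rsqr_abs (snd x)) as E2.
  unfold Rsqr in *. nra.
Qed.
Lemma Cnorm_mul x y : Cnorm (Cmul x y) = Cnorm x * Cnorm y.
Proof.
  unfold Cnorm. rewrite <- sqrt_mult by nra. f_equal. unfold Cmul; simpl. ring.
Qed.
Lemma Cnorm_add x y : Cnorm (Cadd x y) <= Cnorm x + Cnorm y.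
Proof.
  pose proof (Cnorm_ge0 x). pose proof (Cnorm_ge0 y).
  apply Rsqr_incr_0; [|apply Cnorm_ge0|lra].
  unfold Rsqr. rewrite Cnorm_sqr.
  pose proof (Cnorm_sqr x) as Ex. pose proof (Cnorm_sqr y) as Ey.
  (* The cross term of |x + y|^2 is 2 Re(x conj y); multiplicativity of the norm bounds it by 2 |x|
     |y|. *)
  pose proof (Cnorm_mul x (Cconj y)) as Em.
  pose proof (Cnorm_re (Cmul x (Cconj y))) as Hr.
  replace (Cnorm (Cconj y)) with (Cnorm y) in Em by (unfold Cnorm, Cconj; simpl; f_equal; ring).
  rewrite Em in Hr. apply Rabs_le_iff in Hr.
  unfold Cmul, Cconj in Hr; simpl in Hr.
  unfold Cadd; simpl. nra.
Qed.
Lemma Cnorm_opp x : Cnorm (Copp x) = Cnorm x.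
Proof. unfold Cnorm, Copp; simpl; f_equal; ring. Qed.
Lemma Cnorm_conj x : Cnorm (Cconj x) = Cnorm x.
Proof. unfold Cnorm, Cconj; simpl; f_equal; ring. Qed.
Lemma Cnorm_sub_sym x y : Cnorm (Csub x y) = Cnorm (Csub y x).
Proof. unfold Cnorm, Csub, Cadd, Copp; simpl; f_equal; ring. Qed.
Lemma Cnorm_RtoC r : Cnorm (RtoC r) = Rabs r.
Proof.
  unfold Cnorm, RtoC; simpl. rewrite <- sqrt_Rsqr_abs. f_equal. unfold Rsqr; ring.
Qed.
Lemma Cnorm_0 : Cnorm C0 = 0.
Proof. change C0 with (RtoC 0). rewrite Cnorm_RtoC, Rabs_R0. reflexivity. Qed.
Lemma Cnorm_eq0 x : Cnorm x = 0 -> x = C0.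
Proof.
  intros H. pose proof (Cnorm_sqr x) as E. rewrite H in E.
  apply Cx_eq; simpl; nra.
Qed.
Lemma Cnorm_csum n f : Cnorm (csum n f) <= rsum n (fun i => Cnorm (f i)).
Proof.
  induction n as [|n IH]; simpl; [rewrite Cnorm_0; lra|].
  pose proof (Cnorm_add (csum n f) (f n)). lra.
Qed.

(** * Linear algebra *)

Global Instance meq_equiv N : Equivalence (meq N).
Proof.
  split; red; unfold meq; intros; auto.
  - symmetry; auto.
  - rewrite H; auto.
Qed.
Global Instance veq_equiv N : Equivalence (veq N).
Proof.
  split; red; unfold veq; intros; auto.
  - symmetry; auto.
  - rewrite H; auto.
Qed.
Global Instance mulmm_proper N : Proper (meq N ==> meq N ==> meq N) (mulmm N).
Proof.
  intros M M' HM P P' HP i k Hi Hk. apply csum_ext; intros j Hj.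
  rewrite HM, HP; auto.
Qed.
Global Instance mulmv_proper N : Proper (meq N ==> veq N ==> veq N) (mulmv N).
Proof.
  intros M M' HM v v' Hv i Hi. apply csum_ext; intros j Hj. rewrite HM, Hv; auto.
Qed.
Global Instance adj_proper N : Proper (meq N ==> meq N) adj.
Proof. intros M M' HM i j Hi Hj. unfold adj. rewrite HM; auto. Qed.

Lemma mulmm_assoc N M P K : meq N (mulmm N (mulmm N M P) K) (mulmm N M (mulmm N P K)).
Proof.
  intros i k _ _. unfold mulmm.
  transitivity (csum N (fun j => csum N (fun l => Cmul (M i l) (Cmul (P l j) (K j k))))).
  - apply csum_ext; intros j _. rewrite <- csum_mul_r. apply csum_ext; intros; ring.
  - rewrite csum_swap. apply csum_ext; intros j _. apply csum_mul_l.
Qed.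
Lemma mulmv_assoc N M P v : veq N (mulmv N (mulmm N M P) v) (mulmv N M (mulmv N P v)).
Proof.
  intros i _. unfold mulmm, mulmv.
  transitivity (csum N (fun j => csum N (fun l => Cmul (M i l) (Cmul (P l j) (v j))))).
  - apply csum_ext; intros j _. rewrite <- csum_mul_r. apply csum_ext; intros; ring.
  - rewrite csum_swap. apply csum_ext; intros j _. apply csum_mul_l.
Qed.
Lemma mulmm_1l N M : meq N (mulmm N idm M) M.
Proof. intros i k Hi _. apply (csum_delta N i (fun j => M j k) Hi). Qed.
Lemma mulmv_1 N v : veq N (mulmv N idm v) v.
Proof. intros i Hi. apply (csum_delta N i v Hi). Qed.
Lemma adj_mul N M P : meq N (adj (mulmm N M P)) (mulmm N (adj P) (adj M)).
Proof.
  intros i j _ _. unfold adj, mulmm. rewrite csum_conj. apply csum_ext; intros.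
  rewrite Cconj_mul; ring.
Qed.
Lemma adj_adj M : adj (adj M) = M.
Proof.
  unfold adj. apply FunctionalExtensionality.functional_extensionality; intros i.
  apply FunctionalExtensionality.functional_extensionality; intros j. apply Cconj_conj.
Qed.
Lemma adj_idm N : meq N (adj idm) idm.
Proof.
  intros i j _ _. unfold adj, idm. rewrite (Nat.eqb_sym j i).
  destruct (Nat.eqb i j); cx.
Qed.
Lemma mulmm_1r N M : meq N (mulmm N M idm) M.
Proof.
  rewrite <- (adj_adj (mulmm N M idm)), adj_mul, adj_idm, mulmm_1l, adj_adj. reflexivity.
Qed.
Lemma cinner_adj N M x y : cinner N (mulmv N M x) y = cinner N x (mulmv N (adj M) y).
Proof.
  unfold cinner, mulmv, adj.
  transitivity (csum N (fun i => csum N (fun j => Cmul (Cmul (M i j) (x j)) (Cconj (y i))))).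
  - apply csum_ext; intros. symmetry; apply csum_mul_r.
  - rewrite csum_swap. apply csum_ext; intros j _.
    rewrite csum_conj, <- csum_mul_l. apply csum_ext; intros i _.
    rewrite Cconj_mul, Cconj_conj; ring.
Qed.
Lemma cinner_conj N x y : Cconj (cinner N x y) = cinner N y x.
Proof.
  unfold cinner. rewrite csum_conj. apply csum_ext; intros.
  rewrite Cconj_mul, Cconj_conj; ring.
Qed.
Lemma cinner_veq N x x' y y' : veq N x x' -> veq N y y' -> cinner N x y = cinner N x' y'.
Proof. intros Hx Hy. apply csum_ext; intros. rewrite Hx, Hy; auto. Qed.
Lemma cinner_self_re N x : fst (cinner N x x) = rsum N (fun i => Cnorm (x i) * Cnorm (x i)).
Proof.
  unfold cinner. rewrite csum_re. apply rsum_ext; intros. rewrite Cnorm_sqr.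
  unfold Cmul, Cconj; simpl; ring.
Qed.
Lemma cinner_self_zero N x : fst (cinner N x x) = 0 -> veq N x vzero.
Proof.
  rewrite cinner_self_re. intros H i Hi. apply Cnorm_eq0.
  assert (E := rsum_zero_inv N _ (fun i _ => Rle_0_sqr (Cnorm (x i))) H i Hi).
  unfold Rsqr in E; simpl in E. pose proof (Cnorm_ge0 (x i)). nra.
Qed.

(** Elimination without pivoting, by induction on the size. If [z] solves the leading block against
    the last column, then [w] = (z, -1) is annihilated by the first [n] rows. Injectivity of the
    next block makes the last row nonzero on [w], so a multiple of [w] corrects the last equation
    without disturbing the others. *)
Lemma leading_blocks_injective_surjective n M :
  (forall k, (k <= n)%nat -> forall g, veq k (mulmv k M g) vzero -> veq k g vzero) ->
  forall y, exists x, veq n (mulmv n M x) y.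
Proof.
  induction n as [|n IH]; intros H y.
  { exists y. intros i Hi; lia. }
  assert (IH' := IH (fun k Hk => H k (le_S _ _ Hk))).
  destruct (IH' (fun i => M i n)) as [z Hz].
  set (w := fun j => if Nat.eqb j n then Copp C1 else z j).
  assert (ext : forall (v : vec) c i, csum n (fun j => Cmul (M i j)
             ((fun j => if Nat.eqb j n then c else v j) j)) = mulmv n M v i).
  { intros v c i. apply csum_ext; intros j Hj.
    destruct (Nat.eqb_spec j n); [lia|reflexivity]. }
  assert (Hw : forall i, (i < n)%nat -> mulmv (S n) M w i = C0).
  { intros i Hi. unfold mulmv, w. simpl. rewrite ext, Nat.eqb_refl, Hz by assumption.
    ring. }
  (* Up to sign, [s] is the Schur complement of the leading block. *)
  set (s := mulmv (S n) M w n).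
  assert (Hs : s <> C0).
  { intros E. assert (veq (S n) w vzero) as W.
    { apply (H (S n)); [lia|]. intros i Hi. destruct (Nat.eq_dec i n) as [->|]; [exact E|].
      apply Hw; lia. }
    specialize (W n (Nat.lt_succ_diag_r n)). unfold w, vzero in W. rewrite Nat.eqb_refl in W.
    apply (f_equal fst) in W. unfold Copp, C1, C0 in W; simpl in W. lra. }
  destruct (Cmul_inv s Hs) as [d Hd].
  destruct (IH' y) as [x Hx].
  set (x0 := fun j => if Nat.eqb j n then C0 else x j).
  set (c := Cmul (Csub (y n) (mulmv (S n) M x0 n)) d).
  exists (fun j => Cadd (x0 j) (Cmul c (w j))).
  assert (lin : forall i, mulmv (S n) M (fun j => Cadd (x0 j) (Cmul c (w j))) i =
     Cadd (mulmv (S n) M x0 i) (Cmul c (mulmv (S n) M w i))).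
  { intros i. unfold mulmv. rewrite <- csum_mul_l, <- csum_add.
    apply csum_ext; intros; ring. }
  intros i Hi. rewrite lin. destruct (Nat.eq_dec i n) as [->|E].
  - fold s. unfold c.
    replace (Cmul (Cmul (Csub (y n) (mulmv (S n) M x0 n)) d) s)
      with (Cmul (Csub (y n) (mulmv (S n) M x0 n)) (Cmul d s)) by ring.
    rewrite Hd; ring.
  - rewrite Hw by lia. rewrite <- (Hx i) by lia.
    unfold mulmv at 1, x0. simpl. rewrite ext, Nat.eqb_refl. ring.
Qed.

(** The right inverse is assembled column by column. It is also a left inverse because [M]
    annihilates X M v - v for every [v] and is injective. *)
Lemma leading_blocks_injective_inverse n M :
  (forall k, (k <= n)%nat -> forall g, veq k (mulmv k M g) vzero -> veq k g vzero) ->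
  exists X, meq n (mulmm n M X) idm /\ meq n (mulmm n X M) idm.
Proof.
  intros H.
  assert (S := leading_blocks_injective_surjective n M H).
  pose (col := fun j => proj1_sig (ClassicalEpsilon.constructive_indefinite_description _ (S (fun i => idm i j)))).
  assert (Hcol : forall j, veq n (mulmv n M (col j)) (fun i => idm i j)).
  { intros j. unfold col. apply proj2_sig. }
  exists (fun i j => col j i).
  assert (R : meq n (mulmm n M (fun i j => col j i)) idm).
  { intros i j Hi Hj. apply (Hcol j i Hi). }
  split; [exact R|].
  set (X := fun i j => col j i) in *.
  assert (Z : forall v, veq n (mulmv n M (fun i => Csub (mulmv n (mulmm n X M) v i) (v i))) vzero).
  { intros v i Hi.
    assert (E : veq n (mulmv n M (mulmv n (mulmm n X M) v)) (mulmv n M v)).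
    { rewrite mulmv_assoc, <- (mulmv_assoc n M X), R, mulmv_1. reflexivity. }
    unfold mulmv at 1.
    transitivity (Csub (mulmv n M (mulmv n (mulmm n X M) v) i) (mulmv n M v i)).
    - unfold mulmv at 2 4. rewrite <- csum_sub. apply csum_ext; intros; ring.
    - rewrite E by assumption. unfold vzero; ring. }
  intros i j Hi Hj.
  specialize (H n (Nat.le_refl n) _ (Z (fun i => idm i j)) i Hi). cbv beta in H.
  apply Csub_eq0 in H. rewrite <- H.
  exact (eq_sym (mulmm_1r n (mulmm n X M) i j Hi Hj)).
Qed.

Definition mtrace N (M : mat) : Cx := csum N (fun i => M i i).
Lemma mtrace_mul N M P : mtrace N (mulmm N M P) = mtrace N (mulmm N P M).
Proof.
  unfold mtrace, mulmm. rewrite csum_swap. apply csum_ext; intros.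
  apply csum_ext; intros; ring.
Qed.
Lemma mtrace_meq N M P : meq N M P -> mtrace N M = mtrace N P.
Proof. intros H. apply csum_ext; intros; apply H; auto. Qed.

Lemma hermitian_inverse N Q Qi : meq N (adj Q) Q ->
  meq N (mulmm N Q Qi) idm -> meq N (mulmm N Qi Q) idm -> meq N (adj Qi) Qi.
Proof.
  intros HQ R L.
  rewrite <- (mulmm_1r N (adj Qi)), <- R, <- mulmm_assoc.
  rewrite <- HQ at 1. rewrite <- adj_mul, R, adj_idm, mulmm_1l. reflexivity.
Qed.

(* [Z^* Q^-1 Z] is an orthogonal projection of full trace, so it is the identity. *)
Lemma isometry_of_coisometry N Z Q Qi :
  meq N (mulmm N Z (adj Z)) Q ->
  meq N (mulmm N Q Qi) idm -> meq N (mulmm N Qi Q) idm ->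
  meq N (mulmm N (adj Z) (mulmm N Qi Z)) idm.
Proof.
  intros HZ R L.
  assert (HQ : meq N (adj Q) Q) by (rewrite <- HZ, adj_mul, adj_adj; reflexivity).
  assert (HQi := hermitian_inverse N Q Qi HQ R L).
  set (P := mulmm N (adj Z) (mulmm N Qi Z)).
  assert (Padj : meq N (adj P) P).
  { unfold P. rewrite adj_mul, adj_mul, adj_adj, HQi, mulmm_assoc. reflexivity. }
  assert (PP : meq N (mulmm N P P) P).
  { unfold P. rewrite mulmm_assoc, (mulmm_assoc N Qi Z), <- (mulmm_assoc N Z (adj Z)), HZ.
    rewrite <- (mulmm_assoc N Q Qi), R, mulmm_1l. reflexivity. }
  (* Cyclicity of the trace turns Z^* Q^-1 Z into Q^-1 Z Z^* = I; this takes the place of a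
     dimension count. *)
  assert (TP : mtrace N P = mtrace N idm).
  { unfold P. rewrite mtrace_mul. apply mtrace_meq. rewrite mulmm_assoc, HZ. exact L. }
  set (D := msub idm P).
  (* [D] = I - P is again a Hermitian idempotent, so its trace is that of D D^*, the sum of the
     squared norms of its rows. Trace zero therefore forces every row to vanish. *)
  assert (TD : csum N (fun i => cinner N (D i) (D i)) = C0).
  { transitivity (mtrace N (mulmm N D (adj D))); [reflexivity|].
    transitivity (mtrace N D).
    - apply mtrace_meq. intros i k Hi Hk.
      transitivity (Cadd (Csub (mulmm N idm (adj idm) i k) (mulmm N idm (adj P) i k))
         (Csub (mulmm N P (adj P) i k) (mulmm N P (adj idm) i k))).
      + unfold mulmm. rewrite <- !csum_sub, <- csum_add. apply csum_ext; intros.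
        unfold D, msub, adj. rewrite Cconj_sub. ring.
      + assert (E1 : meq N (mulmm N idm (adj idm)) idm) by (rewrite adj_idm; apply mulmm_1l).
        assert (E2 : meq N (mulmm N idm (adj P)) P) by (rewrite mulmm_1l; exact Padj).
        assert (E3 : meq N (mulmm N P (adj P)) P) by (rewrite Padj; exact PP).
        assert (E4 : meq N (mulmm N P (adj idm)) P) by (rewrite adj_idm; apply mulmm_1r).
        rewrite E1, E2, E3, E4 by assumption. unfold D, msub. ring.
    - unfold mtrace in *. unfold D, msub. rewrite csum_sub, TP. ring. }
  assert (Dz : forall i, (i < N)%nat -> veq N (D i) vzero).
  { intros i Hi. apply cinner_self_zero.
    apply (f_equal fst) in TD. rewrite csum_re in TD.
    refine (rsum_zero_inv N (fun i => fst (cinner N (D i) (D i))) _ TD i Hi).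
    intros k _. rewrite cinner_self_re. apply rsum_nonneg; intros. apply Rle_0_sqr. }
  intros i j Hi Hj. symmetry. apply Csub_eq0. exact (Dz i Hi j Hj).
Qed.

(** * Gram matrices and the parametrization of Lagrangian planes *)

Definition madd (M P : mat) : mat := fun i j => Cadd (M i j) (P i j).
Definition vneg (v : vec) : vec := fun i => Copp (v i).

(* This is [T^* T'] for [T g = (- B^* g, A^* g)] and [T' g = (- B'^* g, A'^* g)]. *)
Definition gram N (A B A' B' : mat) : mat := madd (mulmm N A (adj A')) (mulmm N B (adj B')).

Definition full_rank N (A B : mat) : Prop :=
  forall g, veq N (mulmv N (adj A) g) vzero -> veq N (mulmv N (adj B) g) vzero -> veq N g vzero.

Lemma mulmv_madd N M P v i : mulmv N (madd M P) v i = Cadd (mulmv N M v i) (mulmv N P v i).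
Proof. unfold mulmv, madd. rewrite <- csum_add. apply csum_ext; intros; ring. Qed.
Lemma mulmv_lin N M c v w i :
  mulmv N M (vadd (vscale c v) w) i = Cadd (Cmul c (mulmv N M v i)) (mulmv N M w i).
Proof.
  unfold mulmv, vadd, vscale. rewrite <- csum_mul_l, <- csum_add. apply csum_ext; intros; ring.
Qed.
Lemma mulmv_neg N M v i : mulmv N M (vneg v) i = Copp (mulmv N M v i).
Proof. unfold mulmv, vneg. rewrite <- csum_opp. apply csum_ext; intros; ring. Qed.

Lemma csum_trunc k n f : (k <= n)%nat -> (forall i, (k <= i < n)%nat -> f i = C0) ->
  csum n f = csum k f.
Proof.
  induction n as [|n IH]; intros L H.
  - replace k with 0%nat by lia. reflexivity.
  - destruct (Nat.eq_dec k (S n)) as [->|]; [reflexivity|]. simpl.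
    rewrite IH, H by (intros; try apply H; lia). ring.
Qed.

Lemma cinner_gram N A B g :
  cinner N (mulmv N (gram N A B A B) g) g =
  Cadd (cinner N (mulmv N (adj A) g) (mulmv N (adj A) g))
       (cinner N (mulmv N (adj B) g) (mulmv N (adj B) g)).
Proof.
  rewrite <- 2!(cinner_adj N _ (mulmv N _ g) g).
  unfold cinner at 2 3. rewrite <- csum_add. apply csum_ext; intros i Hi.
  unfold gram. rewrite mulmv_madd.
  rewrite 2!(mulmv_assoc N _ _ g i Hi). ring.
Qed.

(** A kernel vector of a leading block, extended by zero to [g'], is isotropic for the full form
    |A^* g'|^2 + |B^* g'|^2. Both terms vanish, and full rank gives g' = 0. *)
Lemma gram_inverse N A B : full_rank N A B ->
  exists Qi, meq N (mulmm N (gram N A B A B) Qi) idm /\ meq N (mulmm N Qi (gram N A B A B)) idm.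
Proof.
  intros H. apply leading_blocks_injective_inverse. intros k Hk g Hg.
  set (g' := fun i => if Nat.ltb i k then g i else C0).
  assert (g'k : forall i, (i < k)%nat -> g' i = g i).
  { intros i Hi. unfold g'. destruct (Nat.ltb_spec i k); [reflexivity|lia]. }
  assert (g'0 : forall i, (k <= i)%nat -> g' i = C0).
  { intros i Hi. unfold g'. destruct (Nat.ltb_spec i k); [lia|reflexivity]. }
  assert (E : cinner N (mulmv N (gram N A B A B) g') g' = C0).
  { unfold cinner. rewrite (csum_trunc k) by (try assumption; intros; rewrite g'0 by lia; cx).
    apply csum_zero; intros i Hi.
    replace (mulmv N (gram N A B A B) g' i) with C0; [ring|].
    change C0 with (vzero i). rewrite <- (Hg i Hi). unfold mulmv at 2.
    rewrite (csum_trunc k) by (try assumption; intros; rewrite g'0 by lia; ring).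
    apply csum_ext; intros; rewrite g'k by assumption; reflexivity. }
  rewrite cinner_gram in E. apply (f_equal fst) in E. unfold Cadd, C0 in E; simpl in E.
  assert (P : forall x, 0 <= fst (cinner N x x)).
  { intros x. rewrite cinner_self_re. apply rsum_nonneg; intros; apply Rle_0_sqr. }
  pose proof (P (mulmv N (adj A) g')). pose proof (P (mulmv N (adj B) g')).
  assert (Z : veq N g' vzero) by (apply H; apply cinner_self_zero; lra).
  intros i Hi. rewrite <- g'k by assumption. apply Z; lia.
Qed.

Lemma in_bc_mulmv N A B v w :
  in_bc N A B v w <-> forall i, (i < N)%nat -> Cadd (mulmv N A v i) (mulmv N B w i) = C0.
Proof.
  unfold in_bc, mulmv. split; intros H i Hi; specialize (H i Hi);
    [rewrite csum_add in H|rewrite csum_add]; exact H.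
Qed.

Definition plane_of N (A B : mat) (g : vec) : vec2 :=
  (vneg (mulmv N (adj B) g), mulmv N (adj A) g).

Lemma Lplane_plane_of N A B g :
  meq N (mulmm N A (adj B)) (mulmm N B (adj A)) -> Lplane N A B (plane_of N A B g).
Proof.
  intros H. apply in_bc_mulmv. intros i Hi. simpl. rewrite mulmv_neg.
  rewrite <- 2!(mulmv_assoc N _ _ g i Hi).
  assert (E : veq N (mulmv N (mulmm N A (adj B)) g) (mulmv N (mulmm N B (adj A)) g))
    by (rewrite H; reflexivity).
  rewrite E by assumption. ring.
Qed.

Definition Ci : Cx := (0, 1).
Definition cayley (s : Cx) (A B : mat) : mat := fun i j => Cadd (A i j) (Cmul s (B i j)).

(* With [s = i, -i], [Z = A + s B] satisfies [Z Z^* = A A^* + B B^*] and, on the plane,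
   [Z (z1 - s z2) = - s (A z2 - B z1)]. *)
Lemma Lplane_param N A B v :
  full_rank N A B -> meq N (mulmm N A (adj B)) (mulmm N B (adj A)) ->
  Lplane N A B v -> exists g, v2eq N v (plane_of N A B g).
Proof.
  intros Hr Hs Hv. unfold Lplane in Hv. rewrite in_bc_mulmv in Hv.
  destruct (gram_inverse N A B Hr) as [Qi [R L]].
  (* With T the parametrization by [plane_of], [r] is T^* v, so Q^-1 T^* v is the only possible
     parameter if v = T g. *)
  set (r := fun i => Csub (mulmv N A (snd v) i) (mulmv N B (fst v) i)).
  set (g := mulmv N Qi r). exists g.
  assert (K : forall s, Cmul s (Cconj s) = C1 -> Cadd s (Cconj s) = C0 -> forall i, (i < N)%nat ->
     Csub (fst v i) (Cmul s (snd v i)) =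
     Copp (Cadd (Cmul s (mulmv N (adj A) g i)) (mulmv N (adj B) g i))).
  { intros s s1 s0.
    assert (sc : Cconj s = Copp s).
    { replace (Copp s) with (Csub (Cadd s (Cconj s)) s) by (rewrite s0; ring). ring. }
    assert (ZZ : meq N (mulmm N (cayley s A B) (adj (cayley s A B))) (gram N A B A B)).
    { intros i k Hi Hk.
      transitivity (Cadd (Cadd (mulmm N A (adj A) i k) (Cmul (Cmul s (Cconj s)) (mulmm N B (adj B) i k)))
        (Cadd (Cmul (Cconj s) (mulmm N A (adj B) i k)) (Cmul s (mulmm N B (adj A) i k)))).
      - unfold mulmm. rewrite <- !csum_mul_l, <- !csum_add. apply csum_ext; intros.
        unfold cayley, adj. rewrite Cconj_add, Cconj_mul. ring.
      - rewrite s1, sc, (Hs i k Hi Hk). unfold gram, madd. ring. }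
    assert (I := isometry_of_coisometry N _ _ Qi ZZ R L).
    set (y := fun i => Csub (fst v i) (Cmul s (snd v i))).
    assert (Zy : veq N (mulmv N (cayley s A B) y) (fun i => Cmul (Copp s) (r i))).
    { intros i Hi.
      transitivity (Cadd (Csub (mulmv N A (fst v) i) (Cmul (Cmul s s) (mulmv N B (snd v) i)))
         (Cmul s (Csub (mulmv N B (fst v) i) (mulmv N A (snd v) i)))).
      - unfold mulmv. rewrite <- !csum_sub, <- !csum_mul_l, <- csum_sub, <- csum_add.
        apply csum_ext; intros. unfold cayley, y. ring.
      - replace (Cmul s s) with (Copp C1) by (rewrite <- s1, sc; ring).
        transitivity (Cadd (Cadd (mulmv N A (fst v) i) (mulmv N B (snd v) i))
          (Cmul s (Csub (mulmv N B (fst v) i) (mulmv N A (snd v) i)))); [ring|].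
        rewrite (Hv i Hi). unfold r. ring. }
    (* Z^* Q^-1 Z = I recovers [y] from Z y, and on the plane Z y depends on [r] alone. *)
    assert (E : veq N y (mulmv N (adj (cayley s A B)) (mulmv N Qi (fun i => Cmul (Copp s) (r i))))).
    { rewrite <- Zy, <- 2!mulmv_assoc. rewrite mulmm_assoc, I, mulmv_1. reflexivity. }
    intros i Hi. refine (eq_trans (E i Hi) _).
    assert (Eg : forall j, mulmv N Qi (fun i => Cmul (Copp s) (r i)) j = Cmul (Copp s) (g j)).
    { intros j. unfold g, mulmv. rewrite <- csum_mul_l. apply csum_ext; intros; ring. }
    transitivity (Cmul (Copp s) (Cadd (mulmv N (adj A) g i) (Cmul (Cconj s) (mulmv N (adj B) g i)))).
    - unfold mulmv at 1. rewrite (csum_ext N _ _ (fun j _ => f_equal (Cmul _) (Eg j))).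
      unfold mulmv. rewrite <- !csum_mul_l, <- csum_add, <- csum_mul_l.
      apply csum_ext; intros. unfold cayley, adj. rewrite Cconj_add, Cconj_mul. ring.
    - replace (Cmul (Copp s) (Cadd (mulmv N (adj A) g i) (Cmul (Cconj s) (mulmv N (adj B) g i))))
        with (Copp (Cadd (Cmul s (mulmv N (adj A) g i)) (Cmul (Cmul s (Cconj s)) (mulmv N (adj B) g i)))) by ring.
      rewrite s1. ring. }
  (* Both v1 - i v2 and v1 + i v2 are now known in terms of [g]; their half sum and half difference
     give the components of [v]. *)
  assert (K1 := K Ci ltac:(unfold Ci; cx) ltac:(unfold Ci; cx)).
  assert (K2 := K (Copp Ci) ltac:(unfold Ci; cx) ltac:(unfold Ci; cx)).
  split; intros i Hi; specialize (K1 i Hi); specialize (K2 i Hi); simpl; unfold vneg;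
    apply (f_equal fst) in K1 as K1f; apply (f_equal snd) in K1 as K1s;
    apply (f_equal fst) in K2 as K2f; apply (f_equal snd) in K2 as K2s;
    unfold Ci, Csub, Cadd, Copp, Cmul in *; simpl in *; apply Cx_eq; simpl; lra.
Qed.

(** Pairing with a vector of the plane measures the defect of [z] in the boundary condition, since
    [A] and [B] can be moved across the inner product. Both the eigenvalue derivative and the
    crossing form are read off from this identity. *)
Lemma omega_plane_of N A B z g :
  omega N z (plane_of N A B g) =
  Copp (cinner N (fun i => Cadd (mulmv N A (fst z) i) (mulmv N B (snd z) i)) g).
Proof.
  transitivity (Copp (Cadd (cinner N (fst z) (mulmv N (adj A) g)) (cinner N (snd z) (mulmv N (adj B) g)))).
  - unfold omega, cinner, plane_of; simpl. rewrite <- csum_add, <- csum_opp.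
    apply csum_ext; intros; unfold vneg. rewrite Cconj_opp. ring.
  - rewrite <- 2!cinner_adj. unfold cinner. rewrite <- csum_add. f_equal.
    apply csum_ext; intros; ring.
Qed.

Lemma omega_conj N z w : Cconj (omega N z w) = Copp (omega N w z).
Proof.
  unfold omega. rewrite csum_conj, <- csum_opp. apply csum_ext; intros.
  rewrite Cconj_sub, !Cconj_mul, !Cconj_conj. ring.
Qed.

Lemma omega_v2eq N z z' w w' : v2eq N z z' -> v2eq N w w' -> omega N z w = omega N z' w'.
Proof.
  intros [H1 H2] [H3 H4]. apply csum_ext; intros i Hi. rewrite H1, H2, H3, H4; auto.
Qed.

Lemma in_bc_veq N A B v v' w w' : veq N v v' -> veq N w w' -> in_bc N A B v w -> in_bc N A B v' w'.
Proof.
  intros Hv Hw H i Hi. rewrite <- (H i Hi). apply csum_ext; intros. rewrite Hv, Hw; auto.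
Qed.

(** * Limits along filters *)

(** The same limit laws serve real variables in a domain, punctured domains and sequences.
    Properness is not among the axioms, so uniqueness of limits takes it as a separate
    hypothesis. *)
Record is_filter {T : Type} (F : (T -> Prop) -> Prop) : Prop := {
  filter_top : F (fun _ => True);
  filter_and2 : forall P Q, F P -> F Q -> F (fun x => P x /\ Q x);
  filter_mono : forall P Q : T -> Prop, (forall x, P x -> Q x) -> F P -> F Q }.

Definition near (D : R -> Prop) (x : R) (P : R -> Prop) : Prop :=
  exists delta, delta > 0 /\ forall y, D y -> Rabs (y - x) < delta -> P y.
Definition evtl (P : nat -> Prop) : Prop := exists n0, forall n, (n0 <= n)%nat -> P n.

Lemma near_filter D x : is_filter (near D x).
Proof.
  split.
  - exists 1; split; [lra|auto].
  - intros P Q [d [Hd HP]] [e [He HQ]]. exists (Rmin d e). split; [apply Rmin_pos; lra|].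
    intros y Dy Hy. pose proof (Rmin_l d e). pose proof (Rmin_r d e).
    split; [apply HP|apply HQ]; auto; lra.
  - intros P Q H [d [Hd HP]]. exists d; split; auto.
Qed.
Lemma evtl_filter : is_filter evtl.
Proof.
  split.
  - exists 0%nat; auto.
  - intros P Q [n HP] [k HQ]. exists (n + k)%nat. intros; split; [apply HP|apply HQ]; lia.
  - intros P Q H [n HP]. exists n; auto.
Qed.

Definition tends {T} (F : (T -> Prop) -> Prop) (g : T -> Cx) (l : Cx) : Prop :=
  forall eps, eps > 0 -> F (fun y => Cnorm (Csub (g y) l) < eps).

Section Tends.
Context {T : Type} (F : (T -> Prop) -> Prop) (HF : is_filter F).

Lemma tends_const c : tends F (fun _ => c) c.
Proof.
  intros eps He. apply (filter_mono F HF (fun _ => True)); [|apply (filter_top F HF)].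
  intros _ _. replace (Csub c c) with C0 by ring. rewrite Cnorm_0; lra.
Qed.
Lemma tends_ext_F f g l : F (fun y => f y = g y) -> tends F f l -> tends F g l.
Proof.
  intros E H eps He. refine (filter_mono F HF _ _ _ (filter_and2 F HF _ _ E (H eps He))).
  intros y [Ey Hy]. rewrite <- Ey; exact Hy.
Qed.
Lemma tends_ext f g l : (forall y, f y = g y) -> tends F f l -> tends F g l.
Proof.
  intros E. apply tends_ext_F.
  apply (filter_mono F HF (fun _ => True)); [auto|apply (filter_top F HF)].
Qed.
Lemma tends_add f g l k : tends F f l -> tends F g k -> tends F (fun y => Cadd (f y) (g y)) (Cadd l k).
Proof.
  intros Hf Hg eps He.
  refine (filter_mono F HF _ _ _ (filter_and2 F HF _ _ (Hf (eps/2) ltac:(lra)) (Hg (eps/2) ltac:(lra)))).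
  intros y [A B]. pose proof (Cnorm_add (Csub (f y) l) (Csub (g y) k)).
  replace (Csub (Cadd (f y) (g y)) (Cadd l k)) with (Cadd (Csub (f y) l) (Csub (g y) k)) by ring.
  lra.
Qed.
(** Boundedness of one factor suffices when the other tends to zero. Continuity of matrix inverses
    is obtained this way, from a bound on the inverses alone. *)
Lemma tends_bounded_mul0 b f g : F (fun y => Cnorm (f y) <= b) -> tends F g C0 ->
  tends F (fun y => Cmul (f y) (g y)) C0.
Proof.
  intros Hf Hg eps He.
  assert (P : 0 < Rabs b + 1) by (pose proof (Rabs_pos b); lra).
  refine (filter_mono F HF _ _ _ (filter_and2 F HF _ _ Hf (Hg (eps / (Rabs b + 1)) _))).
  2:{ apply Rdiv_lt_0_compat; lra. }
  intros y [A B].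
  replace (Csub (Cmul (f y) (g y)) C0) with (Cmul (f y) (Csub (g y) C0)) by ring.
  rewrite Cnorm_mul. pose proof (Cnorm_ge0 (f y)). pose proof (Cnorm_ge0 (Csub (g y) C0)).
  pose proof (RRle_abs b).
  apply Rle_lt_trans with ((Rabs b) * Cnorm (Csub (g y) C0)); [nra|].
  apply Rmult_lt_compat_l with (r := Rabs b + 1) in B; [|lra].
  replace ((Rabs b + 1) * (eps / (Rabs b + 1))) with eps in B by (field; lra). nra.
Qed.
Lemma tends_bounded f l : tends F f l -> F (fun y => Cnorm (f y) <= Cnorm l + 1).
Proof.
  intros H. refine (filter_mono F HF _ _ _ (H 1 ltac:(lra))). intros y A.
  pose proof (Cnorm_add (Csub (f y) l) l) as B.
  replace (Cadd (Csub (f y) l) l) with (f y) in B by ring. lra.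
Qed.
Lemma tends_sub0 f l : tends F f l -> tends F (fun y => Csub (f y) l) C0.
Proof.
  intros H eps He. refine (filter_mono F HF _ _ _ (H eps He)). intros y A.
  replace (Csub (Csub (f y) l) C0) with (Csub (f y) l) by ring. exact A.
Qed.
Lemma tends_of_sub0 f l : tends F (fun y => Csub (f y) l) C0 -> tends F f l.
Proof.
  intros H eps He. refine (filter_mono F HF _ _ _ (H eps He)). intros y A.
  replace (Csub (f y) l) with (Csub (Csub (f y) l) C0) by ring. exact A.
Qed.
Lemma tends_mul f g l k : tends F f l -> tends F g k -> tends F (fun y => Cmul (f y) (g y)) (Cmul l k).
Proof.
  intros Hf Hg.
  replace (Cmul l k) with (Cadd C0 (Cadd C0 (Cmul l k))) by ring.
  apply (tends_ext (fun y => Cadd (Cmul (f y) (Csub (g y) k)) (Cadd (Cmul k (Csub (f y) l)) (Cmul l k)))).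
  { intros; ring. }
  apply tends_add; [|apply tends_add; [|apply tends_const]].
  - apply (tends_bounded_mul0 (Cnorm l + 1)); [apply tends_bounded, Hf|apply tends_sub0, Hg].
  - apply (tends_bounded_mul0 (Cnorm k)); [|apply tends_sub0, Hf].
    apply (filter_mono F HF (fun _ => True)); [intros; lra|apply (filter_top F HF)].
Qed.
Lemma tends_conj f l : tends F f l -> tends F (fun y => Cconj (f y)) (Cconj l).
Proof.
  intros H eps He. refine (filter_mono F HF _ _ _ (H eps He)). intros y A.
  rewrite <- Cconj_sub, Cnorm_conj. exact A.
Qed.
Lemma tends_opp f l : tends F f l -> tends F (fun y => Copp (f y)) (Copp l).
Proof.
  intros H. replace (Copp l) with (Cmul (Copp C1) l) by ring.
  apply (tends_ext (fun y => Cmul (Copp C1) (f y))); [intros; ring|].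
  apply tends_mul; [apply tends_const|exact H].
Qed.
Lemma tends_sub f g l k : tends F f l -> tends F g k -> tends F (fun y => Csub (f y) (g y)) (Csub l k).
Proof. intros; apply tends_add; [|apply tends_opp]; assumption. Qed.
Lemma tends_csum n (f : nat -> T -> Cx) l : (forall i, (i < n)%nat -> tends F (f i) (l i)) ->
  tends F (fun y => csum n (fun i => f i y)) (csum n l).
Proof.
  induction n as [|n IH]; intros H; simpl; [apply tends_const|].
  apply tends_add; [apply IH; intros; apply H; lia|apply H; lia].
Qed.
Lemma tends_unique f l k : ~ F (fun _ => False) -> tends F f l -> tends F f k -> l = k.
Proof.
  intros NF Hl Hk. apply Csub_eq0, Cnorm_eq0.
  destruct (Req_dec (Cnorm (Csub l k)) 0) as [E|E]; [exact E|exfalso].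
  pose proof (Cnorm_ge0 (Csub l k)). set (e := Cnorm (Csub l k)) in *.
  apply NF. refine (filter_mono F HF _ _ _ (filter_and2 F HF _ _ (Hl (e/2) ltac:(lra)) (Hk (e/2) ltac:(lra)))).
  intros y [A B]. pose proof (Cnorm_add (Csub l (f y)) (Csub (f y) k)) as C.
  replace (Cadd (Csub l (f y)) (Csub (f y) k)) with (Csub l k) in C by ring.
  rewrite (Cnorm_sub_sym l (f y)) in C. fold e in C. lra.
Qed.
Lemma filter_forall_lt n (P : nat -> T -> Prop) : (forall i, (i < n)%nat -> F (P i)) ->
  F (fun y => forall i, (i < n)%nat -> P i y).
Proof.
  induction n as [|n IH]; intros H.
  - refine (filter_mono F HF _ _ _ (filter_top F HF)). intros; lia.
  - assert (H1 := IH (fun i Hi => H i (Nat.lt_lt_succ_r _ _ Hi))).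
    assert (H2 := H n (Nat.lt_succ_diag_r n)).
    refine (filter_mono F HF _ _ _ (filter_and2 F HF _ _ H1 H2)).
    intros y [A B] i Hi. destruct (Nat.eq_dec i n) as [->|]; [exact B|apply A; lia].
Qed.
End Tends.

(** * Derivatives as limits of difference quotients *)

Definition punct (D : R -> Prop) (x y : R) : Prop := D y /\ y <> x.
Definition quot (g : R -> Cx) (x y : R) : Cx := Cscale (/ (y - x)) (Csub (g y) (g x)).

Lemma near_sub D D' x P : (forall y, D' y -> D y) -> near D x P -> near D' x P.
Proof. intros H [d [Hd HP]]. exists d; split; auto. Qed.

Lemma cderiv_tends D g x l : cderiv_pt D g x l <-> tends (near (punct D x) x) (quot g x) l.
Proof.
  split; intros H eps He; destruct (H eps He) as [d [Hd Hy]]; exists d; split; auto.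
  - intros y [Dy Ny] Ly. apply Hy; auto.
  - intros y Dy Ny Ly. apply Hy; [split|]; auto.
Qed.
Lemma ccont_tends D g : ccont_on D g <-> forall x, D x -> tends (near D x) g (g x).
Proof. reflexivity. Qed.

Lemma cderiv_sub D D' g x l : (forall y, D' y -> D y) -> cderiv_pt D g x l -> cderiv_pt D' g x l.
Proof.
  intros HD H eps He. destruct (H eps He) as [d [Hd Hy]]. exists d; split; auto.
Qed.
Lemma tends_sub_dom D D' x g l : (forall y, D' y -> D y) -> tends (near D x) g l -> tends (near D' x) g l.
Proof. intros HD H eps He. apply (near_sub D); auto. Qed.
Lemma cderiv_ext D f g x l : D x -> (forall y, D y -> f y = g y) -> cderiv_pt D f x l -> cderiv_pt D g x l.
Proof.
  intros Dx E H eps He. destruct (H eps He) as [d [Hd Hy]]. exists d; split; auto.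
  intros y Dy Ny Ly. rewrite <- !E by assumption. auto.
Qed.

Section Cderiv.
Variables (D : R -> Prop) (x : R).
Let HF := near_filter (punct D x) x.

Lemma cderiv_const c : cderiv_pt D (fun _ => c) x C0.
Proof.
  apply cderiv_tends. apply (tends_ext _ HF (fun _ => C0)); [|apply (tends_const _ HF)].
  intros y. unfold quot. cx.
Qed.
Lemma cderiv_add f g l k : cderiv_pt D f x l -> cderiv_pt D g x k ->
  cderiv_pt D (fun y => Cadd (f y) (g y)) x (Cadd l k).
Proof.
  rewrite !cderiv_tends. intros H1 H2.
  refine (tends_ext _ HF _ _ _ _ (tends_add _ HF _ _ _ _ H1 H2)). unfold quot; cx.
Qed.
Lemma cderiv_tends_cont f l : cderiv_pt D f x l -> tends (near (punct D x) x) f (f x).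
Proof.
  rewrite cderiv_tends. intros H. apply (tends_of_sub0 _ HF).
  replace C0 with (Cmul l C0) by ring.
  apply (tends_ext_F _ HF (fun y => Cmul (quot f x y) (RtoC (y - x)))).
  - exists 1; split; [lra|]. intros y [_ Ny] _. unfold quot. cx; field; lra.
  - apply (tends_mul _ HF); [exact H|]. intros eps He. exists eps; split; auto.
    intros y _ Hy. replace (Csub (RtoC (y - x)) C0) with (RtoC (y - x)) by ring.
    rewrite Cnorm_RtoC. exact Hy.
Qed.
Lemma cderiv_mul f g l k : cderiv_pt D f x l -> cderiv_pt D g x k ->
  cderiv_pt D (fun y => Cmul (f y) (g y)) x (Cadd (Cmul l (g x)) (Cmul (f x) k)).
Proof.
  intros H1 H2. pose proof (cderiv_tends_cont _ _ H2) as H3.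
  rewrite cderiv_tends in *.
  apply (tends_ext _ HF (fun y => Cadd (Cmul (quot f x y) (g y)) (Cmul (f x) (quot g x y)))).
  - intros y. unfold quot; cx.
  - apply (tends_add _ HF); apply (tends_mul _ HF); auto. apply (tends_const _ HF).
Qed.
Lemma cderiv_conj f l : cderiv_pt D f x l -> cderiv_pt D (fun y => Cconj (f y)) x (Cconj l).
Proof.
  rewrite !cderiv_tends. intros H.
  refine (tends_ext _ HF _ _ _ _ (tends_conj _ HF _ _ H)). unfold quot; cx.
Qed.
Lemma cderiv_opp f l : cderiv_pt D f x l -> cderiv_pt D (fun y => Copp (f y)) x (Copp l).
Proof.
  rewrite !cderiv_tends. intros H.
  refine (tends_ext _ HF _ _ _ _ (tends_opp _ HF _ _ H)). unfold quot; cx.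
Qed.
Lemma cderiv_csum n (f : nat -> R -> Cx) l : (forall i, (i < n)%nat -> cderiv_pt D (f i) x (l i)) ->
  cderiv_pt D (fun y => csum n (fun i => f i y)) x (csum n l).
Proof.
  induction n as [|n IH]; intros H; simpl; [apply cderiv_const|].
  apply cderiv_add; [apply IH; intros; apply H; lia|apply H; lia].
Qed.
Lemma cderiv_cont f l : cderiv_pt D f x l -> tends (near D x) f (f x).
Proof.
  intros H eps He. destruct (cderiv_tends_cont _ _ H eps He) as [d [Hd Hy]].
  exists d; split; auto. intros y Dy Ly. destruct (Req_dec y x) as [->|N].
  - replace (Csub (f x) (f x)) with C0 by ring. rewrite Cnorm_0; lra.
  - apply Hy; [split|]; auto.
Qed.
End Cderiv.

Lemma cderiv_unique a b x f l k : a < x < b -> cderiv_pt (Ioo a b) f x l -> cderiv_pt (Ioo a b) f x k -> l = k.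
Proof.
  intros Hx H1 H2. rewrite cderiv_tends in *.
  refine (tends_unique _ (near_filter _ _) _ _ _ _ H1 H2).
  (* The punctured filter is proper: this point to the right of [x] lies in the interval and within
     distance [d]. *)
  intros [d [Hd H]]. apply (H (x + Rmin (d/2) ((b - x)/2))).
  - pose proof (Rmin_pos (d/2) ((b-x)/2) ltac:(lra) ltac:(lra)).
    pose proof (Rmin_r (d/2) ((b-x)/2)). split; [split|]; lra.
  - pose proof (Rmin_pos (d/2) ((b-x)/2) ltac:(lra) ltac:(lra)).
    pose proof (Rmin_l (d/2) ((b-x)/2)).
    replace (x + Rmin (d/2) ((b - x)/2) - x) with (Rmin (d/2) ((b - x)/2)) by ring.
    rewrite Rabs_pos_eq; lra.
Qed.

(** * The crossing form *)

Lemma rsum_swap n k (f : nat -> nat -> R) :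
  rsum n (fun i => rsum k (fun j => f i j)) = rsum k (fun j => rsum n (fun i => f i j)).
Proof.
  induction n as [|n IH]; simpl.
  - rewrite rsum_const; ring.
  - rewrite IH, <- rsum_add. reflexivity.
Qed.

(** The maximal column sum is the operator norm on l^1, so this says that M - I has norm at most
    1/2. Dropping rows and columns only lowers the sums, hence leading blocks inherit the
    condition. *)
Definition near_idm n (M : mat) : Prop :=
  forall j, (j < n)%nat -> rsum n (fun i => Cnorm (Csub (M i j) (idm i j))) <= 1 / 2.

(** Neumann estimate: |x| <= |M x| + |(M - I) x| in the l^1 norm, and the last term is at most |x| /
    2. *)
Lemma near_idm_bound n M x : near_idm n M ->
  rsum n (fun i => Cnorm (x i)) <= 2 * rsum n (fun i => Cnorm (mulmv n M x i)).
Proof.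
  intros H.
  assert (A : rsum n (fun i => Cnorm (x i)) <= rsum n (fun i => Cnorm (mulmv n M x i) +
     rsum n (fun j => Cnorm (Csub (M i j) (idm i j)) * Cnorm (x j)))).
  { apply rsum_le; intros i Hi.
    replace (x i) with (Cadd (mulmv n M x i)
      (Copp (csum n (fun j => Cmul (Csub (M i j) (idm i j)) (x j))))).
    - eapply Rle_trans; [apply Cnorm_add|]. apply Rplus_le_compat_l. rewrite Cnorm_opp.
      eapply Rle_trans; [apply Cnorm_csum|]. apply rsum_le; intros. rewrite Cnorm_mul; lra.
    - rewrite <- (csum_delta n i x Hi). unfold mulmv.
      rewrite <- csum_opp, <- csum_add. apply csum_ext; intros; ring. }
  rewrite rsum_add, rsum_swap in A.
  assert (B : rsum n (fun j => rsum n (fun i => Cnorm (Csub (M i j) (idm i j)) * Cnorm (x j)))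
     <= 1 / 2 * rsum n (fun j => Cnorm (x j))).
  { rewrite <- rsum_mul_l. apply rsum_le; intros j Hj.
    rewrite (rsum_ext n _ (fun i => Cnorm (x j) * Cnorm (Csub (M i j) (idm i j))))
      by (intros; ring).
    rewrite rsum_mul_l. specialize (H j Hj). pose proof (Cnorm_ge0 (x j)). nra. }
  lra.
Qed.

Lemma near_idm_leading k n M : (k <= n)%nat -> near_idm n M -> near_idm k M.
Proof.
  intros L H j Hj. eapply Rle_trans; [|apply (H j); lia].
  apply rsum_mono_n; [intros; apply Cnorm_ge0|exact L].
Qed.

Lemma near_idm_inverse n M : near_idm n M ->
  exists X, meq n (mulmm n M X) idm /\ meq n (mulmm n X M) idm.
Proof.
  intros H. apply leading_blocks_injective_inverse. intros k Hk g Hg i Hi.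
  pose proof (near_idm_bound k M g (near_idm_leading k n M Hk H)) as B.
  rewrite (rsum_ext k (fun i => Cnorm (mulmv k M g i)) (fun _ => 0)), rsum_const in B.
  2:{ intros j Hj. rewrite (Hg j Hj). apply Cnorm_0. }
  apply Cnorm_eq0.
  pose proof (rsum_term_le k (fun i => Cnorm (g i)) i (fun j _ => Cnorm_ge0 (g j)) Hi).
  pose proof (Cnorm_ge0 (g i)). cbv beta in *. lra.
Qed.

(** [M] sends a column of [X] to a column of the identity, of l^1 norm 1. The constant 2 bounds the
    inverses along a whole path before anything is known about their dependence on t. *)
Lemma near_idm_inverse_bound n M X : near_idm n M -> meq n (mulmm n M X) idm ->
  forall i j, (i < n)%nat -> (j < n)%nat -> Cnorm (X i j) <= 2.
Proof.
  intros H E i j Hi Hj. pose proof (near_idm_bound n M (fun i => X i j) H) as B.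
  rewrite (rsum_ext n (fun i0 => Cnorm (mulmv n M (fun i => X i j) i0)) (fun i => Cnorm (idm i j))) in B.
  2:{ intros k Hk. f_equal. exact (E k j Hk Hj). }
  assert (S : rsum n (fun i => Cnorm (idm i j)) <= 1).
  (* Strengthened for the induction: the partial sums are zero until index [j] is passed, so its
     entry 1 is added to 0. *)
  { clear - Hj. assert (G : forall n, rsum n (fun i => Cnorm (idm i j)) <= 1 /\
      ((n <= j)%nat -> rsum n (fun i => Cnorm (idm i j)) = 0)).
    { clear. induction n as [|n [IH1 IH2]]; simpl; [split; intros; lra|].
      unfold idm at 2 4. destruct (Nat.eqb_spec n j).
      - rewrite IH2 by lia. change C1 with (RtoC 1). rewrite Cnorm_RtoC, Rabs_R1.
        split; [lra|lia].
      - rewrite Cnorm_0. split; [lra|]. intros; rewrite IH2 by lia; lra. }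
    apply G. }
  pose proof (rsum_term_le n (fun i => Cnorm (X i j)) i (fun k _ => Cnorm_ge0 (X k j)) Hi).
  cbv beta in *. lra.
Qed.

(** * Differentiability of the inverse along a path of matrices *)

Section InversePath.
Variables (n : nat) (D : R -> Prop) (M X dM : R -> mat).
Hypothesis HMX : forall t, D t -> meq n (mulmm n (M t) (X t)) idm.
Hypothesis HXM : forall t, D t -> meq n (mulmm n (X t) (M t)) idm.
Hypothesis HX : forall t, D t -> forall i j, (i < n)%nat -> (j < n)%nat -> Cnorm (X t i j) <= 2.
Hypothesis HM : forall i j, (i < n)%nat -> (j < n)%nat ->
  cderiv_on D (fun t => M t i j) (fun t => dM t i j) /\ ccont_on D (fun t => dM t i j).

Definition dinv (t : R) : mat :=
  mulmm n (X t) (mulmm n (fun i j => Copp (dM t i j)) (X t)).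

(** Resolvent identity: insert M_s X_s = I after X_t and X_t M_t = I before X_s. The difference of
    inverses becomes linear in M_t - M_s, which gives continuity and, after division by t - s, the
    derivative -X M' X. *)
Lemma inverse_diff s t i k : D s -> D t -> (i < n)%nat -> (k < n)%nat ->
  Csub (X t i k) (X s i k) =
  csum n (fun j => Cmul (X t i j) (csum n (fun l => Cmul (Copp (Csub (M t j l) (M s j l))) (X s l k)))).
Proof.
  intros Ds Dt Hi Hk.
  assert (E1 : meq n (mulmm n (X t) (mulmm n (M s) (X s))) (X t))
    by (rewrite (HMX s Ds); apply mulmm_1r).
  assert (E2 : meq n (mulmm n (X t) (mulmm n (M t) (X s))) (X s))
    by (rewrite <- mulmm_assoc, (HXM t Dt); apply mulmm_1l).
  rewrite <- (E1 i k Hi Hk) at 1. rewrite <- (E2 i k Hi Hk) at 1.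
  unfold mulmm. rewrite <- csum_sub. apply csum_ext; intros j Hj.
  transitivity (Cmul (X t i j) (Csub (csum n (fun l => Cmul (M s j l) (X s l k)))
    (csum n (fun l => Cmul (M t j l) (X s l k))))); [ring|].
  f_equal. rewrite <- csum_sub. apply csum_ext; intros; ring.
Qed.

Lemma inverse_cont s i k : D s -> (i < n)%nat -> (k < n)%nat ->
  tends (near D s) (fun t => X t i k) (X s i k).
Proof.
  intros Ds Hi Hk. pose proof (near_filter D s) as HF. apply (tends_of_sub0 _ HF).
  apply (tends_ext_F _ HF (fun t => csum n (fun j => Cmul (X t i j)
     (csum n (fun l => Cmul (Copp (Csub (M t j l) (M s j l))) (X s l k)))))).
  { exists 1; split; [lra|]. intros t Dt _. symmetry; apply inverse_diff; auto. }
  rewrite <- (csum_zero n (fun _ => C0)) by reflexivity. apply (tends_csum _ HF); intros j Hj.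
  (* Only the bound 2 on [X t] is available here, since its convergence is what is being proved. *)
  apply (tends_bounded_mul0 _ HF 2).
  { exists 1; split; [lra|]. intros t Dt _. apply HX; auto. }
  rewrite <- (csum_zero n (fun _ => C0)) by reflexivity. apply (tends_csum _ HF); intros l Hl.
  replace C0 with (Cmul (Copp (Csub (M s j l) (M s j l))) (X s l k)) by ring.
  apply (tends_mul _ HF); [|apply (tends_const _ HF)].
  apply (tends_opp _ HF), (tends_sub _ HF); [|apply (tends_const _ HF)].
  apply (cderiv_cont _ _ _ _ (proj1 (HM j l Hj Hl) s Ds)).
Qed.

Lemma inverse_cderiv s i k : D s -> (i < n)%nat -> (k < n)%nat ->
  cderiv_pt D (fun t => X t i k) s (dinv s i k).
Proof.
  intros Ds Hi Hk. apply cderiv_tends. pose proof (near_filter (punct D s) s) as HF.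
  apply (tends_ext_F _ HF (fun t => csum n (fun j => Cmul (X t i j)
     (csum n (fun l => Cmul (Copp (quot (fun t => M t j l) s t)) (X s l k)))))).
  { exists 1; split; [lra|]. intros t [Dt _] _. unfold quot at 2. rewrite Cscale_mul.
    rewrite inverse_diff by auto. rewrite <- csum_mul_l. apply csum_ext; intros j Hj.
    transitivity (Cmul (X t i j) (Cmul (RtoC (/ (t - s))) (csum n
        (fun l => Cmul (Copp (Csub (M t j l) (M s j l))) (X s l k))))); [|ring].
    f_equal. rewrite <- csum_mul_l. apply csum_ext; intros. unfold quot.
    rewrite Cscale_mul. ring. }
  unfold dinv, mulmm. apply (tends_csum _ HF); intros j Hj. apply (tends_mul _ HF).
  - apply (tends_sub_dom D); [intros y Hy; apply Hy|]. apply inverse_cont; auto.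
  - apply (tends_csum _ HF); intros l Hl. apply (tends_mul _ HF); [|apply (tends_const _ HF)].
    apply (tends_opp _ HF). apply cderiv_tends. apply (HM j l); auto.
Qed.

Lemma dinv_cont i k : (i < n)%nat -> (k < n)%nat -> ccont_on D (fun t => dinv t i k).
Proof.
  intros Hi Hk. rewrite ccont_tends. intros s Ds. pose proof (near_filter D s) as HF.
  unfold dinv, mulmm. apply (tends_csum _ HF); intros j Hj. apply (tends_mul _ HF).
  - apply inverse_cont; auto.
  - apply (tends_csum _ HF); intros l Hl. apply (tends_mul _ HF); [|apply inverse_cont; auto].
    apply (tends_opp _ HF). exact (proj2 (HM j l Hj Hl) s Ds).
Qed.
End InversePath.

(** The adjoint T^* of T g = (-B^* g, A^* g) for the inner product [inner2]; vectors that it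
    annihilates are orthogonal to the range of T. *)
Definition tadj N (A B : mat) (w : vec2) : vec :=
  fun i => Csub (mulmv N A (snd w) i) (mulmv N B (fst w) i).

Lemma tadj_plane_of N A B A' B' g :
  veq N (tadj N A B (plane_of N A' B' g)) (mulmv N (gram N A B A' B') g).
Proof.
  intros i Hi. unfold tadj, gram. simpl. rewrite mulmv_madd, mulmv_neg.
  rewrite <- 2!(mulmv_assoc N _ _ g i Hi). ring.
Qed.
Lemma tadj_veq N A B w w' : v2eq N w w' -> veq N (tadj N A B w) (tadj N A B w').
Proof.
  intros [H1 H2] i Hi. unfold tadj.
  assert (E1 : veq N (mulmv N A (snd w)) (mulmv N A (snd w'))) by (rewrite H2; reflexivity).
  assert (E2 : veq N (mulmv N B (fst w)) (mulmv N B (fst w'))) by (rewrite H1; reflexivity).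
  rewrite E1, E2; auto.
Qed.
Lemma inner2_plane_of N A B r g : inner2 N r (plane_of N A B g) = cinner N (tadj N A B r) g.
Proof.
  transitivity (Csub (cinner N (snd r) (mulmv N (adj A) g)) (cinner N (fst r) (mulmv N (adj B) g))).
  - unfold inner2, plane_of; simpl. unfold cinner. rewrite <- csum_add, <- csum_sub.
    apply csum_ext; intros; unfold vneg. rewrite Cconj_opp. ring.
  - rewrite <- 2!cinner_adj. unfold cinner. rewrite <- csum_sub.
    apply csum_ext; intros; unfold tadj; ring.
Qed.
Lemma plane_of_veq N A B g h : veq N g h -> v2eq N (plane_of N A B g) (plane_of N A B h).
Proof.
  intros H. split; intros i Hi; simpl; unfold vneg; [f_equal|].
  - assert (E : veq N (mulmv N (adj B) g) (mulmv N (adj B) h)) by (rewrite H; reflexivity). auto.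
  - assert (E : veq N (mulmv N (adj A) g) (mulmv N (adj A) h)) by (rewrite H; reflexivity). auto.
Qed.
Lemma v2eq_trans N u v w : v2eq N u v -> v2eq N v w -> v2eq N u w.
Proof. intros [A B] [C D]; split; etransitivity; eassumption. Qed.

Lemma mulmv_tends {T} (F : (T -> Prop) -> Prop) (HF : is_filter F) N (M : T -> mat) (x : T -> vec) M0 x0 i :
  (forall j, (j < N)%nat -> tends F (fun t => M t i j) (M0 i j)) ->
  (forall j, (j < N)%nat -> tends F (fun t => x t j) (x0 j)) ->
  tends F (fun t => mulmv N (M t) (x t) i) (mulmv N M0 x0 i).
Proof. intros HM Hx. apply (tends_csum _ HF); intros j Hj. apply (tends_mul _ HF); auto. Qed.

Lemma mulmv_cderiv D s N (M : R -> mat) (x : R -> vec) dM dx i :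
  (forall j, (j < N)%nat -> cderiv_pt D (fun t => M t i j) s (dM i j)) ->
  (forall j, (j < N)%nat -> cderiv_pt D (fun t => x t j) s (dx j)) ->
  cderiv_pt D (fun t => mulmv N (M t) (x t) i) s (Cadd (mulmv N dM (x s) i) (mulmv N (M s) dx i)).
Proof.
  intros HM Hx. unfold mulmv. rewrite <- csum_add. apply cderiv_csum; intros j Hj.
  apply (cderiv_mul D s (fun t => M t i j) (fun t => x t j)); auto.
Qed.

(** * Value of the crossing form and existence of admissible operators *)

Section Crossing.
Variables (N : nat) (A B dA dB : R -> mat) (al be t0 : R).
Hypothesis HH : hypH N A B dA dB al be.
Hypothesis Ht0 : al < t0 < be.

Let HA i j (Hi : (i < N)%nat) (Hj : (j < N)%nat) := proj1 (proj2 HH) i j Hi Hj.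
Let Hrk t (Ht : Icc al be t) : full_rank N (A t) (B t) := proj1 (proj2 (proj2 HH) t Ht).
Let Hsym t (Ht : Icc al be t) := proj2 (proj2 (proj2 HH) t Ht).
Let It0 : Icc al be t0.
Proof. split; lra. Qed.

(** Differentiation gives A R'_1 + B R'_2 = -(A' v_1 + B' v_2), where R' is [dR t0 v]. To use
    [omega_plane_of], [v] must stand in the second slot of [omega]; the skew-Hermitian symmetry that
    moves it there produces the conjugate in the hypothesis on [z]. *)
Lemma crossing_value v g z Rt dR delta :
  v2eq N v (plane_of N (A t0) (B t0) g) ->
  z = Cconj (cinner N (fun i => Cadd (mulmv N (dA t0) (fst v) i) (mulmv N (dB t0) (snd v) i)) g) ->
  admissible_R N A B t0 Rt dR delta -> z = Copp (omega N v (dR t0 v)).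
Proof.
  intros Hv Hz [Hd [Hpl [H0 Hder]]].
  assert (Lv : Lplane N (A t0) (B t0) v).
  { eapply in_bc_veq; [symmetry; apply Hv|symmetry; apply Hv|].
    apply (Lplane_plane_of N (A t0) (B t0) g). apply Hsym, It0. }
  (* The interval of radius [r] lies both in [al, be], where [A] and [B] are differentiable, and in
     the domain of R_t. It is open, so derivatives at t0 are unique. *)
  set (r := Rmin delta (Rmin (t0 - al) (be - t0))).
  assert (Hr : r > 0) by (apply Rmin_pos; [lra|apply Rmin_pos; lra]).
  assert (r1 : r <= delta) by apply Rmin_l.
  assert (r2 : r <= t0 - al /\ r <= be - t0).
  { split; (eapply Rle_trans; [apply Rmin_r|]); [apply Rmin_l|apply Rmin_r]. }
  set (D := Ioo (t0 - r) (t0 + r)).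
  assert (Dt0 : D t0) by (split; lra).
  assert (R0 := H0 v Lv). destruct R0 as [R01 R02].
  assert (E : forall i, (i < N)%nat ->
    Cadd (Cadd (mulmv N (dA t0) (fst v) i) (mulmv N (dB t0) (snd v) i))
      (Cadd (mulmv N (A t0) (fst (dR t0 v)) i) (mulmv N (B t0) (snd (dR t0 v)) i)) = C0).
  { intros i Hi.
    (* The residual of v + R_t v at time t vanishes identically, so its derivative by the product
       rule is zero. Since R_t v = 0 at t0, the terms with [dA] and [dB] see only [v]. *)
    apply (cderiv_unique (t0 - r) (t0 + r) t0 (fun _ => C0)); [lra| |apply cderiv_const].
    apply (cderiv_ext _ (fun t => Cadd (mulmv N (A t) (fun j => Cadd (fst v j) (fst (Rt t v) j)) i)
       (mulmv N (B t) (fun j => Cadd (snd v j) (snd (Rt t v) j)) i))); [exact Dt0| |].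
    - intros t Dt. destruct (Hpl t) as [_ [_ [_ Hiff]]].
      { apply Rabs_def1; destruct Dt; lra. }
      assert (L : Lplane N (A t) (B t) (v2add v (Rt t v))).
      { apply Hiff. exists v. split; [exact Lv|]. split; reflexivity. }
      unfold Lplane in L. rewrite in_bc_mulmv in L. apply (L i Hi).
    - replace (Cadd (Cadd (mulmv N (dA t0) (fst v) i) (mulmv N (dB t0) (snd v) i))
         (Cadd (mulmv N (A t0) (fst (dR t0 v)) i) (mulmv N (B t0) (snd (dR t0 v)) i)))
       with (Cadd (Cadd (mulmv N (dA t0) (fst v) i) (mulmv N (A t0) (fst (dR t0 v)) i))
                  (Cadd (mulmv N (dB t0) (snd v) i) (mulmv N (B t0) (snd (dR t0 v)) i))) by ring.
      assert (sub : forall y, D y -> Icc al be y) by (intros y [? ?]; split; lra).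
      assert (sub' : forall y, D y -> Ioo (t0 - delta) (t0 + delta) y) by (intros y [? ?]; split; lra).
      assert (Dd : Ioo (t0 - delta) (t0 + delta) t0) by auto.
      apply cderiv_add.
      + replace (mulmv N (dA t0) (fst v) i) with
          (mulmv N (dA t0) (fun j => Cadd (fst v j) (fst (Rt t0 v) j)) i).
        2:{ apply csum_ext; intros j Hj. rewrite (R01 j Hj). simpl; unfold vzero; ring. }
        apply (mulmv_cderiv D t0 N A (fun t j => Cadd (fst v j) (fst (Rt t v) j))); intros j Hj.
        * apply (cderiv_sub (Icc al be)); [exact sub|]. apply (HA i j Hi Hj), It0.
        * replace (fst (dR t0 v) j) with (Cadd C0 (fst (dR t0 v) j)) by ring.
          apply cderiv_add; [apply cderiv_const|].
          apply (cderiv_sub _ _ _ _ _ sub'). apply (Hder v Lv j Hj), Dd.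
      + replace (mulmv N (dB t0) (snd v) i) with
          (mulmv N (dB t0) (fun j => Cadd (snd v j) (snd (Rt t0 v) j)) i).
        2:{ apply csum_ext; intros j Hj. rewrite (R02 j Hj). simpl; unfold vzero; ring. }
        apply (mulmv_cderiv D t0 N B (fun t j => Cadd (snd v j) (snd (Rt t v) j))); intros j Hj.
        * apply (cderiv_sub (Icc al be)); [exact sub|]. apply (HA i j Hi Hj), It0.
        * replace (snd (dR t0 v) j) with (Cadd C0 (snd (dR t0 v) j)) by ring.
          apply cderiv_add; [apply cderiv_const|].
          apply (cderiv_sub _ _ _ _ _ sub'). apply (Hder v Lv j Hj), Dd. }
  rewrite Hz. rewrite <- omega_conj, (omega_v2eq N _ (dR t0 v) v (plane_of N (A t0) (B t0) g))
    by (try assumption; split; reflexivity).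
  rewrite omega_plane_of. f_equal. unfold cinner. rewrite <- csum_opp.
  apply csum_ext; intros i Hi. specialize (E i Hi).
  set (p := Cadd (mulmv N (dA t0) (fst v) i) (mulmv N (dB t0) (snd v) i)) in *.
  set (q := Cadd (mulmv N (A t0) (fst (dR t0 v)) i) (mulmv N (B t0) (snd (dR t0 v)) i)) in *.
  replace p with (Csub (Cadd p q) q) by ring. rewrite E. ring.
Qed.

Lemma admissible_R_exists : exists Rt dR delta, admissible_R N A B t0 Rt dR delta.
Proof.
  destruct (gram_inverse N (A t0) (B t0) (Hrk t0 It0)) as [Qi [QR QL]].
  (* [G t] is T_0^* T_t. Multiplication by Q^-1 makes [M t] the identity at t0, so near t0 its
     invertibility follows from closeness to the identity. *)
  set (G := fun t => gram N (A t0) (B t0) (A t) (B t)).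
  set (M := fun t => mulmm N Qi (G t)).
  assert (HF := near_filter (Icc al be) t0).
  assert (near_M : near (Icc al be) t0 (fun t => near_idm N (M t))).
  { apply (filter_forall_lt _ HF). intros j Hj.
    (* The column sum is embedded in [Cx] so that the complex limit laws apply to it. *)
    assert (T : tends (near (Icc al be) t0)
       (fun t => RtoC (rsum N (fun i => Cnorm (Csub (M t i j) (idm i j))))) C0).
    { assert (T' : forall i, (i < N)%nat -> tends (near (Icc al be) t0) (fun t => M t i j) (idm i j)).
      { intros i Hi. rewrite <- (QL i j Hi Hj). unfold M, mulmm. apply (tends_csum _ HF).
        intros k Hk. apply (tends_mul _ HF); [apply (tends_const _ HF)|].
        unfold G, gram, madd, mulmm. apply (tends_add _ HF); apply (tends_csum _ HF); intros l Hl;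
        (apply (tends_mul _ HF); [apply (tends_const _ HF)|]); apply (tends_conj _ HF).
        - apply (cderiv_cont _ _ _ _ (proj1 (HA j l Hj Hl) t0 It0)).
        - apply (cderiv_cont _ _ _ _ (proj1 (proj2 (proj2 (HA j l Hj Hl))) t0 It0)). }
      assert (G' : forall k, (k <= N)%nat -> tends (near (Icc al be) t0)
         (fun t => RtoC (rsum k (fun i => Cnorm (Csub (M t i j) (idm i j))))) C0).
      { induction k as [|k IH]; intros Hk; simpl; [apply (tends_const _ HF)|].
        replace C0 with (Cadd C0 C0) by ring.
        apply (tends_ext _ HF (fun t => Cadd (RtoC (rsum k (fun i => Cnorm (Csub (M t i j) (idm i j)))))
           (RtoC (Cnorm (Csub (M t k j) (idm k j)))))); [cx|].
        apply (tends_add _ HF); [apply IH; lia|].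
        intros eps He. destruct (T' k Hk eps He) as [d [Hd Hy]]. exists d; split; auto.
        intros y Dy Ly. specialize (Hy y Dy Ly).
        replace (Csub (RtoC (Cnorm (Csub (M y k j) (idm k j)))) C0)
          with (RtoC (Cnorm (Csub (M y k j) (idm k j)))) by ring.
        rewrite Cnorm_RtoC, Rabs_pos_eq by apply Cnorm_ge0. exact Hy. }
      apply G'; lia. }
    destruct (T (1/2) ltac:(lra)) as [d [Hd Hy]]. exists d; split; auto. intros y Dy Ly.
    specialize (Hy y Dy Ly).
    replace (Csub (RtoC (rsum N (fun i => Cnorm (Csub (M y i j) (idm i j))))) C0) with
      (RtoC (rsum N (fun i => Cnorm (Csub (M y i j) (idm i j))))) in Hy by ring.
    rewrite Cnorm_RtoC, Rabs_pos_eq in Hy by (apply rsum_nonneg; intros; apply Cnorm_ge0). lra. }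
  destruct near_M as [d [Hd near_M]].
  set (r := Rmin d (Rmin (t0 - al) (be - t0))).
  assert (Hr : r > 0) by (apply Rmin_pos; [lra|apply Rmin_pos; lra]).
  assert (r1 : r <= d) by apply Rmin_l.
  assert (r2 : r <= t0 - al /\ r <= be - t0).
  { split; (eapply Rle_trans; [apply Rmin_r|]); [apply Rmin_l|apply Rmin_r]. }
  set (D := Ioo (t0 - r) (t0 + r)).
  assert (DI : forall t, D t -> Icc al be t) by (intros t [? ?]; split; lra).
  assert (Dn : forall t, D t -> near_idm N (M t)).
  { intros t Dt. apply near_M; [auto|]. apply Rabs_def1; destruct Dt; lra. }
  assert (DR : forall t, Rabs (t - t0) < r -> D t).
  { intros t H. apply Rabs_def2 in H. split; lra. }
  assert (XX : forall t, exists X, D t -> meq N (mulmm N (M t) X) idm /\ meq N (mulmm N X (M t)) idm).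
  { intros t. destruct (ClassicalEpsilon.excluded_middle_informative (D t)) as [Dt|Nt].
    - destruct (near_idm_inverse N (M t) (Dn t Dt)) as [X HX]. exists X; auto.
    (* An arbitrary value outside [D], making [X] a total function. *)
    - exists (M t). intros; contradiction. }
  set (X := fun t => proj1_sig (ClassicalEpsilon.constructive_indefinite_description _ (XX t))).
  assert (HX : forall t, D t -> meq N (mulmm N (M t) (X t)) idm /\ meq N (mulmm N (X t) (M t)) idm).
  { intros t. unfold X. apply proj2_sig. }
  set (dM := fun t => mulmm N Qi (gram N (A t0) (B t0) (dA t) (dB t))).
  assert (MM : forall i j, (i < N)%nat -> (j < N)%nat ->
     cderiv_on D (fun t => M t i j) (fun t => dM t i j) /\ ccont_on D (fun t => dM t i j)).
  { intros i j Hi Hj. split.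
    - intros s Ds. unfold M, dM, mulmm. apply cderiv_csum; intros k Hk.
      replace (Cmul (Qi i k) (gram N (A t0) (B t0) (dA s) (dB s) k j)) with
        (Cadd (Cmul C0 (G s k j)) (Cmul (Qi i k) (gram N (A t0) (B t0) (dA s) (dB s) k j))) by ring.
      apply (cderiv_mul D s (fun _ => Qi i k) (fun t => G t k j)); [apply cderiv_const|].
      unfold G, gram, madd, mulmm. apply cderiv_add; apply cderiv_csum; intros l Hl; unfold adj.
      + replace (Cmul (A t0 k l) (Cconj (dA s j l))) with
          (Cadd (Cmul C0 (Cconj (A s j l))) (Cmul (A t0 k l) (Cconj (dA s j l)))) by ring.
        apply (cderiv_mul D s (fun _ => A t0 k l) (fun t => Cconj (A t j l))); [apply cderiv_const|].
        apply cderiv_conj. apply (cderiv_sub _ _ _ _ _ DI). apply (HA j l Hj Hl); auto.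
      + replace (Cmul (B t0 k l) (Cconj (dB s j l))) with
          (Cadd (Cmul C0 (Cconj (B s j l))) (Cmul (B t0 k l) (Cconj (dB s j l)))) by ring.
        apply (cderiv_mul D s (fun _ => B t0 k l) (fun t => Cconj (B t j l))); [apply cderiv_const|].
        apply cderiv_conj. apply (cderiv_sub _ _ _ _ _ DI). apply (HA j l Hj Hl); auto.
    - rewrite ccont_tends. intros s Ds. pose proof (near_filter D s) as HFs.
      unfold dM, mulmm. apply (tends_csum _ HFs); intros k Hk.
      apply (tends_mul _ HFs); [apply (tends_const _ HFs)|].
      unfold gram, madd, mulmm. apply (tends_add _ HFs); apply (tends_csum _ HFs); intros l Hl;
        (apply (tends_mul _ HFs); [apply (tends_const _ HFs)|]); apply (tends_conj _ HFs);
        apply (tends_sub_dom _ _ _ _ _ DI);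
        destruct (HA j l Hj Hl) as [_ [a2 [_ a4]]]; [exact (a2 s (DI s Ds))|exact (a4 s (DI s Ds))]. }
  assert (XB : forall t, D t -> forall i j, (i < N)%nat -> (j < N)%nat -> Cnorm (X t i j) <= 2).
  { intros t Dt. apply (near_idm_inverse_bound N (M t)); [auto|apply HX, Dt]. }
  (* [x t w] is (T_0^* T_t)^-1 T_0^* w. For [w] in the plane at t0, T_t x is thus the point of the
     plane at t whose orthogonal projection to the plane at t0 is [w]. *)
  set (y := fun w => mulmv N Qi (tadj N (A t0) (B t0) w)).
  set (x := fun t w => mulmv N (X t) (y w)).
  set (dx := fun t w => mulmv N (dinv N X dM t) (y w)).
  exists (fun t w => v2add (plane_of N (A t) (B t) (x t w)) (v2scale (Copp C1) w)).
  exists (fun t w => (fun k => Copp (Cadd (mulmv N (adj (dB t)) (x t w) k) (mulmv N (adj (B t)) (dx t w) k)),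
     fun k => Cadd (mulmv N (adj (dA t)) (x t w) k) (mulmv N (adj (A t)) (dx t w) k))).
  exists r.
  assert (Gx : forall t w, D t -> veq N (mulmv N (G t) (x t w)) (tadj N (A t0) (B t0) w)).
  { intros t w Dt. unfold x.
    rewrite <- (mulmm_1l N (G t)), <- QR, mulmm_assoc. fold (M t).
    rewrite mulmv_assoc, <- (mulmv_assoc N (M t)), (proj1 (HX t Dt)), mulmv_1. unfold y.
    rewrite <- mulmv_assoc, QR, mulmv_1. reflexivity. }
  assert (Dt0 : D t0) by (split; lra).
  split; [exact Hr|]. split; [|split].
  - intros t Ht. assert (Dt := DR t Ht). split; [|split; [|split]].
    + intros w w' Lw Hw.
      assert (Ex : veq N (x t w) (x t w')).
      { unfold x, y. rewrite (tadj_veq N _ _ _ _ Hw). reflexivity. }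
      destruct (plane_of_veq N (A t) (B t) _ _ Ex) as [E1 E2]. destruct Hw as [W1 W2].
      split; intros i Hi; simpl; unfold vadd, vscale.
      * rewrite (W1 i Hi). f_equal. apply (E1 i Hi).
      * rewrite (W2 i Hi). f_equal. apply (E2 i Hi).
    + intros w Lw z Lz.
      (* Testing against z = T_0 g amounts to applying T_0^*, which annihilates T_t x - w by
         [Gx]. *)
      destruct (Lplane_param N _ _ z (Hrk t0 It0) (Hsym t0 It0) Lz) as [g [Z1 Z2]].
      unfold inner2. rewrite (cinner_veq N _ _ _ _ (reflexivity _) Z1), (cinner_veq N _ _ _ _ (reflexivity _) Z2).
      change (inner2 N (v2add (plane_of N (A t) (B t) (x t w)) (v2scale (Copp C1) w))
         (plane_of N (A t0) (B t0) g) = C0).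
      rewrite inner2_plane_of. apply csum_zero; intros i Hi.
      replace (tadj N (A t0) (B t0) (v2add (plane_of N (A t) (B t) (x t w)) (v2scale (Copp C1) w)) i)
        with (Csub (tadj N (A t0) (B t0) (plane_of N (A t) (B t) (x t w)) i) (tadj N (A t0) (B t0) w i)).
      * rewrite (tadj_plane_of N _ _ _ _ _ i Hi). change (gram N (A t0) (B t0) (A t) (B t)) with (G t).
        rewrite (Gx t w Dt i Hi). ring.
      * unfold tadj, mulmv. rewrite <- !csum_sub. apply csum_ext; intros.
        simpl. unfold vadd, vscale. ring.
    + intros w1 w2 c L1 L2.
      assert (Ey : veq N (y (v2add (v2scale c w1) w2)) (vadd (vscale c (y w1)) (y w2))).
      { intros i Hi.
        transitivity (mulmv N Qi (vadd (vscale c (tadj N (A t0) (B t0) w1)) (tadj N (A t0) (B t0) w2)) i);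
          [|apply mulmv_lin].
        apply csum_ext; intros k Hk. f_equal. unfold tadj. simpl. rewrite !mulmv_lin.
        unfold vadd, vscale. ring. }
      assert (Ex : veq N (x t (v2add (v2scale c w1) w2)) (vadd (vscale c (x t w1)) (x t w2))).
      { unfold x. rewrite Ey. intros i Hi. apply mulmv_lin. }
      destruct (plane_of_veq N (A t) (B t) _ _ Ex) as [E1 E2].
      simpl in E1, E2. split; intros i Hi.
      * change (Cadd (vneg (mulmv N (adj (B t)) (x t (v2add (v2scale c w1) w2))) i) (Cmul (Copp C1) (Cadd (Cmul c (fst w1 i)) (fst w2 i))) =
          Cadd (Cmul c (Cadd (vneg (mulmv N (adj (B t)) (x t w1)) i) (Cmul (Copp C1) (fst w1 i))))
            (Cadd (vneg (mulmv N (adj (B t)) (x t w2)) i) (Cmul (Copp C1) (fst w2 i)))).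
        rewrite (E1 i Hi). unfold vneg. rewrite mulmv_lin. ring.
      * change (Cadd (mulmv N (adj (A t)) (x t (v2add (v2scale c w1) w2)) i) (Cmul (Copp C1) (Cadd (Cmul c (snd w1 i)) (snd w2 i))) =
          Cadd (Cmul c (Cadd (mulmv N (adj (A t)) (x t w1) i) (Cmul (Copp C1) (snd w1 i))))
            (Cadd (mulmv N (adj (A t)) (x t w2) i) (Cmul (Copp C1) (snd w2 i)))).
        rewrite (E2 i Hi), mulmv_lin. ring.
    + intros z. split.
      * intros Lz.
        destruct (Lplane_param N _ _ z (Hrk t (DI t Dt)) (Hsym t (DI t Dt)) Lz) as [g Hg].
        (* For z = T_t g the preimage is T_0 M_t g: its parameter [x] is X_t M_t g = g, so adding
           R_t returns T_t g. *)
        exists (plane_of N (A t0) (B t0) (mulmv N (M t) g)).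
        split; [apply Lplane_plane_of, Hsym, It0|].
        assert (Ex : veq N g (x t (plane_of N (A t0) (B t0) (mulmv N (M t) g)))).
        { unfold x, y. rewrite tadj_plane_of, <- (mulmv_assoc N Qi), QL, mulmv_1.
          rewrite <- mulmv_assoc, (proj2 (HX t Dt)), mulmv_1. reflexivity. }
        apply (v2eq_trans _ _ _ _ Hg). destruct (plane_of_veq N (A t) (B t) _ _ Ex) as [E1 E2].
        split; intros i Hi; [rewrite (E1 i Hi)|rewrite (E2 i Hi)]; simpl; unfold vadd, vscale; ring.
      * intros [w [Lw Hw]].
        eapply in_bc_veq; [| |apply (Lplane_plane_of N (A t) (B t) (x t w)), Hsym, DI, Dt].
        -- intros i Hi. rewrite (proj1 Hw i Hi). simpl; unfold vadd, vscale; ring.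
        -- intros i Hi. rewrite (proj2 Hw i Hi). simpl; unfold vadd, vscale; ring.
  - intros w Lw.
    destruct (Lplane_param N _ _ w (Hrk t0 It0) (Hsym t0 It0) Lw) as [g Hg].
    (* At t0 the parameter [x] is the original parameter of [w], so T_0 x - w = 0. *)
    assert (Ex : veq N (x t0 w) g).
    { unfold x, y. rewrite (tadj_veq N _ _ _ _ Hg), tadj_plane_of, <- (mulmv_assoc N Qi).
      change (mulmm N Qi (gram N (A t0) (B t0) (A t0) (B t0))) with (M t0).
      rewrite <- mulmv_assoc, (proj2 (HX t0 Dt0)), mulmv_1. reflexivity. }
    destruct (plane_of_veq N (A t0) (B t0) _ _ Ex) as [E1 E2].
    split; intros i Hi; simpl; unfold vadd, vscale, vzero.
    + rewrite (proj1 Hg i Hi). change (vneg (mulmv N (adj (B t0)) (x t0 w)) i) with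
       (fst (plane_of N (A t0) (B t0) (x t0 w)) i). rewrite (E1 i Hi). ring.
    + rewrite (proj2 Hg i Hi). change (mulmv N (adj (A t0)) (x t0 w) i) with
       (snd (plane_of N (A t0) (B t0) (x t0 w)) i). rewrite (E2 i Hi). ring.
  - intros w Lw k Hk. change (Ioo (t0 - r) (t0 + r)) with D.
    assert (xd : forall s j, D s -> (j < N)%nat -> cderiv_pt D (fun t => x t w j) s (dx s w j)).
    { intros s j Ds Hj. unfold x, dx.
      replace (mulmv N (dinv N X dM s) (y w) j) with
        (Cadd (mulmv N (dinv N X dM s) (y w) j) (mulmv N (X s) vzero j)).
      2:{ unfold mulmv at 2. rewrite csum_zero by (intros; unfold vzero; ring). ring. }
      apply (mulmv_cderiv D s N X (fun _ => y w)); intros l Hl; [|apply cderiv_const].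
      apply (inverse_cderiv N D M X dM); auto; intros; apply HX; assumption. }
    assert (xc : forall s j, D s -> (j < N)%nat -> tends (near D s) (fun t => x t w j) (x s w j)).
    { intros s j Ds Hj. apply (cderiv_cont _ _ _ _ (xd s j Ds Hj)). }
    assert (dxc : forall s j, D s -> (j < N)%nat -> tends (near D s) (fun t => dx t w j) (dx s w j)).
    { intros s j Ds Hj. unfold dx. pose proof (near_filter D s) as HFs.
      apply (mulmv_tends _ HFs); intros l Hl; [|apply (tends_const _ HFs)].
      refine (dinv_cont N D M X dM _ _ XB MM j l Hj Hl s Ds); intros; apply HX; assumption. }
    assert (Ad : forall s i j, D s -> (i < N)%nat -> (j < N)%nat ->
       cderiv_pt D (fun t => adj (A t) i j) s (adj (dA s) i j) /\
       cderiv_pt D (fun t => adj (B t) i j) s (adj (dB s) i j) /\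
       tends (near D s) (fun t => adj (dA t) i j) (adj (dA s) i j) /\
       tends (near D s) (fun t => adj (dB t) i j) (adj (dB s) i j)).
    { intros s i j Ds Hi Hj. destruct (HA j i Hj Hi) as [a1 [a2 [a3 a4]]].
      pose proof (near_filter D s) as HFs. unfold adj.
      split; [|split; [|split]];
        [apply cderiv_conj, (cderiv_sub _ _ _ _ _ DI)|apply cderiv_conj, (cderiv_sub _ _ _ _ _ DI)
        |apply (tends_conj _ HFs), (tends_sub_dom _ _ _ _ _ DI)
        |apply (tends_conj _ HFs), (tends_sub_dom _ _ _ _ _ DI)]; auto.
      - exact (a2 s (DI s Ds)).
      - exact (a4 s (DI s Ds)). }
    split; [|split; [|split]].
    + intros s Ds. simpl. unfold vadd, vscale, vneg.
      match goal with |- cderiv_pt _ _ _ ?l => replace l with (Cadd l C0) by ring end.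
      apply cderiv_add; [|apply cderiv_const].
      apply cderiv_opp. apply (mulmv_cderiv D s N (fun t => adj (B t)) (fun t => x t w)); intros j Hj.
      * apply Ad; auto.
      * apply xd; auto.
    + rewrite ccont_tends. intros s Ds. simpl. pose proof (near_filter D s) as HFs.
      apply (tends_opp _ HFs), (tends_add _ HFs); apply (mulmv_tends _ HFs); intros j Hj; auto.
      * apply Ad; auto.
      * apply (cderiv_cont _ _ (fun t => adj (B t) k j) (adj (dB s) k j)). apply Ad; auto.
    + intros s Ds. simpl. unfold vadd, vscale, vneg.
      match goal with |- cderiv_pt _ _ _ ?l => replace l with (Cadd l C0) by ring end.
      apply cderiv_add; [|apply cderiv_const].
      apply (mulmv_cderiv D s N (fun t => adj (A t)) (fun t => x t w)); intros j Hj.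
      * apply Ad; auto.
      * apply xd; auto.
    + rewrite ccont_tends. intros s Ds. simpl. pose proof (near_filter D s) as HFs.
      apply (tends_add _ HFs); apply (mulmv_tends _ HFs); intros j Hj; auto.
      * apply Ad; auto.
      * apply (cderiv_cont _ _ (fun t => adj (A t) k j) (adj (dA s) k j)). apply Ad; auto.
Qed.
End Crossing.

(** * Absolutely continuous functions *)

(** Continuous induction: the supremum [s] of the points satisfying [P] is approached from the left
    by such points, and a step across [s] either reaches [b] or contradicts the choice of [s]. The
    step joins points on both sides of [s] because differentiability at [s] controls increments
    across [s]. *)
Lemma interval_induction (a b : R) (P : R -> Prop) : a <= b -> P a ->
  (forall s, a <= s <= b -> exists d, d > 0 /\ forall x y,
     a <= x <= s -> s <= y <= b -> s - d < x -> y < s + d -> P x -> P y) ->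
  P b.
Proof.
  intros Hab Pa Hs.
  destruct (completeness (fun x => a <= x <= b /\ P x)) as [s [Hub Hlub]].
  - exists b. intros x [[_ H] _]; exact H.
  - exists a. split; [lra|exact Pa].
  - assert (as_ : a <= s) by (apply Hub; split; [lra|exact Pa]).
    assert (sb : s <= b) by (apply Hlub; intros x [[_ H] _]; exact H).
    destruct (Hs s (conj as_ sb)) as [d [Hd Hstep]].
    assert (exists x, (a <= x <= b /\ P x) /\ s - d < x) as [x [[[H1 H2] Px] H3]].
    { apply Classical_Prop.NNPP. intros N.
      assert (s <= s - d); [|lra]. apply Hlub. intros x Hx.
      apply Rnot_lt_le. intros L. apply N. exists x; split; assumption. }
    assert (xs : x <= s) by (apply Hub; split; [split|]; assumption).
    destruct (Req_dec s b) as [->|Nb].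
    + apply (Hstep x b); try lra. exact Px.
    + exfalso. set (y := Rmin b (s + d/2)).
      assert (y1 : y <= b) by apply Rmin_l.
      assert (y2 : y <= s + d/2) by apply Rmin_r.
      assert (y3 : s < y) by (apply Rmin_glb_lt; lra).
      assert (P y) by (apply (Hstep x y); try lra; exact Px).
      assert (y <= s); [|lra]. apply Hub. split; [lra|assumption].
Qed.

(** The derivative relative to [D], one-sided at an endpoint of an interval. The derivative function
    in [D_in] is constant because only its value at [x] enters. *)
Definition rderiv (D : R -> Prop) (g : R -> R) (x l : R) : Prop := D_in g (fun _ => l) D x.

Lemma rderiv_iff D g x l : rderiv D g x l <->
  forall eps, eps > 0 -> exists d, d > 0 /\ forall y, D y -> y <> x -> Rabs (y - x) < d ->
    Rabs ((g y - g x) / (y - x) - l) < eps.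
Proof.
  unfold rderiv, D_in, limit1_in, limit_in, D_x. simpl. unfold Rdist. split; intros H eps He;
    destruct (H eps He) as [d [Hd Hy]]; exists d; split; auto.
  intros y [[Dy Ny] Ly]. auto.
Qed.

Lemma rderiv_lin D g x l : rderiv D g x l <->
  forall eps, eps > 0 -> exists d, d > 0 /\ forall y, D y -> Rabs (y - x) < d ->
    Rabs (g y - g x - l * (y - x)) <= eps * Rabs (y - x).
Proof.
  rewrite rderiv_iff. split; intros H eps He.
  - destruct (H eps He) as [d [Hd Hy]]. exists d; split; auto. intros y Dy Ly.
    destruct (Req_dec y x) as [->|N].
    + replace (g x - g x - l * (x - x)) with 0 by ring. rewrite Rabs_R0.
      pose proof (Rabs_pos (x - x)). nra.
    + specialize (Hy y Dy N Ly).
      replace (g y - g x - l * (y - x)) with (((g y - g x) / (y - x) - l) * (y - x)) by (field; lra).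
      rewrite Rabs_mult. pose proof (Rabs_pos (y - x)). nra.
  - destruct (H (eps/2) ltac:(lra)) as [d [Hd Hy]]. exists d; split; auto. intros y Dy N Ly.
    specialize (Hy y Dy Ly).
    replace ((g y - g x) / (y - x) - l) with ((g y - g x - l * (y - x)) * / (y - x)) by (field; lra).
    rewrite Rabs_mult, Rabs_inv.
    assert (P : 0 < Rabs (y - x)) by (apply Rabs_pos_lt; lra).
    apply Rmult_lt_reg_r with (Rabs (y - x)); [exact P|].
    rewrite Rmult_assoc, Rinv_l by lra. nra.
Qed.

Lemma rderiv_sub (D D' : R -> Prop) g x l : (forall y, D' y -> D y) -> rderiv D g x l -> rderiv D' g x l.
Proof.
  rewrite !rderiv_iff. intros HD H eps He. destruct (H eps He) as [d [Hd Hy]]. exists d; split; auto.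
Qed.
Lemma rderiv_const D c x : rderiv D (fun _ => c) x 0.
Proof. apply Dconst. Qed.
Lemma rderiv_add D f g x l k : rderiv D f x l -> rderiv D g x k -> rderiv D (fun y => f y + g y) x (l + k).
Proof. intros H1 H2. exact (Dadd D (fun _ => l) (fun _ => k) f g x H1 H2). Qed.
Lemma rderiv_mul D f g x l k : rderiv D f x l -> rderiv D g x k ->
  rderiv D (fun y => f y * g y) x (l * g x + f x * k).
Proof. intros H1 H2. exact (Dmult D (fun _ => l) (fun _ => k) f g x H1 H2). Qed.
Lemma rderiv_scal D c f x l : rderiv D f x l -> rderiv D (fun y => c * f y) x (c * l).
Proof. intros H1. exact (Dmult_const D f (fun _ => l) x c H1). Qed.
Lemma rderiv_minus D f g x l k : rderiv D f x l -> rderiv D g x k -> rderiv D (fun y => f y - g y) x (l - k).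
Proof. intros H1 H2. exact (Dminus D (fun _ => l) (fun _ => k) f g x H1 H2). Qed.
Lemma rderiv_eq D f x l k : rderiv D f x l -> l = k -> rderiv D f x k.
Proof. intros H <-; exact H. Qed.

Lemma Icc_sub a b c d : a <= c -> d <= b -> forall x, Icc c d x -> Icc a b x.
Proof. unfold Icc; intros; lra. Qed.

Definition rac (a b : R) (g : R -> R) : Prop :=
  forall eps, eps > 0 -> exists delta, delta > 0 /\
    forall (n : nat) (x y : nat -> R),
      (forall i, (i < n)%nat -> a <= x i /\ x i <= y i /\ y i <= b) ->
      (forall i, (S i < n)%nat -> y i <= x (S i)) ->
      rsum n (fun i => y i - x i) < delta ->
      rsum n (fun i => Rabs (g (y i) - g (x i))) < eps.

Lemma rac_sub a b c d g : a <= c -> d <= b -> rac a b g -> rac c d g.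
Proof.
  intros H1 H2 H eps He. destruct (H eps He) as [dl [Hd Hn]]. exists dl; split; auto.
  intros n x y Hx. apply Hn. intros i Hi. specialize (Hx i Hi). lra.
Qed.
Lemma ae_sub a b c d (P : R -> Prop) : a <= c -> d <= b -> ae_on a b P -> ae_on c d P.
Proof.
  intros H1 H2 H eps He. destruct (H eps He) as [l [r [A [B C]]]]. exists l, r.
  split; [exact A|split; [|exact C]]. intros x [Hx N]. apply B. split; [lra|exact N].
Qed.
Lemma ae_imp a b (P Q : R -> Prop) : (forall x, a <= x <= b -> P x -> Q x) -> ae_on a b P -> ae_on a b Q.
Proof.
  intros H HP eps He. destruct (HP eps He) as [l [r [A [B C]]]]. exists l, r.
  split; [exact A|split; [|exact C]]. intros x [Hx N]. apply B. split; auto.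
Qed.

Lemma rac_cont a b g : rac a b g -> forall eps, eps > 0 -> exists d, d > 0 /\
  forall x y, a <= x -> x <= y -> y <= b -> y - x < d -> Rabs (g y - g x) < eps.
Proof.
  intros H eps He. destruct (H eps He) as [d [Hd Hn]]. exists d; split; auto.
  intros x y H1 H2 H3 H4. specialize (Hn 1%nat (fun _ => x) (fun _ => y)). simpl in Hn.
  rewrite !Rplus_0_l in Hn. apply Hn; intros; lra || lia.
Qed.

Lemma rac_bounded a b g : a <= b -> rac a b g -> exists M, 0 <= M /\ forall x, Icc a b x -> Rabs (g x) <= M.
Proof.
  intros Hab H. destruct (rac_cont a b g H 1 ltac:(lra)) as [d [Hd Hc]].
  cut (exists M, forall x, Icc a b x -> Rabs (g x) <= M).
  { intros [M HM]. exists M; split; [|exact HM].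
    eapply Rle_trans; [apply (Rabs_pos (g a))|apply HM; unfold Icc; lra]. }
  apply (interval_induction a b (fun y => exists M, forall x, Icc a y x -> Rabs (g x) <= M)); [exact Hab| |].
  - exists (Rabs (g a)). intros x [? ?]. replace x with a by lra. lra.
  - intros s Hs. exists (d/2); split; [lra|]. intros x y Hx Hy H1 H2 [M HM].
    exists (Rmax M (Rabs (g x) + 1)). intros z [Hz1 Hz2].
    destruct (Rle_dec z x) as [L|L].
    + eapply Rle_trans; [apply HM; split; lra|apply Rmax_l].
    + eapply Rle_trans; [|apply Rmax_r].
      assert (Rabs (g z - g x) < 1) by (apply Hc; lra).
      pose proof (Rabs_triang (g z - g x) (g x)) as T.
      replace (g z - g x + g x) with (g z) in T by ring. lra.
Qed.

Lemma rac_lipschitz a b g L :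
  (forall x y, a <= x -> x <= y -> y <= b -> Rabs (g y - g x) <= L * (y - x)) -> rac a b g.
Proof.
  intros H eps He. exists (eps / (Rabs L + 1)).
  assert (P : 0 < Rabs L + 1) by (pose proof (Rabs_pos L); lra).
  split; [apply Rdiv_lt_0_compat; lra|]. intros n x y Hx _ Hs.
  apply Rle_lt_trans with ((Rabs L + 1) * rsum n (fun i => y i - x i)).
  - rewrite <- rsum_mul_l. apply rsum_le; intros i Hi. destruct (Hx i Hi) as [A [B C]].
    eapply Rle_trans; [apply H; assumption|]. pose proof (RRle_abs L). nra.
  - apply Rmult_lt_compat_l with (r := Rabs L + 1) in Hs; [|exact P].
    replace ((Rabs L + 1) * (eps / (Rabs L + 1))) with eps in Hs by (field; lra). exact Hs.
Qed.

(** One criterion from which closure under sums, multiples and products follows, the last with [M]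
    taken from bounds on the factors. *)
Lemma rac_dominated a b f g h M :
  rac a b f -> rac a b g -> 0 <= M ->
  (forall x y, Icc a b x -> Icc a b y ->
     Rabs (h y - h x) <= M * Rabs (f y - f x) + M * Rabs (g y - g x)) -> rac a b h.
Proof.
  intros Hf Hg HM H eps He.
  set (e := eps / (2 * (M + 1))).
  assert (He' : e > 0) by (apply Rdiv_lt_0_compat; lra).
  destruct (Hf e He') as [d1 [Hd1 H1]]. destruct (Hg e He') as [d2 [Hd2 H2]].
  exists (Rmin d1 d2). split; [apply Rmin_pos; lra|]. intros n x y Hx Ho Hs.
  assert (A := H1 n x y Hx Ho (Rlt_le_trans _ _ _ Hs (Rmin_l _ _))).
  assert (B := H2 n x y Hx Ho (Rlt_le_trans _ _ _ Hs (Rmin_r _ _))).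
  apply Rle_lt_trans with (M * rsum n (fun i => Rabs (f (y i) - f (x i))) + M * rsum n (fun i => Rabs (g (y i) - g (x i)))).
  - rewrite <- !rsum_mul_l, <- rsum_add. apply rsum_le; intros i Hi.
    destruct (Hx i Hi) as [? [? ?]]. apply H; split; lra.
  - assert (E : 2 * (M + 1) * e = eps) by (unfold e; field; lra). nra.
Qed.

Lemma rac_const a b c : rac a b (fun _ => c).
Proof.
  apply (rac_lipschitz a b _ 0). intros. replace (c - c) with 0 by ring. rewrite Rabs_R0; lra.
Qed.
Lemma rac_add a b f g : rac a b f -> rac a b g -> rac a b (fun x => f x + g x).
Proof.
  intros Hf Hg. apply (rac_dominated a b f g _ 1); auto; [lra|]. intros.
  replace (f y + g y - (f x + g x)) with ((f y - f x) + (g y - g x)) by ring.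
  pose proof (Rabs_triang (f y - f x) (g y - g x)). lra.
Qed.
Lemma rac_scal a b c f : rac a b f -> rac a b (fun x => c * f x).
Proof.
  intros Hf. apply (rac_dominated a b f f _ (Rabs c)); auto; [apply Rabs_pos|]. intros.
  replace (c * f y - c * f x) with (c * (f y - f x)) by ring. rewrite Rabs_mult.
  pose proof (Rabs_pos c). pose proof (Rabs_pos (f y - f x)). nra.
Qed.
Lemma rac_ext a b f g : (forall x, f x = g x) -> rac a b f -> rac a b g.
Proof.
  intros E Hf. apply (rac_dominated a b f f _ 1); auto; [lra|]. intros. rewrite <- !E.
  pose proof (Rabs_pos (f y - f x)). lra.
Qed.
Lemma rac_minus a b f g : rac a b f -> rac a b g -> rac a b (fun x => f x - g x).
Proof.
  intros Hf Hg. apply (rac_ext a b (fun x => f x + (-1) * g x)); [intros; ring|].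
  apply rac_add; [|apply rac_scal]; assumption.
Qed.
Lemma rac_mul a b f g : a <= b -> rac a b f -> rac a b g -> rac a b (fun x => f x * g x).
Proof.
  intros Hab Hf Hg.
  destruct (rac_bounded a b f Hab Hf) as [M1 [P1 H1]].
  destruct (rac_bounded a b g Hab Hg) as [M2 [P2 H2]].
  apply (rac_dominated a b f g _ (M1 + M2)); auto; [lra|]. intros x y Hx Hy.
  replace (f y * g y - f x * g x) with ((f y - f x) * g y + f x * (g y - g x)) by ring.
  eapply Rle_trans; [apply Rabs_triang|]. rewrite !Rabs_mult.
  specialize (H1 x Hx). specialize (H2 y Hy).
  pose proof (Rabs_pos (f y - f x)). pose proof (Rabs_pos (g y - g x)).
  pose proof (Rabs_pos (f x)). pose proof (Rabs_pos (g y)). nra.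
Qed.

(** Mean value inequality by continuous induction: with the slope relaxed to L + e',
    differentiability at [s] carries the bound from the left of [s] to its right, and [e'] is
    arbitrary. *)
Lemma rderiv_lipschitz a b f df L : a <= b ->
  (forall x, Icc a b x -> rderiv (Icc a b) f x (df x) /\ Rabs (df x) <= L) ->
  forall x y, a <= x -> x <= y -> y <= b -> Rabs (f y - f x) <= L * (y - x).
Proof.
  intros Hab H x y H1 H2 H3. apply le_epsilon. intros e He.
  (* The summand 1 keeps the denominator positive when a = b; the total slack over [x, y] stays
     below [e]. *)
  set (e' := e / (b - a + 1)). assert (He' : e' > 0) by (apply Rdiv_lt_0_compat; lra).
  apply Rle_trans with ((L + e') * (y - x)).
  2:{ assert (e' * (b - a + 1) = e) by (unfold e'; field; lra). nra. }
  apply (interval_induction x y (fun z => Rabs (f z - f x) <= (L + e') * (z - x))); [lra| |].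
  - replace (f x - f x) with 0 by ring. rewrite Rabs_R0; lra.
  - intros s Hs. destruct (H s ltac:(split; lra)) as [Ds Ls]. rewrite rderiv_lin in Ds.
    destruct (Ds e' He') as [d [Hd Hy]]. exists d; split; auto. intros p r Hp Hr Q1 Q2 IH.
    assert (A := Hy p ltac:(split; lra) ltac:(apply Rabs_def1; lra)).
    assert (B := Hy r ltac:(split; lra) ltac:(apply Rabs_def1; lra)).
    rewrite (Rabs_left1 (p - s)) in A by lra. rewrite (Rabs_pos_eq (r - s)) in B by lra.
    apply Rabs_le_iff in A, B, IH, Ls. apply Rabs_le. nra.
Qed.

(** * Covering sums and almost everywhere monotonicity *)

Section Coverage.
Variables (c d : nat -> R).
(** For c k <= d k, each summand is the length of the part of [c k, d k] to the left of [x].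
    Overlaps are counted repeatedly, which is harmless since only the total of the lengths is
    bounded. *)
Definition covered (N : nat) (x : R) : R := rsum N (fun k => Rmax (c k) (Rmin x (d k)) - c k).

Lemma covered_incr N x y : x <= y -> covered N x <= covered N y.
Proof.
  intros H. apply rsum_le; intros i _. unfold Rmax, Rmin.
  repeat destruct Rle_dec; lra.
Qed.
Lemma covered_incr_index N K x y : x <= y -> (N <= K)%nat ->
  covered N y - covered N x <= covered K y - covered K x.
Proof.
  intros H L. induction L as [|K L IH]; [lra|]. unfold covered in *; simpl.
  assert (Rmax (c K) (Rmin x (d K)) - c K <= Rmax (c K) (Rmin y (d K)) - c K); [|lra].
  unfold Rmax, Rmin; repeat destruct Rle_dec; lra.
Qed.
Lemma covered_interval n N x y : (n < N)%nat -> c n < x -> x <= y -> y < d n ->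
  y - x <= covered N y - covered N x.
Proof.
  intros Hn H1 H2 H3. apply Rle_trans with (covered (S n) y - covered (S n) x).
  - unfold covered; simpl.
    pose proof (covered_incr n x y H2) as P. unfold covered in P.
    assert (y - x <= (Rmax (c n) (Rmin y (d n)) - c n) - (Rmax (c n) (Rmin x (d n)) - c n)); [|lra].
    unfold Rmax, Rmin; repeat destruct Rle_dec; lra.
  - apply covered_incr_index; [exact H2|lia].
Qed.
Lemma covered_total N x y : (forall k, c k <= d k) ->
  covered N y - covered N x <= rsum N (fun k => d k - c k).
Proof.
  intros H. unfold covered. induction N as [|N IH]; simpl; [lra|].
  specialize (H N).
  assert (Rmax (c N) (Rmin y (d N)) - c N - (Rmax (c N) (Rmin x (d N)) - c N) <= d N - c N); [|lra].
  unfold Rmax, Rmin; repeat destruct Rle_dec; lra.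
Qed.
End Coverage.

(* Chains of exceptional intervals are accumulated by induction along [a, b]; the total length
   is controlled by the monotone function [covered]. *)
Lemma rac_ae_nonincreasing a b G : a <= b -> rac a b G ->
  ae_on a b (fun x => exists l, l <= 0 /\ rderiv (Icc a b) G x l) -> G b <= G a.
Proof.
  intros Hab HG Hae. enough (G b - G a <= 0) by lra.
  apply le_epsilon. intros e He.
  set (e1 := e / (2 * (b - a + 1))). assert (He1 : e1 > 0) by (apply Rdiv_lt_0_compat; lra).
  destruct (HG (e / 2) ltac:(lra)) as [dl [Hdl Hac]].
  (* The total length dl / 2 is strictly below the threshold [dl] of absolute continuity, so the
     increments of [G] over a chain no longer than the cover add up to less than e / 2. *)
  destruct (Hae (dl / 2) ltac:(lra)) as [c [d [Hcd [Hcov Htot]]]].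
  (* Invariant up to [z]: [G] grows by at most slope [e1] times the distance plus the increments
     over an ordered chain, whose length is dominated by [covered]. The clause y i <= z allows the
     chain to be extended on the right. *)
  assert (K : exists N n x y,
     (forall i, (i < n)%nat -> a <= x i /\ x i <= y i /\ y i <= b) /\
     (forall i, (S i < n)%nat -> y i <= x (S i)) /\
     rsum n (fun i => y i - x i) <= covered c d N b - covered c d N a /\
     (forall i, (i < n)%nat -> y i <= b) /\
     G b - G a <= e1 * (b - a) + rsum n (fun i => Rabs (G (y i) - G (x i)))).
  { apply (interval_induction a b (fun z => exists N n x y,
     (forall i, (i < n)%nat -> a <= x i /\ x i <= y i /\ y i <= b) /\
     (forall i, (S i < n)%nat -> y i <= x (S i)) /\
     rsum n (fun i => y i - x i) <= covered c d N z - covered c d N a /\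
     (forall i, (i < n)%nat -> y i <= z) /\
     G z - G a <= e1 * (z - a) + rsum n (fun i => Rabs (G (y i) - G (x i))))); [exact Hab| |].
    - exists 0%nat, 0%nat, (fun _ => a), (fun _ => a). simpl.
      split; [intros; lia|split; [intros; lia|split; [lra|split; [intros; lia|lra]]]].
    - intros s Hs.
      destruct (ClassicalEpsilon.excluded_middle_informative
        (exists l, l <= 0 /\ rderiv (Icc a b) G s l)) as [[l [Hl Ds]]|Bad].
      (* At a good point the growth from [p] to [q] is absorbed by the slope [e1], and the chain is
         unchanged. *)
      + rewrite rderiv_lin in Ds. destruct (Ds e1 He1) as [r [Hr Hy]]. exists r; split; auto.
        intros p q Hp Hq Q1 Q2 [N [n [x [y [A [B [C [D E]]]]]]]].
        exists N, n, x, y. split; [exact A|split; [exact B|split; [|split]]].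
        * pose proof (covered_incr c d N p q). lra.
        * intros i Hi. specialize (D i Hi). lra.
        * assert (A1 := Hy p ltac:(split; lra) ltac:(apply Rabs_def1; lra)).
          assert (B1 := Hy q ltac:(split; lra) ltac:(apply Rabs_def1; lra)).
          rewrite (Rabs_left1 (p - s)) in A1 by lra. rewrite (Rabs_pos_eq (q - s)) in B1 by lra.
          apply Rabs_le_iff in A1, B1. nra.
      (* At an exceptional point [p] and [q] lie in one covering interval [k], and [p, q] is
         appended to the chain. Raising [N] to at least S k makes that interval count in
         [covered]. *)
      + destruct (Hcov s (conj Hs Bad)) as [k [K1 K2]].
        exists (Rmin (s - c k) (d k - s)). split; [apply Rmin_pos; lra|].
        pose proof (Rmin_l (s - c k) (d k - s)). pose proof (Rmin_r (s - c k) (d k - s)).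
        intros p q Hp Hq Q1 Q2 [N [n [x [y [A [B [C [D E]]]]]]]].
        exists (Nat.max N (S k)), (S n), (fun i => if Nat.eqb i n then p else x i),
           (fun i => if Nat.eqb i n then q else y i).
        split; [|split; [|split; [|split]]].
        * intros i Hi. destruct (Nat.eqb_spec i n); [lra|apply A; lia].
        * intros i Hi. destruct (Nat.eqb_spec i n); [lia|].
          destruct (Nat.eqb_spec (S i) n); [apply D; lia|apply B; lia].
        * simpl. rewrite Nat.eqb_refl.
          rewrite (rsum_ext n _ (fun i => y i - x i)).
          2:{ intros i Hi. destruct (Nat.eqb_spec i n); [lia|reflexivity]. }
          pose proof (covered_incr_index c d N (Nat.max N (S k)) a p ltac:(lra) ltac:(lia)).
          pose proof (covered_interval c d k (Nat.max N (S k)) p q ltac:(lia) ltac:(lra) ltac:(lra) ltac:(lra)).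
          lra.
        * intros i Hi. destruct (Nat.eqb_spec i n); [lra|].
          assert (y i <= p) by (apply D; lia). lra.
        * simpl. rewrite Nat.eqb_refl.
          rewrite (rsum_ext n _ (fun i => Rabs (G (y i) - G (x i)))).
          2:{ intros i Hi. destruct (Nat.eqb_spec i n); [lia|reflexivity]. }
          pose proof (RRle_abs (G q - G p)).
          nra. }
  destruct K as [N [n [x [y [A [B [C [_ E]]]]]]]].
  pose proof (covered_total c d N a b Hcd). specialize (Htot N).
  pose proof (Hac n x y A B ltac:(lra)).
  assert (e1 * (2 * (b - a + 1)) = e) by (unfold e1; field; lra). nra.
Qed.

Lemma rac_id a b : rac a b (fun x => x).
Proof. apply (rac_lipschitz a b _ 1). intros. rewrite Rabs_pos_eq; lra. Qed.

Lemma rac_ae_le a b G L : a <= b -> rac a b G ->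
  ae_on a b (fun x => exists l, l <= L /\ rderiv (Icc a b) G x l) -> G b - G a <= L * (b - a).
Proof.
  intros Hab HG Hae.
  enough (G b - L * b <= G a - L * a) by lra.
  apply (rac_ae_nonincreasing a b (fun x => G x - L * x) Hab).
  - apply rac_minus; [exact HG|apply rac_scal, rac_id].
  - revert Hae. apply ae_imp. intros x _ [l [Hl D]]. exists (l - L * 1). split; [lra|].
    apply rderiv_minus; [exact D|apply rderiv_scal]. exact (Dx (Icc a b) x).
Qed.

Lemma rac_ae_lipschitz a b G L : rac a b G ->
  ae_on a b (fun x => exists l, Rabs l <= L /\ rderiv (Icc a b) G x l) ->
  forall x y, a <= x -> x <= y -> y <= b -> Rabs (G y - G x) <= L * (y - x).
Proof.
  intros HG Hae x y H1 H2 H3.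
  assert (HG' := rac_sub a b x y G H1 H3 HG).
  assert (Hae' := ae_sub a b x y _ H1 H3 Hae).
  assert (sub := Icc_sub a b x y H1 H3).
  apply Rabs_le. split.
  - enough ((-1) * G y - (-1) * G x <= L * (y - x)) by lra.
    apply (rac_ae_le x y (fun z => (-1) * G z)); [exact H2|apply rac_scal; exact HG'|].
    revert Hae'. apply ae_imp. intros z _ [l [Hl D]]. apply Rabs_le_iff in Hl.
    exists ((-1) * l). split; [lra|]. apply rderiv_scal. apply (rderiv_sub _ _ _ _ _ sub), D.
  - apply rac_ae_le; [exact H2|exact HG'|].
    revert Hae'. apply ae_imp. intros z _ [l [Hl D]]. apply Rabs_le_iff in Hl.
    exists l. split; [lra|]. apply (rderiv_sub _ _ _ _ _ sub), D.
Qed.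

(** * Countable intersections of almost everywhere properties *)

Lemma choice {T U : Type} (P : T -> U -> Prop) : (forall x, exists y, P x y) -> exists f, forall x, P x (f x).
Proof.
  intros H. exists (fun x => proj1_sig (ClassicalEpsilon.constructive_indefinite_description _ (H x))).
  intros x. apply proj2_sig.
Qed.

(* Interleaving enumeration of a sequence of sequences: the even entries of [merge k] come from
   the [k]-th sequence, the odd ones from [merge (k + 1)]; [fuel] bounds the recursion. *)
Fixpoint merge_index (fuel k i : nat) : nat * nat :=
  match fuel with
  | O => (k, i)
  | S fuel' => if Nat.even i then (k, Nat.div2 i) else merge_index fuel' (S k) (Nat.div2 i)
  end.

Lemma merge_index_fuel f1 : forall f2 k i, (i < f1)%nat -> (i < f2)%nat ->
  merge_index f1 k i = merge_index f2 k i.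
Proof.
  induction f1 as [|f1 IH]; intros [|f2] k i H1 H2; try lia. simpl.
  destruct (Nat.even i) eqn:E; [reflexivity|].
  assert (i <> 0)%nat by (intros ->; discriminate).
  pose proof (Nat.lt_div2 i ltac:(lia)). apply IH; lia.
Qed.

Lemma merge_index_even f k i : merge_index (S f) k (2 * i) = (k, i).
Proof. cbn [merge_index]. rewrite Nat.even_even, Nat.div2_double. reflexivity. Qed.
Lemma merge_index_odd f k i : (i < f)%nat ->
  merge_index (S f) k (S (2 * i)) = merge_index (S i) (S k) i.
Proof.
  intros H. replace (merge_index (S f) k (S (2 * i))) with (merge_index f (S k) i).
  - apply merge_index_fuel; lia.
  - cbn [merge_index]. rewrite Nat.div2_succ_double.
    replace (S (2 * i)) with (2 * i + 1)%nat by lia. rewrite Nat.even_odd. reflexivity.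
Qed.

Lemma merge_index_surj k j : forall i, exists n, merge_index (S n) i n = ((i + k)%nat, j).
Proof.
  induction k as [|k IH]; intros i.
  - exists (2 * j)%nat. rewrite merge_index_even, Nat.add_0_r. reflexivity.
  - destruct (IH (S i)) as [n Hn]. exists (S (2 * n)). rewrite merge_index_odd by lia.
    rewrite Hn. f_equal; lia.
Qed.

(** An initial segment of even length splits into one of the [k]-th sequence and one of the merge
    from k + 1, each contributing at most eps / 2^(k+1), the second by induction on the length. *)
Lemma merge_sum_bound (L : nat -> nat -> R) eps :
  (forall k j, 0 <= L k j) -> (forall k n, rsum n (L k) <= eps / 2 ^ S k) -> 0 <= eps ->
  forall n k, rsum n (fun i => let p := merge_index (S i) k i in L (fst p) (snd p)) <= eps / 2 ^ k.
Proof.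
  intros HL HS He.
  set (m := fun k i => let p := merge_index (S i) k i in L (fst p) (snd p)).
  assert (m_even : forall k i, m k (2 * i)%nat = L k i).
  { intros. unfold m. rewrite merge_index_even. reflexivity. }
  assert (m_odd : forall k i, m k (S (2 * i))%nat = m (S k) i).
  { intros. unfold m. rewrite merge_index_odd by lia. reflexivity. }
  assert (m_pos : forall k i, 0 <= m k i) by (intros; apply HL).
  assert (split : forall n k, rsum (2 * n) (m k) = rsum n (L k) + rsum n (m (S k))).
  { induction n as [|n IH]; intros k; [simpl; ring|].
    replace (2 * S n)%nat with (S (S (2 * n))) by lia. cbn [rsum].
    rewrite IH, m_even, m_odd. ring. }
  assert (half : forall k, eps / 2 ^ S k + eps / 2 ^ S k = eps / 2 ^ k).
  { intros k. simpl. field. apply pow_nonzero; lra. }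
  induction n as [n IH] using (well_founded_induction Wf_nat.lt_wf). intros k. fold (m k).
  destruct n as [|[|n]].
  - simpl. apply Rmult_le_pos; [exact He|]. left; apply Rinv_0_lt_compat, pow_lt; lra.
  - change (0 + m k (2 * 0)%nat <= eps / 2 ^ k). rewrite m_even.
    pose proof (HS k 1%nat) as H1. cbn [rsum] in H1. rewrite <- (half k).
    assert (0 <= eps / 2 ^ S k).
    { apply Rmult_le_pos; [exact He|]. left; apply Rinv_0_lt_compat, pow_lt; lra. }
    lra.
  - set (h := S (Nat.div2 (S n))).
    assert (Hh : (S (S n) <= 2 * h)%nat /\ (h < S (S n))%nat).
    { unfold h. pose proof (Nat.div2_odd (S n)). destruct (Nat.odd (S n)); simpl Nat.b2n in *; lia. }
    apply Rle_trans with (rsum (2 * h) (m k)); [apply rsum_mono_n; [apply m_pos|lia]|].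
    rewrite split, <- (half k). apply Rplus_le_compat; [apply HS|]. apply IH; lia.
Qed.

(** The [k]-th exceptional set is covered within eps / 2^(k+1), and the covers are interleaved. The
    equation passes to a limit of solutions at points that are good for all members of the sequence
    at once. *)
Lemma ae_all a b (P : nat -> R -> Prop) :
  (forall k, ae_on a b (P k)) -> ae_on a b (fun x => forall k, P k x).
Proof.
  intros H eps He.
  assert (Hk : forall k, exists cd : (nat -> R) * (nat -> R),
    (forall n, fst cd n <= snd cd n) /\
    (forall x, a <= x <= b /\ ~ P k x -> exists n, fst cd n < x < snd cd n) /\
    (forall n, rsum n (fun i => snd cd i - fst cd i) <= eps / 2 ^ S k)).
  { intros k. destruct (H k (eps / 2 ^ S k)) as [c [d Hcd]].
    - apply Rdiv_lt_0_compat; [exact He|apply pow_lt; lra].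
    - exists (c, d). exact Hcd. }
  destruct (choice _ Hk) as [cd Hcd].
  set (idx := fun i => merge_index (S i) 0 i).
  exists (fun i => fst (cd (fst (idx i))) (snd (idx i))), (fun i => snd (cd (fst (idx i))) (snd (idx i))).
  split; [|split].
  - intros n. apply Hcd.
  - intros x [Hx N].
    assert (exists k, ~ P k x) as [k Nk].
    { apply Classical_Prop.NNPP. intros N'. apply N. intros k. apply Classical_Prop.NNPP.
      intros Nk. apply N'. exists k; exact Nk. }
    destruct (proj1 (proj2 (Hcd k)) x (conj Hx Nk)) as [j Hj].
    destruct (merge_index_surj k j 0) as [n Hn]. exists n. unfold idx. rewrite Hn. exact Hj.
  - intros n. replace eps with (eps / 2 ^ 0) by (simpl; field).
    apply (merge_sum_bound (fun k j => snd (cd k) j - fst (cd k) j)).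
    + intros k j. pose proof (proj1 (Hcd k) j). lra.
    + intros k m. apply Hcd.
    + lra.
Qed.

Lemma ae_and a b (P Q : R -> Prop) : ae_on a b P -> ae_on a b Q -> ae_on a b (fun x => P x /\ Q x).
Proof.
  intros HP HQ.
  assert (H := ae_all a b (fun k => match k with O => P | S _ => Q end)).
  refine (ae_imp _ _ _ _ _ (H _)).
  - intros x _ A. split; [exact (A 0%nat)|exact (A 1%nat)].
  - intros [|k]; assumption.
Qed.

(** * Solutions of the eigenvalue equation *)

(** Since [q] and [lam] are real, the real and imaginary parts of an eigenfunction solve the same
    scalar equation separately; all estimates are made in this real form. *)
Definition rsol (a b : R) (q : R -> R) (lam : R) (f df : R -> R) : Prop :=
  (forall x, Icc a b x -> rderiv (Icc a b) f x (df x)) /\ rac a b df /\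
  ae_on a b (fun x => rderiv (Icc a b) df x ((q x - lam) * f x)).

Lemma c1_rac a b f df : a <= b -> (forall x, Icc a b x -> rderiv (Icc a b) f x (df x)) ->
  rac a b df -> rac a b f.
Proof.
  intros Hab Hf Hd. destruct (rac_bounded a b df Hab Hd) as [M [_ HM]].
  apply (rac_lipschitz a b f M). apply (rderiv_lipschitz a b f df M Hab). auto.
Qed.

Lemma rderiv_of_derivable D f x l : derivable_pt_lim f x l -> rderiv D f x l.
Proof.
  intros H. rewrite rderiv_iff. intros eps He. destruct (H eps He) as [d Hd].
  exists d. split; [apply d|]. intros y _ Ny Ly.
  specialize (Hd (y - x) ltac:(lra) Ly). replace (x + (y - x)) with y in Hd by ring. exact Hd.
Qed.

(** The energy f^2 + f'^2 + eta^2 times exp(-K (x - a)) has nonpositive derivative almost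
    everywhere. The value K = C + 2 comes from 2 |f f'| (1 + C) + 2 eta |f'| and three uses of 2 p r
    <= p^2 + r^2. The inhomogeneity [eta] accommodates differences of solutions with different
    spectral parameters. *)
Lemma gronwall a b C eta f df : 0 <= C ->
  (forall x, Icc a b x -> rderiv (Icc a b) f x (df x)) -> rac a b df ->
  ae_on a b (fun x => exists l, Rabs l <= C * Rabs (f x) + eta /\ rderiv (Icc a b) df x l) ->
  forall x, Icc a b x ->
  f x * f x + df x * df x <= (f a * f a + df a * df a + eta * eta) * exp ((C + 2) * (b - a)).
Proof.
  intros HC Hf Hdf Hae x [Hx1 Hx2]. set (K := C + 2).
  assert (sub := Icc_sub a b a x (Rle_refl a) Hx2).
  set (E := fun z => exp (- K * (z - a))).
  assert (dE : forall z, rderiv (Icc a x) E z (- K * E z)).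
  { intros z. apply rderiv_of_derivable. unfold E.
    replace (- K * exp (- K * (z - a))) with (exp (- K * (z - a)) * (- K)) by ring.
    apply (derivable_pt_lim_comp (fun z => - K * (z - a)) exp); [|apply derivable_pt_lim_exp].
    intros eps He. exists (mkposreal 1 Rlt_0_1). intros h Nh _.
    replace ((- K * (z + h - a) - - K * (z - a)) / h - - K) with 0 by (field; exact Nh).
    rewrite Rabs_R0. exact He. }
  assert (E1 : forall z, a <= z -> 0 < E z <= 1).
  { intros z Hz. split; [apply exp_pos|]. unfold E. rewrite <- exp_0.
    destruct (Req_dec z a) as [->|]; [right; f_equal; ring|]. left; apply exp_increasing. unfold K. nra. }
  assert (acE : rac a x E).
  { apply (rac_lipschitz a x E K). apply (rderiv_lipschitz a x E (fun z => - K * E z) K Hx1).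
    intros z [Hz _]. split; [apply dE|]. specialize (E1 z Hz). apply Rabs_le. unfold K in *. nra. }
  assert (acdf := rac_sub a b a x df (Rle_refl a) Hx2 Hdf).
  assert (acf : rac a x f).
  { apply (c1_rac a x f df Hx1); [|exact acdf]. intros z Hz. apply (rderiv_sub _ _ _ _ _ sub), Hf, sub, Hz. }
  set (G := fun z => (f z * f z + df z * df z + eta * eta) * E z).
  assert (GG : G x <= G a).
  { apply (rac_ae_nonincreasing a x G Hx1).
    - apply rac_mul; [exact Hx1| |exact acE].
      apply rac_add; [apply rac_add; apply rac_mul; assumption|apply rac_const].
    - refine (ae_imp _ _ _ _ _ (ae_sub a b a x _ (Rle_refl a) Hx2 Hae)).
      intros z Hz [l [Hl Dl]].
      exists ((df z * f z + f z * df z + (l * df z + df z * l) + 0) * E z +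
              (f z * f z + df z * df z + eta * eta) * (- K * E z)). split.
      + specialize (E1 z (proj1 Hz)).
        assert (B : Rabs (l * df z) <= (C * Rabs (f z) + eta) * Rabs (df z)).
        { rewrite Rabs_mult. apply Rmult_le_compat_r; [apply Rabs_pos|exact Hl]. }
        pose proof (RRle_abs (l * df z)).
        pose proof (Rsqr_abs (f z)) as A1. pose proof (Rsqr_abs (df z)) as A2. unfold Rsqr in A1, A2.
        enough (df z * f z + f z * df z + (l * df z + df z * l) <= K * (f z * f z + df z * df z + eta * eta)) as W.
        { apply Rmult_le_compat_l with (r := E z) in W; [|lra]. lra. }
        set (p := Rabs (f z)) in *. set (r := Rabs (df z)) in *.
        assert (0 <= C * ((p - r) * (p - r))) by (apply Rmult_le_pos; [exact HC|apply Rle_0_sqr]).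
        assert (0 <= (f z - df z) * (f z - df z)) by apply Rle_0_sqr.
        assert (0 <= (eta - r) * (eta - r)) by apply Rle_0_sqr.
        assert (0 <= C * (eta * eta)) by (apply Rmult_le_pos; [exact HC|apply Rle_0_sqr]).
        unfold K. nra.
      + assert (Dz : Icc a x z) by exact Hz.
        assert (Df : rderiv (Icc a x) f z (df z)) by (apply (rderiv_sub _ _ _ _ _ sub), Hf, sub, Dz).
        assert (Dl' : rderiv (Icc a x) df z l) by (apply (rderiv_sub _ _ _ _ _ sub), Dl).
        apply (rderiv_mul _ (fun z => f z * f z + df z * df z + eta * eta) E); [|apply dE].
        apply rderiv_add; [|apply rderiv_const].
        apply rderiv_add; apply rderiv_mul; assumption. }
  unfold G in GG. assert (Ea : E a = 1) by (unfold E; replace (- K * (a - a)) with 0 by ring; apply exp_0).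
  rewrite Ea in GG. fold K.
  assert (Ex : E x * exp (K * (x - a)) = 1).
  { unfold E. rewrite <- exp_plus. replace (- K * (x - a) + K * (x - a)) with 0 by ring. apply exp_0. }
  assert (mono : exp (K * (x - a)) <= exp (K * (b - a))).
  { destruct (Req_dec x b) as [->|]; [lra|]. left; apply exp_increasing. unfold K; nra. }
  pose proof (exp_pos (K * (x - a))). specialize (E1 x Hx1).
  assert (P : f x * f x + df x * df x + eta * eta <= (f a * f a + df a * df a + eta * eta) * exp (K * (x - a))).
  { replace (f x * f x + df x * df x + eta * eta) with
      ((f x * f x + df x * df x + eta * eta) * E x * exp (K * (x - a))) by (rewrite Rmult_assoc, Ex; ring).
    apply Rmult_le_compat_r; [lra|]. lra. }
  assert (0 <= f a * f a + df a * df a + eta * eta) by nra. nra.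
Qed.

Lemma sqr_sum_bound x y e : x * x + y * y <= e * e -> 0 <= e -> Rabs x <= e /\ Rabs y <= e.
Proof. intros H He. split; apply Rabs_le; nra. Qed.

Lemma Un_cv_abs_le u l e n0 : Un_cv u l -> (forall n, (n0 <= n)%nat -> Rabs (u n) <= e) -> Rabs l <= e.
Proof.
  intros H Hn. apply le_epsilon. intros eps He. destruct (H eps He) as [n1 H1].
  specialize (H1 (n0 + n1)%nat ltac:(lia)). specialize (Hn (n0 + n1)%nat ltac:(lia)).
  unfold Rdist in H1. rewrite Rabs_minus_sym in H1.
  pose proof (Rabs_triang (l - u (n0 + n1)%nat) (u (n0 + n1)%nat)) as T.
  replace (l - u (n0 + n1)%nat + u (n0 + n1)%nat) with l in T by ring. lra.
Qed.
Lemma Un_cv_bounded u l : Un_cv u l -> exists M, 0 < M /\ forall n, Rabs (u n) <= M.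
Proof. intros H. apply maj_by_pos. exists l; exact H. Qed.
Lemma Un_cv_const c : Un_cv (fun _ => c) c.
Proof. intros e He. exists 0%nat. intros. unfold Rdist. rewrite Rminus_diag, Rabs_R0. exact He. Qed.

(** The error F - Fn k is compared with |y - x|, not merely bounded uniformly; the increment of the
    error, the linearization of [Fn k] and the difference of slopes contribute eps / 3 each. *)
Lemma uniform_limit_rderiv (D : R -> Prop) F (Fn : nat -> R -> R) (gn : nat -> R) x g :
  (forall eps, eps > 0 -> exists k,
     (forall y, D y -> Rabs ((F y - Fn k y) - (F x - Fn k x)) <= eps * Rabs (y - x)) /\
     rderiv D (Fn k) x (gn k) /\ Rabs (gn k - g) <= eps) -> rderiv D F x g.
Proof.
  intros H. rewrite rderiv_lin. intros eps He.
  destruct (H (eps / 3) ltac:(lra)) as [k [HL [HD Hg]]].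
  rewrite rderiv_lin in HD. destruct (HD (eps / 3) ltac:(lra)) as [d [Hd Hy]].
  exists d; split; auto. intros y Dy Ly. specialize (HL y Dy). specialize (Hy y Dy Ly).
  replace (F y - F x - g * (y - x)) with (((F y - Fn k y) - (F x - Fn k x)) +
    ((Fn k y - Fn k x - gn k * (y - x)) + (gn k - g) * (y - x))) by ring.
  eapply Rle_trans; [apply Rabs_triang|].
  pose proof (Rabs_triang (Fn k y - Fn k x - gn k * (y - x)) ((gn k - g) * (y - x))) as T.
  rewrite Rabs_mult in T. pose proof (Rabs_pos (y - x)).
  assert (Rabs (gn k - g) * Rabs (y - x) <= eps / 3 * Rabs (y - x)) by (apply Rmult_le_compat_r; lra).
  lra.
Qed.

Lemma lipschitz_limit a b (Fn : nat -> R -> R) F k e :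
  (forall x, Icc a b x -> Un_cv (fun n => Fn n x) (F x)) ->
  (forall n, (k <= n)%nat -> forall x y, a <= x -> x <= y -> y <= b ->
     Rabs ((Fn n y - Fn k y) - (Fn n x - Fn k x)) <= e * (y - x)) ->
  forall x y, Icc a b x -> Icc a b y -> Rabs ((F y - Fn k y) - (F x - Fn k x)) <= e * Rabs (y - x).
Proof.
  intros Hcv HL.
  assert (W : forall x y, Icc a b x -> Icc a b y -> x <= y ->
     Rabs ((F y - Fn k y) - (F x - Fn k x)) <= e * (y - x)).
  { intros x y Hx Hy Hxy.
    apply (Un_cv_abs_le (fun n => (Fn n y - Fn k y) - (Fn n x - Fn k x)) _ _ k).
    - apply CV_minus; (apply CV_minus; [apply Hcv; assumption|apply Un_cv_const]).
    - intros n Hn. destruct Hx, Hy. apply HL; assumption. }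
  intros x y Hx Hy. destruct (Rle_dec x y) as [L|L].
  - rewrite (Rabs_pos_eq (y - x)) by lra. auto.
  - rewrite (Rabs_left (y - x)), Rabs_minus_sym by lra.
    replace (e * - (y - x)) with (e * (x - y)) by ring. apply W; auto; lra.
Qed.

(** A difference of two members solves the equation up to an error proportional to the difference of
    their parameters, so [gronwall] makes functions and derivatives uniformly Cauchy. Reinserted in
    the equation, this gives small Lipschitz constants for the differences of derivatives, as
    [uniform_limit_rderiv] demands. *)
Lemma rsol_limit a b q (lamn : nat -> R) lam (fn dfn : nat -> R -> R) M al be :
  a <= b -> ae_on a b (fun x => Rabs (q x) <= M) ->
  (forall n, rsol a b q (lamn n) (fn n) (dfn n)) -> Un_cv lamn lam ->
  Un_cv (fun n => fn n a) al -> Un_cv (fun n => dfn n a) be ->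
  exists f df, rsol a b q lam f df /\
    forall eps, eps > 0 -> exists n0, forall n x, (n0 <= n)%nat -> Icc a b x ->
      Rabs (fn n x - f x) <= eps /\ Rabs (dfn n x - df x) <= eps.
Proof.
  intros Hab HM Hs Hlam Hal Hbe.
  assert (Aall := ae_and _ _ _ _ HM (ae_all _ _ _ (fun n => proj2 (proj2 (Hs n))))).
  destruct (Un_cv_bounded _ _ Hlam) as [La [La0 HLa]].
  assert (HLa' : Rabs lam <= La) by (apply (Un_cv_abs_le lamn lam La 0 Hlam); auto).
  destruct (Un_cv_bounded _ _ Hal) as [V [V0 HV]].
  destruct (Un_cv_bounded _ _ Hbe) as [V' [V0' HV']].
  (* A bound for |q - l| valid for all parameters involved; [Rabs M] because the essential bound [M]
     carries no sign information. *)
  set (C := Rabs M + La). assert (HC : 0 <= C) by (pose proof (Rabs_pos M); unfold C; lra).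
  assert (HMq : forall x l y, Rabs (q x) <= M -> Rabs l <= La -> Rabs ((q x - l) * y) <= C * Rabs y).
  { intros x l y H1 H2. rewrite Rabs_mult. apply Rmult_le_compat_r; [apply Rabs_pos|].
    pose proof (Rabs_triang (q x) (- l)) as T. rewrite Rabs_Ropp in T. pose proof (RRle_abs M).
    unfold C, Rminus. lra. }
  set (S := exp ((C + 2) * (b - a))).
  assert (S1 : 1 <= S).
  { unfold S. rewrite <- exp_0. destruct (Req_dec a b) as [->|].
    - right; f_equal; ring.
    - left; apply exp_increasing. nra. }
  set (B := (V * V + V' * V') * S).
  assert (B0 : 0 <= B) by (unfold B; apply Rmult_le_pos; nra).
  assert (HB : forall n x, Icc a b x -> Rabs (fn n x) <= B + 1).
  { intros n x Hx. destruct (Hs n) as [s1 [s2 s3]].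
    assert (G : fn n x * fn n x + dfn n x * dfn n x <= (fn n a * fn n a + dfn n a * dfn n a + 0 * 0) * S).
    { apply (gronwall a b C 0); auto. refine (ae_imp _ _ _ _ _ (ae_and _ _ _ _ HM s3)).
      intros z _ [Hq Dz]. exists ((q z - lamn n) * fn n z). split; [|exact Dz].
      rewrite Rplus_0_r. apply HMq; auto. }
    specialize (HV n). specialize (HV' n). apply Rabs_le_iff in HV, HV'.
    assert (fn n a * fn n a <= V * V) by nra. assert (dfn n a * dfn n a <= V' * V') by nra.
    assert ((fn n a * fn n a + dfn n a * dfn n a + 0 * 0) * S <= B) by (unfold B; apply Rmult_le_compat_r; lra).
    apply Rabs_le. nra. }
  assert (Hdiff : forall n k, ae_on a b (fun x => exists l,
      Rabs l <= C * Rabs (fn n x - fn k x) + Rabs (lamn k - lamn n) * (B + 1) /\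
      rderiv (Icc a b) (fun x => dfn n x - dfn k x) x l)).
  { intros n k. refine (ae_imp _ _ _ _ _ Aall). intros x Hx [Hq HD].
    exists ((q x - lamn n) * fn n x - (q x - lamn k) * fn k x). split; [|apply rderiv_minus; apply HD].
    replace ((q x - lamn n) * fn n x - (q x - lamn k) * fn k x) with
      ((q x - lamn n) * (fn n x - fn k x) + (lamn k - lamn n) * fn k x) by ring.
    eapply Rle_trans; [apply Rabs_triang|]. apply Rplus_le_compat; [apply HMq; auto|].
    rewrite Rabs_mult. apply Rmult_le_compat_l; [apply Rabs_pos|]. apply HB, Hx. }
  assert (Hder : forall n k x, Icc a b x -> rderiv (Icc a b) (fun x => fn n x - fn k x) x (dfn n x - dfn k x)).
  { intros n k x Hx. apply rderiv_minus; apply Hs, Hx. }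
  assert (Hacd : forall n k, rac a b (fun x => dfn n x - dfn k x)).
  { intros. apply rac_minus; apply Hs. }
  assert (CauS : forall u l, Un_cv u l -> forall eps, eps > 0 -> exists n0, forall n k,
     (n0 <= n)%nat -> (n0 <= k)%nat -> Rabs (u n - u k) <= eps).
  { intros u l H eps He. destruct (H (eps / 2) ltac:(lra)) as [n0 H0]. exists n0. intros n k Hn Hk.
    pose proof (H0 n Hn) as A1. pose proof (H0 k Hk) as A2. unfold Rdist in A1, A2.
    apply Rabs_def2 in A1, A2. apply Rabs_le. lra. }
  assert (Cau : forall eps, eps > 0 -> exists n0, forall n k, (n0 <= n)%nat -> (n0 <= k)%nat ->
     Rabs (lamn k - lamn n) * (B + 1) <= eps /\ forall x, Icc a b x ->
     Rabs (fn n x - fn k x) <= eps /\ Rabs (dfn n x - dfn k x) <= eps).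
  (* If both initial differences and [eta] are at most [e], the energy is at most 3 e^2 S = e eps,
     which is below eps^2. *)
  { intros eps He. set (e := eps / (3 * S)).
    assert (e0 : e > 0) by (apply Rdiv_lt_0_compat; lra).
    assert (eS : e * (3 * S) = eps) by (unfold e; field; lra).
    destruct (CauS _ _ Hal e e0) as [n1 H1]. destruct (CauS _ _ Hbe e e0) as [n2 H2].
    destruct (CauS _ _ Hlam (e / (B + 1)) ltac:(apply Rdiv_lt_0_compat; lra)) as [n3 H3].
    exists (n1 + n2 + n3)%nat. intros n k Hn Hk.
    specialize (H1 n k ltac:(lia) ltac:(lia)). specialize (H2 n k ltac:(lia) ltac:(lia)).
    specialize (H3 k n ltac:(lia) ltac:(lia)).
    set (eta := Rabs (lamn k - lamn n) * (B + 1)).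
    assert (Heta : 0 <= eta <= e).
    { split; [apply Rmult_le_pos; [apply Rabs_pos|lra]|]. unfold eta.
      apply Rmult_le_compat_r with (r := B + 1) in H3; [|lra].
      replace (e / (B + 1) * (B + 1)) with e in H3 by (field; lra). exact H3. }
    split; [nra|]. intros x Hx.
    pose proof (gronwall a b C eta (fun x => fn n x - fn k x) (fun x => dfn n x - dfn k x) HC
       (Hder n k) (Hacd n k) (Hdiff n k) x Hx) as G. cbv beta in G. fold S in G.
    apply Rabs_le_iff in H1, H2.
    assert (I : (fn n a - fn k a) * (fn n a - fn k a) + (dfn n a - dfn k a) * (dfn n a - dfn k a) + eta * eta
       <= 3 * (e * e)) by nra.
    apply Rmult_le_compat_r with (r := S) in I; [|lra].
    assert (J : 3 * (e * e) * S <= eps * eps).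
    { replace (3 * (e * e) * S) with (e * eps) by (rewrite <- eS; ring).
      apply Rmult_le_compat_r; nra. }
    apply sqr_sum_bound; lra. }
  assert (Lim : forall u : nat -> R -> R, (forall eps, eps > 0 -> exists n0, forall n k,
      (n0 <= n)%nat -> (n0 <= k)%nat -> forall x, Icc a b x -> Rabs (u n x - u k x) <= eps) ->
     exists F, forall x, Icc a b x -> Un_cv (fun n => u n x) (F x)).
  { intros u Hu. apply (choice (fun x y => Icc a b x -> Un_cv (fun n => u n x) y)). intros x.
    destruct (ClassicalEpsilon.excluded_middle_informative (Icc a b x)) as [Hx|Nx].
    - destruct (R_complete (fun n => u n x)) as [l Hl].
      + intros eps He. destruct (Hu (eps / 2) ltac:(lra)) as [n0 H0]. exists n0. intros n k Hn Hk.
        unfold Rdist. specialize (H0 n k Hn Hk x Hx). lra.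
      + exists l; auto.
    - exists 0; intros; contradiction. }
  destruct (Lim fn) as [f Hf].
  { intros eps He. destruct (Cau eps He) as [n0 H0]. exists n0. intros. apply (H0 n k); assumption. }
  destruct (Lim dfn) as [df Hdf].
  { intros eps He. destruct (Cau eps He) as [n0 H0]. exists n0. intros. apply (H0 n k); assumption. }
  assert (Unif : forall eps, eps > 0 -> exists n0, forall n x, (n0 <= n)%nat -> Icc a b x ->
      Rabs (fn n x - f x) <= eps /\ Rabs (dfn n x - df x) <= eps).
  { intros eps He. destruct (Cau eps He) as [n0 H0]. exists n0. intros n x Hn Hx. split.
    - apply (Un_cv_abs_le (fun k => fn n x - fn k x) _ _ n0).
      + apply CV_minus; [apply Un_cv_const|apply Hf, Hx].
      + intros k Hk. apply (H0 n k Hn Hk), Hx.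
    - apply (Un_cv_abs_le (fun k => dfn n x - dfn k x) _ _ n0).
      + apply CV_minus; [apply Un_cv_const|apply Hdf, Hx].
      + intros k Hk. apply (H0 n k Hn Hk), Hx. }
  assert (LipF : forall eps, eps > 0 -> exists k0, forall k, (k0 <= k)%nat ->
     forall x y, Icc a b x -> Icc a b y ->
       Rabs ((f y - fn k y) - (f x - fn k x)) <= eps * Rabs (y - x) /\
       Rabs ((df y - dfn k y) - (df x - dfn k x)) <= eps * Rabs (y - x)).
  (* The difference of the second derivatives is at most C e from the functions plus [e] from the
     parameters. *)
  { intros eps He. set (e := eps / (C + 1)).
    assert (e0 : e > 0) by (apply Rdiv_lt_0_compat; lra).
    assert (ee : e * (C + 1) = eps) by (unfold e; field; lra).
    assert (ele : e <= eps) by nra.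
    destruct (Cau e e0) as [k0 H0]. exists k0. intros k Hk x y Hx Hy. split.
    - apply (lipschitz_limit a b fn f k eps Hf); auto. intros n Hn.
      apply (rderiv_lipschitz a b (fun x => fn n x - fn k x) (fun x => dfn n x - dfn k x) eps Hab).
      intros z Hz. split; [apply Hder, Hz|].
      destruct (H0 n k ltac:(lia) Hk) as [_ H1]. specialize (H1 z Hz). lra.
    - apply (lipschitz_limit a b dfn df k eps Hdf); auto. intros n Hn.
      apply (rac_ae_lipschitz a b (fun x => dfn n x - dfn k x) eps (Hacd n k)).
      refine (ae_imp _ _ _ _ _ (Hdiff n k)). intros z Hz [l [Hl Dl]]. exists l. split; [|exact Dl].
      destruct (H0 n k ltac:(lia) Hk) as [H2 H1]. specialize (H1 z Hz). nra. }
  exists f, df. split; [|exact Unif]. split; [|split].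
  - intros x Hx. apply (uniform_limit_rderiv _ f fn (fun k => dfn k x)). intros eps He.
    destruct (LipF eps He) as [k0 HL]. destruct (Unif eps He) as [n0 HU].
    exists (k0 + n0)%nat. split; [intros y Hy; apply HL; auto; lia|]. split; [apply Hs, Hx|].
    apply HU; [lia|exact Hx].
  (* [df] is the absolutely continuous [dfn k0] plus a remainder with Lipschitz constant 1. *)
  - destruct (LipF 1 ltac:(lra)) as [k0 HL].
    apply (rac_ext a b (fun x => dfn k0 x + (df x - dfn k0 x))); [intros; ring|].
    apply rac_add; [apply Hs|]. apply (rac_lipschitz a b _ 1). intros x y H1 H2 H3.
    rewrite <- (Rabs_pos_eq (y - x)) by lra. apply (HL k0 (le_n _)); split; lra.
  - refine (ae_imp _ _ _ _ _ Aall). intros x Hx [Hq HD].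
    apply (uniform_limit_rderiv _ df dfn (fun k => (q x - lamn k) * fn k x)). intros eps He.
    destruct (LipF eps He) as [k0 HL].
    (* The two errors are at most C e and e (B + 1), the latter from the uniform bound B + 1 on the
       solutions. *)
    set (e := eps / (C + B + 2)).
    assert (e0 : e > 0) by (apply Rdiv_lt_0_compat; lra).
    assert (ee : e * (C + B + 2) = eps) by (unfold e; field; lra).
    destruct (Unif e e0) as [n0 HU]. destruct (Hlam e e0) as [n1 HU1].
    exists (k0 + n0 + n1)%nat. split; [intros y Hy; apply HL; auto; lia|]. split; [apply HD|].
    set (k := (k0 + n0 + n1)%nat).
    specialize (HU1 k ltac:(unfold k; lia)). unfold Rdist in HU1. rewrite Rabs_minus_sym in HU1.
    destruct (HU k x ltac:(unfold k; lia) Hx) as [HU2 _].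
    replace ((q x - lamn k) * fn k x - (q x - lam) * f x) with
      ((q x - lam) * (fn k x - f x) + (lam - lamn k) * fn k x) by ring.
    eapply Rle_trans; [apply Rabs_triang|].
    pose proof (HMq x lam (fn k x - f x) Hq HLa') as T.
    rewrite (Rabs_mult (lam - lamn k)). specialize (HB k x Hx).
    pose proof (Rabs_pos (lam - lamn k)). pose proof (Rabs_pos (fn k x)). nra.
Qed.

Lemma cderiv_rderiv D g x l : cderiv_pt D g x l <->
  rderiv D (fun y => fst (g y)) x (fst l) /\ rderiv D (fun y => snd (g y)) x (snd l).
Proof.
  assert (F : forall y, Cscale (/ (y - x)) (Csub (g y) (g x)) =
    ((fst (g y) - fst (g x)) / (y - x), (snd (g y) - snd (g x)) / (y - x))).
  { intros y. cx; unfold Rdiv; ring. }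
  rewrite !rderiv_iff. split.
  - intros H. split; intros eps He; destruct (H eps He) as [d [Hd Hy]]; exists d; (split; [exact Hd|]);
      intros y Dy Ny Ly; specialize (Hy y Dy Ny Ly); rewrite F in Hy;
      (eapply Rle_lt_trans; [|exact Hy]);
      match type of Hy with Cnorm ?w < _ => exact (Cnorm_re w) || exact (Cnorm_im w) end.
  - intros [H1 H2] eps He. destruct (H1 (eps / 2) ltac:(lra)) as [d1 [Hd1 Y1]].
    destruct (H2 (eps / 2) ltac:(lra)) as [d2 [Hd2 Y2]]. exists (Rmin d1 d2).
    split; [apply Rmin_pos; lra|]. intros y Dy Ny Ly.
    pose proof (Rmin_l d1 d2). pose proof (Rmin_r d1 d2).
    specialize (Y1 y Dy Ny ltac:(lra)). specialize (Y2 y Dy Ny ltac:(lra)).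
    rewrite F. eapply Rle_lt_trans; [apply Cnorm_le_add|].
    unfold Csub, Cadd, Copp; simpl. unfold Rminus in *. lra.
Qed.

Lemma abs_cont_rac a b g : abs_cont a b g <->
  rac a b (fun x => fst (g x)) /\ rac a b (fun x => snd (g x)).
Proof.
  split.
  - intros H. split; intros eps He; destruct (H eps He) as [d [Hd Hn]]; exists d; (split; [exact Hd|]);
      intros n x y Hx Ho Hs; (eapply Rle_lt_trans; [|exact (Hn n x y Hx Ho Hs)]);
      apply rsum_le; intros i _; [exact (Cnorm_re (Csub (g (y i)) (g (x i))))|exact (Cnorm_im (Csub (g (y i)) (g (x i))))].
  - intros [H1 H2] eps He. destruct (H1 (eps / 2) ltac:(lra)) as [d1 [Hd1 Y1]].
    destruct (H2 (eps / 2) ltac:(lra)) as [d2 [Hd2 Y2]]. exists (Rmin d1 d2).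
    split; [apply Rmin_pos; lra|]. intros n x y Hx Ho Hs.
    specialize (Y1 n x y Hx Ho (Rlt_le_trans _ _ _ Hs (Rmin_l _ _))).
    specialize (Y2 n x y Hx Ho (Rlt_le_trans _ _ _ Hs (Rmin_r _ _))).
    eapply Rle_lt_trans; [apply rsum_le; intros i _; apply Cnorm_le_add|].
    simpl. rewrite rsum_add. unfold Rminus in *. lra.
Qed.

Lemma eigfun_rsol m a b q lam f df : eigfun m a b q lam f df <->
  forall e, (e < m)%nat ->
    rsol (a e) (b e) (q e) lam (fun x => fst (f e x)) (fun x => fst (df e x)) /\
    rsol (a e) (b e) (q e) lam (fun x => snd (f e x)) (fun x => snd (df e x)).
Proof.
  split; intros H e He; specialize (H e He).
  - destruct H as [H1 [H2 H3]]. apply abs_cont_rac in H2.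
    split; (split; [|split; [apply H2|]]).
    + intros x Hx. apply (cderiv_rderiv _ (f e)), H1, Hx.
    + refine (ae_imp _ _ _ _ _ H3). intros x _ D. apply cderiv_rderiv in D. apply D.
    + intros x Hx. apply (cderiv_rderiv _ (f e)), H1, Hx.
    + refine (ae_imp _ _ _ _ _ H3). intros x _ D. apply cderiv_rderiv in D. apply D.
  - destruct H as [[H1 [H2 H3]] [K1 [K2 K3]]]. split; [|split].
    + intros x Hx. apply cderiv_rderiv. split; [apply H1|apply K1]; exact Hx.
    + apply abs_cont_rac. split; assumption.
    + refine (ae_imp _ _ _ _ _ (ae_and _ _ _ _ H3 K3)). intros x _ D. apply cderiv_rderiv, D.
Qed.

Lemma rsol_scal a b q lam r f df : rsol a b q lam f df ->
  rsol a b q lam (fun x => r * f x) (fun x => r * df x).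
Proof.
  intros [H1 [H2 H3]]. split; [|split].
  - intros x Hx. apply rderiv_scal, H1, Hx.
  - apply rac_scal, H2.
  - refine (ae_imp _ _ _ _ _ H3). intros x _ D.
    eapply rderiv_eq; [apply rderiv_scal, D|]. ring.
Qed.

(** Uniqueness for the initial value problem, from [gronwall] with eta = 0. *)
Lemma rsol_zero a b q lam M f df : ae_on a b (fun x => Rabs (q x) <= M) -> rsol a b q lam f df ->
  f a = 0 -> df a = 0 -> forall x, Icc a b x -> f x = 0.
Proof.
  intros HM [H1 [H2 H3]] fa dfa x Hx.
  assert (HC : 0 <= Rabs M + Rabs lam) by (pose proof (Rabs_pos M); pose proof (Rabs_pos lam); lra).
  pose proof (gronwall a b (Rabs M + Rabs lam) 0 f df HC H1 H2) as G.
  assert (E : f x * f x + df x * df x <= (f a * f a + df a * df a + 0 * 0) *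
     exp ((Rabs M + Rabs lam + 2) * (b - a))).
  { apply G; [|exact Hx]. refine (ae_imp _ _ _ _ _ (ae_and _ _ _ _ HM H3)). intros z _ [Hq D].
    exists ((q z - lam) * f z). split; [|exact D].
    rewrite Rabs_mult, Rplus_0_r. apply Rmult_le_compat_r; [apply Rabs_pos|].
    pose proof (Rabs_triang (q z) (- lam)) as T. rewrite Rabs_Ropp in T. pose proof (RRle_abs M).
    unfold Rminus. lra. }
  rewrite fa, dfa in E. replace ((0 * 0 + 0 * 0 + 0 * 0) * exp ((Rabs M + Rabs lam + 2) * (b - a))) with 0 in E by ring.
  nra.
Qed.

(** In a nondegenerate closed interval every point, endpoints included, is approached from within.
    Uniqueness at the endpoints is what determines [gammaN] from the function. *)
Lemma rderiv_unique a b f x l k : a < b -> Icc a b x ->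
  rderiv (Icc a b) f x l -> rderiv (Icc a b) f x k -> l = k.
Proof.
  intros Hab Hx. rewrite !rderiv_lin. intros Hl Hk.
  apply Rminus_diag_uniq. destruct (Req_dec (l - k) 0) as [E|E]; [exact E|exfalso].
  assert (P : 0 < Rabs (l - k)) by (apply Rabs_pos_lt, E). set (e := Rabs (l - k) / 4).
  destruct (Hl e ltac:(unfold e; lra)) as [d1 [Hd1 Y1]].
  destruct (Hk e ltac:(unfold e; lra)) as [d2 [Hd2 Y2]].
  assert (exists y, Icc a b y /\ y <> x /\ Rabs (y - x) < d1 /\ Rabs (y - x) < d2) as [y [Hy [Ny [L1 L2]]]].
  { set (r := Rmin (Rmin d1 d2) (b - a) / 2).
    assert (r0 : 0 < r) by (unfold r; pose proof (Rmin_pos (Rmin d1 d2) (b - a) (Rmin_pos d1 d2 Hd1 Hd2) ltac:(lra)); lra).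
    assert (r1 : r < d1 /\ r < d2 /\ r <= (b - a) / 2).
    { unfold r in *. pose proof (Rmin_l (Rmin d1 d2) (b - a)). pose proof (Rmin_r (Rmin d1 d2) (b - a)).
      pose proof (Rmin_l d1 d2). pose proof (Rmin_r d1 d2). lra. }
    (* Moving by [r] <= (b - a) / 2 towards the farther endpoint stays in the interval. *)
    destruct Hx as [x1 x2]. destruct (Rle_dec x ((a + b) / 2)).
    - exists (x + r). replace (x + r - x) with r by ring. rewrite Rabs_pos_eq by lra.
      unfold Icc. repeat split; lra.
    - exists (x - r). replace (x - r - x) with (- r) by ring. rewrite Rabs_Ropp, Rabs_pos_eq by lra.
      unfold Icc. repeat split; lra. }
  specialize (Y1 y Hy L1). specialize (Y2 y Hy L2).
  assert (Q : 0 < Rabs (y - x)) by (apply Rabs_pos_lt; lra).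
  assert (T : Rabs ((l - k) * (y - x)) <= 2 * e * Rabs (y - x)).
  { replace ((l - k) * (y - x)) with ((f y - f x - k * (y - x)) - (f y - f x - l * (y - x))) by ring.
    eapply Rle_trans; [apply Rabs_triang|]. rewrite Rabs_Ropp. lra. }
  rewrite Rabs_mult in T. unfold e in T. nra.
Qed.

Lemma riemann_primitive a b (p : R -> R) (pr : Riemann_integrable p a b) : a < b -> rac a b p ->
  exists P, (forall x, Icc a b x -> rderiv (Icc a b) P x (p x)) /\ P b - P a = RiemannInt pr.
Proof.
  intros Hab Hp.
  (* Composition with the clamp to [a, b] extends [p] to a function continuous on the whole line
     without changing its integral. *)
  set (cl := fun x => Rmax a (Rmin x b)).
  assert (cl1 : forall x, Icc a b (cl x)).
  { intros x. unfold cl, Icc, Rmax, Rmin. repeat destruct Rle_dec; lra. }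
  assert (cl2 : forall x, Icc a b x -> cl x = x).
  { intros x [? ?]. unfold cl, Rmax, Rmin. repeat destruct Rle_dec; lra. }
  assert (cl3 : forall x y, Rabs (cl x - cl y) <= Rabs (x - y)).
  { intros x y. unfold cl, Rmax, Rmin, Rabs. repeat destruct Rle_dec; repeat destruct Rcase_abs; lra. }
  set (g := fun x => p (cl x)).
  assert (gc : forall x, continuity_pt g x).
  { intros x eps He. destruct (rac_cont a b p Hp eps He) as [d [Hd Hc]]. exists d; split; [exact Hd|].
    intros y [_ Ly]. simpl in *. unfold Rdist in *. unfold g.
    specialize (cl3 y x). pose proof (cl1 x) as [? ?]. pose proof (cl1 y) as [? ?].
    destruct (Rle_dec (cl x) (cl y)).
    - apply Hc; try lra. rewrite Rabs_pos_eq in cl3 by lra. lra.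
    - rewrite Rabs_minus_sym. apply Hc; try lra. rewrite Rabs_left in cl3 by lra. lra. }
  assert (hab : a <= b) by lra.
  (* Here [C0] names the continuity of [g] on [a, b], not the complex zero. *)
  set (C0 := fun x (_ : a <= x <= b) => gc x).
  exists (primitive hab (FTC_P1 hab C0)). split.
  - intros x Hx. apply rderiv_of_derivable.
    replace (p x) with (g x) by (unfold g; rewrite (cl2 x Hx); reflexivity).
    exact (RiemannInt_P28 hab C0 Hx).
  - unfold primitive. destruct (Rle_dec a b); [|lra]. destruct (Rle_dec b b); [|lra].
    destruct (Rle_dec a a); [|lra].
    rewrite RiemannInt_P9, Rminus_0_r. apply RiemannInt_P18; [exact hab|].
    intros x Hx. unfold g. rewrite cl2; [reflexivity|]. split; lra.
Qed.

(** * The Wronskian identity and its limit *)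

Section Wronskian.
Variables (a b : R) (q : R -> R) (lam mu s : R) (f1 df1 f2 df2 g1 dg1 g2 dg2 : R -> R).
Hypothesis Hab : a <= b.
Hypotheses (F1 : rsol a b q lam f1 df1) (F2 : rsol a b q lam f2 df2).
Hypotheses (G1 : rsol a b q mu g1 dg1) (G2 : rsol a b q mu g2 dg2).

(** One formula for both parts of the complex Wronskian f conj(g') - f' conj(g): s = 1 with matching
    components gives the real part, s = -1 with the components of f swapped the imaginary part. *)
Definition wronskian2 (x : R) : R :=
  (f1 x * dg1 x - df1 x * g1 x) + s * (f2 x * dg2 x - df2 x * g2 x).

(** Almost everywhere the Wronskian has derivative (lam - mu) (f1 g1 + s f2 g2). Subtracting (lam -
    mu) k P leaves a function with Lipschitz constant |lam - mu| e, so the product is never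
    integrated. *)
Lemma wronskian2_estimate P p k e :
  (forall x, Icc a b x -> rderiv (Icc a b) P x (p x)) -> rac a b p ->
  (forall x, Icc a b x -> Rabs (f1 x * g1 x + s * (f2 x * g2 x) - k * p x) <= e) ->
  Rabs (wronskian2 b - wronskian2 a - (lam - mu) * (k * (P b - P a))) <= Rabs (lam - mu) * e * (b - a).
Proof.
  intros HP Hp He.
  destruct F1 as [a1 [b1 c1]], F2 as [a2 [b2 c2]], G1 as [a3 [b3 c3]], G2 as [a4 [b4 c4]].
  assert (h1 := c1_rac _ _ _ _ Hab a1 b1). assert (h2 := c1_rac _ _ _ _ Hab a2 b2).
  assert (h3 := c1_rac _ _ _ _ Hab a3 b3). assert (h4 := c1_rac _ _ _ _ Hab a4 b4).
  assert (hP := c1_rac _ _ _ _ Hab HP Hp).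
  replace (wronskian2 b - wronskian2 a - (lam - mu) * (k * (P b - P a))) with
    ((wronskian2 b - (lam - mu) * k * P b) - (wronskian2 a - (lam - mu) * k * P a)) by ring.
  apply (rac_ae_lipschitz a b (fun x => wronskian2 x - (lam - mu) * k * P x)); try lra.
  - unfold wronskian2. apply rac_minus; [|apply rac_scal, hP].
    apply rac_add; [|apply rac_scal]; apply rac_minus; apply rac_mul; assumption.
  - refine (ae_imp _ _ _ _ _ (ae_and _ _ _ _ (ae_and _ _ _ _ c1 c2) (ae_and _ _ _ _ c3 c4))).
    intros x Hx [[d1 d2] [d3 d4]].
    exists ((lam - mu) * (f1 x * g1 x + s * (f2 x * g2 x) - k * p x)). split.
    + rewrite Rabs_mult. apply Rmult_le_compat_l; [apply Rabs_pos|apply He, Hx].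
    + unfold wronskian2. eapply rderiv_eq.
      * apply rderiv_minus; [|apply rderiv_scal, HP, Hx].
        apply rderiv_add; [|apply rderiv_scal]; apply rderiv_minus; apply rderiv_mul; eauto.
      * simpl. ring.
Qed.
End Wronskian.

(** The quotients (lamn n - mu) / sn n are bounded, so the uniform error in the product still tends
    to zero after division by [sn n]. *)
Lemma wronskian2_limit a b q (lamn sn : nat -> R) mu s dl
  (f1 df1 f2 df2 : nat -> R -> R) g1 dg1 g2 dg2 P p k :
  a <= b ->
  (forall n, rsol a b q (lamn n) (f1 n) (df1 n)) -> (forall n, rsol a b q (lamn n) (f2 n) (df2 n)) ->
  rsol a b q mu g1 dg1 -> rsol a b q mu g2 dg2 ->
  (forall x, Icc a b x -> rderiv (Icc a b) P x (p x)) -> rac a b p ->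
  (forall eps, eps > 0 -> exists n0, forall n x, (n0 <= n)%nat -> Icc a b x ->
     Rabs (f1 n x * g1 x + s * (f2 n x * g2 x) - k * p x) <= eps) ->
  Un_cv (fun n => (lamn n - mu) / sn n) dl ->
  Un_cv (fun n => (wronskian2 s (f1 n) (df1 n) (f2 n) (df2 n) g1 dg1 g2 dg2 b -
     wronskian2 s (f1 n) (df1 n) (f2 n) (df2 n) g1 dg1 g2 dg2 a) / sn n) (dl * (k * (P b - P a))).
Proof.
  intros Hab F1 F2 G1 G2 HP Hp Hu Hl eps He.
  destruct (Un_cv_bounded _ _ Hl) as [B [B0 HB]].
  set (J := k * (P b - P a)).
  set (e := eps / (2 * (B * (b - a) + 1))).
  assert (D : 0 < B * (b - a) + 1) by nra.
  assert (e0 : e > 0) by (apply Rdiv_lt_0_compat; lra).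
  assert (ee : e * (B * (b - a) + 1) = eps / 2) by (unfold e; field; lra).
  destruct (Hu e e0) as [n1 H1].
  assert (J0 : 0 < Rabs J + 1) by (pose proof (Rabs_pos J); lra).
  destruct (Hl (eps / (2 * (Rabs J + 1))) ltac:(apply Rdiv_lt_0_compat; lra)) as [n2 H2].
  exists (n1 + n2)%nat. intros n Hn. specialize (H2 n ltac:(lia)). unfold Rdist in *.
  pose proof (wronskian2_estimate a b q (lamn n) mu s (f1 n) (df1 n) (f2 n) (df2 n) g1 dg1 g2 dg2
    Hab (F1 n) (F2 n) G1 G2 P p k e HP Hp (fun x Hx => H1 n x ltac:(lia) Hx)) as W.
  fold J in W.
  set (w := wronskian2 s (f1 n) (df1 n) (f2 n) (df2 n) g1 dg1 g2 dg2 b -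
     wronskian2 s (f1 n) (df1 n) (f2 n) (df2 n) g1 dg1 g2 dg2 a) in *.
  replace (w / sn n - dl * J) with ((w - (lamn n - mu) * J) * / sn n + ((lamn n - mu) / sn n - dl) * J)
    by (unfold Rdiv; ring).
  eapply Rle_lt_trans; [apply Rabs_triang|]. rewrite !Rabs_mult.
  (* By the choice of [e], B e (b - a) equals eps / 2 - e; the spare [e] makes the final inequality
     strict. *)
  assert (W' : Rabs (w - (lamn n - mu) * J) * Rabs (/ sn n) <= eps / 2 - e).
  { apply Rle_trans with (Rabs (lamn n - mu) * e * (b - a) * Rabs (/ sn n)).
    - apply Rmult_le_compat_r; [apply Rabs_pos|exact W].
    - specialize (HB n). unfold Rdiv in HB. rewrite Rabs_mult in HB.
      replace (Rabs (lamn n - mu) * e * (b - a) * Rabs (/ sn n)) with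
        (Rabs (lamn n - mu) * Rabs (/ sn n) * (e * (b - a))) by ring.
      apply Rle_trans with (B * (e * (b - a))); [|nra].
      apply Rmult_le_compat_r; [|exact HB]. apply Rmult_le_pos; lra. }
  assert (Rabs ((lamn n - mu) / sn n - dl) * Rabs J <= eps / 2).
  { apply Rle_trans with (eps / (2 * (Rabs J + 1)) * (Rabs J + 1)).
    - pose proof (Rabs_pos J). pose proof (Rabs_pos ((lamn n - mu) / sn n - dl)).
      apply Rmult_le_compat; lra.
    - right. field. lra. }
  lra.
Qed.

(** * Convergent selections common to finitely many sequences *)

Lemma Un_cv_subseq u l (phi : nat -> nat) : (forall k, (k <= phi k)%nat) -> Un_cv u l ->
  Un_cv (fun k => u (phi k)) l.
Proof.
  intros Hp H eps He. destruct (H eps He) as [n0 H0]. exists n0. intros n Hn. apply H0.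
  specialize (Hp n). lia.
Qed.

(** A cluster point is approached within 1 / (k + 1) by some term of index at least k. The selection
    need not be increasing: k <= phi k already preserves limits. *)
Lemma bolzano_weierstrass_seq (u : nat -> R) M : (forall n, Rabs (u n) <= M) ->
  exists phi l, (forall k, (k <= phi k)%nat) /\ Un_cv (fun k => u (phi k)) l.
Proof.
  intros H. destruct (Bolzano_Weierstrass u (fun x => - M <= x <= M) (compact_P3 (- M) M)) as [l Hl].
  { intros n. apply Rabs_le_iff, H. }
  destruct (choice (fun k p => (k <= p)%nat /\ Rabs (u p - l) < / (INR k + 1))) as [phi Hphi].
  { intros k. assert (P : 0 < / (INR k + 1)) by (apply Rinv_0_lt_compat; pose proof (pos_INR k); lra).
    destruct (Hl (disc l (mkposreal _ P)) k) as [p [H1 H2]].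
    - exists (mkposreal _ P). intros x Hx. exact Hx.
    - exists p. split; [exact H1|exact H2]. }
  exists phi, l. split; [apply Hphi|]. intros eps He.
  destruct (archimed_cor1 eps He) as [n0 [H0 H1]]. exists n0. intros n Hn. unfold Rdist.
  destruct (Hphi n) as [_ A]. eapply Rlt_trans; [exact A|]. eapply Rle_lt_trans; [|exact H0].
  apply Rinv_le_contravar; [apply lt_0_INR; lia|]. apply le_INR in Hn. lra.
Qed.

Lemma bolzano_weierstrass_list (us : list (nat -> R)) M :
  (forall u, In u us -> forall n, Rabs (u n) <= M) ->
  exists phi, (forall k, (k <= phi k)%nat) /\
    forall u, In u us -> exists l, Un_cv (fun k => u (phi k)) l.
Proof.
  induction us as [|u us IH]; intros H.
  - exists (fun k => k). split; [auto|]. intros u [].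
  - destruct IH as [phi [P1 P2]]; [intros; apply H; right; assumption|].
    destruct (bolzano_weierstrass_seq (fun k => u (phi k)) M) as [psi [l [Q1 Q2]]].
    { intros n. apply H; left; reflexivity. }
    exists (fun k => phi (psi k)). split.
    + intros k. specialize (Q1 k). specialize (P1 (psi k)). lia.
    + intros v [<-|Hv]; [exists l; exact Q2|]. destruct (P2 v Hv) as [l' Hl']. exists l'.
      apply (Un_cv_subseq (fun k => v (phi k))); assumption.
Qed.

(** * Eigenfunctions on the graph *)

Lemma odd_double e : Nat.odd (2 * e) = false.
Proof. rewrite Nat.odd_even. reflexivity. Qed.
Lemma odd_double_succ e : Nat.odd (S (2 * e)) = true.
Proof. replace (S (2 * e)) with (2 * e + 1)%nat by lia. apply Nat.odd_odd. Qed.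

Lemma gammaD_left f a b e : gammaD f a b (2 * e)%nat = f e (a e).
Proof. unfold gammaD. rewrite odd_double, Nat.div2_double. reflexivity. Qed.
Lemma gammaD_right f a b e : gammaD f a b (S (2 * e)) = f e (b e).
Proof. unfold gammaD. rewrite odd_double_succ, Nat.div2_succ_double. reflexivity. Qed.
Lemma gammaN_left df a b e : gammaN df a b (2 * e)%nat = df e (a e).
Proof. unfold gammaN. rewrite odd_double, Nat.div2_double. reflexivity. Qed.
Lemma gammaN_right df a b e : gammaN df a b (S (2 * e)) = Copp (df e (b e)).
Proof. unfold gammaN. rewrite odd_double_succ, Nat.div2_succ_double. reflexivity. Qed.

Lemma endpoint_cases m p : (p < 2 * m)%nat -> exists e, (e < m)%nat /\ (p = (2 * e)%nat \/ p = S (2 * e)).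
Proof.
  intros H. exists (Nat.div2 p). pose proof (Nat.div2_odd p).
  destruct (Nat.odd p); simpl Nat.b2n in *; lia.
Qed.

Lemma csum_pairs m F : csum (2 * m) F = csum m (fun e => Cadd (F (2 * e)%nat) (F (S (2 * e)))).
Proof.
  induction m as [|m IH]; [reflexivity|].
  replace (2 * S m)%nat with (S (S (2 * m))) by lia. cbn [csum]. rewrite IH. ring.
Qed.

Definition trace (f df : nat -> R -> Cx) (a b : nat -> R) : vec2 := (gammaD f a b, gammaN df a b).

Definition wronskianC (f df u du : nat -> R -> Cx) (e : nat) (x : R) : Cx :=
  Csub (Cmul (f e x) (Cconj (du e x))) (Cmul (df e x) (Cconj (u e x))).

(** The derivative pointing into the edge changes sign at the right endpoint, which turns the sum
    over endpoints into boundary differences of the Wronskian. *)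
Lemma omega_trace m a b f df u du :
  omega (2 * m) (trace f df a b) (trace u du a b) =
  csum m (fun e => Csub (wronskianC f df u du e (b e)) (wronskianC f df u du e (a e))).
Proof.
  unfold omega. rewrite csum_pairs. apply csum_ext; intros e _. unfold trace, wronskianC; cbn [fst snd].
  rewrite !gammaD_left, !gammaD_right, !gammaN_left, !gammaN_right, Cconj_opp. ring.
Qed.

Lemma Cnorm_sqr_pow x : Cnorm x ^ 2 = fst x * fst x + snd x * snd x.
Proof. rewrite <- Cnorm_sqr. ring. Qed.

Lemma eigfun_primitive m a b q lam u du I : (forall e, (e < m)%nat -> a e < b e) ->
  eigfun m a b q lam u du ->
  (forall e, (e < m)%nat -> exists pr : Riemann_integrable
        (fun x => Cnorm (u e x) ^ 2) (a e) (b e), RiemannInt pr = I e) ->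
  forall e, (e < m)%nat -> rac (a e) (b e) (fun x => Cnorm (u e x) ^ 2) /\
   exists P, (forall x, Icc (a e) (b e) x -> rderiv (Icc (a e) (b e)) P x (Cnorm (u e x) ^ 2)) /\
     P (b e) - P (a e) = I e.
Proof.
  intros Hab Hu HI e He. rewrite eigfun_rsol in Hu.
  destruct (Hu e He) as [[a1 [b1 _]] [a2 [b2 _]]]. specialize (Hab e He).
  assert (Hab' : a e <= b e) by lra.
  assert (h1 := c1_rac _ _ _ _ Hab' a1 b1). assert (h2 := c1_rac _ _ _ _ Hab' a2 b2).
  assert (ac : rac (a e) (b e) (fun x => Cnorm (u e x) ^ 2)).
  { apply (rac_ext _ _ (fun x => fst (u e x) * fst (u e x) + snd (u e x) * snd (u e x))).
    - intros x. symmetry; apply Cnorm_sqr_pow.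
    - apply rac_add; apply rac_mul; assumption. }
  split; [exact ac|]. destruct (HI e He) as [pr <-]. apply riemann_primitive; assumption.
Qed.

(** If [u] vanished everywhere, the primitives of |u|^2 would be constant and the total mass 0
    instead of 1. *)
Lemma normalized_nonzero m a b q lam u du : (forall e, (e < m)%nat -> a e < b e) ->
  eigfun m a b q lam u du -> normalized m a b u -> nonzero_fun m a b u.
Proof.
  intros Hab Hu [I [HI HS]]. apply Classical_Prop.NNPP. intros N.
  assert (Z : forall e x, (e < m)%nat -> Icc (a e) (b e) x -> u e x = C0).
  { intros e x He Hx. apply Classical_Prop.NNPP. intros N'. apply N. exists e, x. auto. }
  assert (rsum m I = 0); [|lra].
  rewrite (rsum_ext m I (fun _ => 0)); [rewrite rsum_const; ring|]. intros e He.
  destruct (eigfun_primitive m a b q lam u du I Hab Hu HI e He) as [_ [P [HP <-]]].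
  specialize (Hab e He).
  assert (L : Rabs (P (b e) - P (a e)) <= 0 * (b e - a e)).
  { apply (rderiv_lipschitz (a e) (b e) P (fun x => Cnorm (u e x) ^ 2) 0); try lra.
    intros x Hx. split; [apply HP, Hx|]. rewrite (Z e x He Hx), Cnorm_0. rewrite pow_i by lia.
    rewrite Rabs_R0. lra. }
  rewrite Rmult_0_l in L. apply Rabs_le_iff in L. lra.
Qed.

Lemma tends_of_Un_cv (g : nat -> Cx) l : Un_cv (fun n => fst (g n)) (fst l) ->
  Un_cv (fun n => snd (g n)) (snd l) -> tends evtl g l.
Proof.
  intros H1 H2 eps He. destruct (H1 (eps / 2) ltac:(lra)) as [n1 Y1].
  destruct (H2 (eps / 2) ltac:(lra)) as [n2 Y2]. exists (n1 + n2)%nat. intros n Hn.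
  specialize (Y1 n ltac:(lia)). specialize (Y2 n ltac:(lia)). unfold Rdist in *.
  eapply Rle_lt_trans; [apply Cnorm_le_add|]. unfold Csub, Cadd, Copp; simpl. unfold Rminus in *. lra.
Qed.

Lemma uniform_mul (a b : R) (s M : R) (f1 f2 : nat -> R -> R) F1 F2 g1 g2 : Rabs s = 1 ->
  (forall x, Icc a b x -> Rabs (g1 x) <= M /\ Rabs (g2 x) <= M) -> 0 <= M ->
  (forall eps, eps > 0 -> exists n0, forall n x, (n0 <= n)%nat -> Icc a b x ->
     Rabs (f1 n x - F1 x) <= eps /\ Rabs (f2 n x - F2 x) <= eps) ->
  forall eps, eps > 0 -> exists n0, forall n x, (n0 <= n)%nat -> Icc a b x ->
     Rabs (f1 n x * g1 x + s * (f2 n x * g2 x) - (F1 x * g1 x + s * (F2 x * g2 x))) <= eps.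
Proof.
  intros Hs HM M0 H eps He. set (e := eps / (2 * (M + 1))).
  assert (e0 : e > 0) by (apply Rdiv_lt_0_compat; lra).
  assert (ee : 2 * (M + 1) * e = eps) by (unfold e; field; lra).
  destruct (H e e0) as [n0 H0]. exists n0. intros n x Hn Hx.
  destruct (H0 n x Hn Hx) as [A B]. destruct (HM x Hx) as [G1 G2].
  replace (f1 n x * g1 x + s * (f2 n x * g2 x) - (F1 x * g1 x + s * (F2 x * g2 x))) with
    ((f1 n x - F1 x) * g1 x + s * ((f2 n x - F2 x) * g2 x)) by ring.
  eapply Rle_trans; [apply Rabs_triang|]. rewrite !Rabs_mult, Hs, Rmult_1_l.
  assert (Rabs (f1 n x - F1 x) * Rabs (g1 x) <= e * M) by (apply Rmult_le_compat; auto using Rabs_pos).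
  assert (Rabs (f2 n x - F2 x) * Rabs (g2 x) <= e * M) by (apply Rmult_le_compat; auto using Rabs_pos).
  lra.
Qed.

(** As f_n tends uniformly to c u, the pairing with [u] tends to c times the squared norm of [u],
    which is c; the eigenvalue quotient supplies the factor [dl]. *)
Lemma green_limit m a b q (lamn sn : nat -> R) lam0 dl (fn dfn : nat -> nat -> R -> Cx) u du c :
  (forall e, (e < m)%nat -> a e < b e) ->
  (forall n, eigfun m a b q (lamn n) (fn n) (dfn n)) -> eigfun m a b q lam0 u du ->
  normalized m a b u ->
  (forall e, (e < m)%nat -> forall eps, eps > 0 -> exists n0, forall n x, (n0 <= n)%nat ->
     Icc (a e) (b e) x -> Cnorm (Csub (fn n e x) (Cmul c (u e x))) <= eps) ->
  Un_cv (fun n => (lamn n - lam0) / sn n) dl ->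
  tends evtl (fun n => Cscale (/ sn n) (omega (2 * m) (trace (fn n) (dfn n) a b) (trace u du a b)))
    (Cmul (RtoC dl) c).
Proof.
  intros Hab Hf Hu [I [HI HS]] Hc Hl.
  assert (Prim := eigfun_primitive m a b q lam0 u du I Hab Hu HI).
  (* The limit is distributed over the edges by the masses I e, which sum to 1. *)
  replace (Cmul (RtoC dl) c) with (csum m (fun e => (dl * (fst c * I e), dl * (snd c * I e)))).
  2:{ assert (E : forall k, csum k (fun e => (dl * (fst c * I e), dl * (snd c * I e))) =
         (dl * (fst c * rsum k I), dl * (snd c * rsum k I))).
      { induction k as [|k IH]; simpl; [|rewrite IH]; cx. }
      rewrite E, HS. cx. }
  pose proof evtl_filter as HF.
  apply (tends_ext _ HF (fun n => csum m (fun e => Cscale (/ sn n)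
     (Csub (wronskianC (fn n) (dfn n) u du e (b e)) (wronskianC (fn n) (dfn n) u du e (a e)))))).
  { intros n. rewrite omega_trace, Cscale_mul, <- csum_mul_l. apply csum_ext; intros.
    apply Cscale_mul. }
  apply (tends_csum _ HF). intros e He. destruct (Prim e He) as [ac [P [HP <-]]].
  specialize (Hab e He). rewrite eigfun_rsol in Hu. destruct (Hu e He) as [U1 U2].
  assert (Hf' : forall n, _) by (intros n; exact (proj1 (eigfun_rsol _ _ _ _ _ _ _) (Hf n) e He)).
  destruct (rac_bounded (a e) (b e) (fun x => fst (u e x))) as [M1 [P1 HM1]]; [lra| |].
  { destruct U1 as [U1a [U1b _]]. exact (c1_rac _ _ _ _ (Rlt_le _ _ Hab) U1a U1b). }
  destruct (rac_bounded (a e) (b e) (fun x => snd (u e x))) as [M2 [P2 HM2]]; [lra| |].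
  { destruct U2 as [U2a [U2b _]]. exact (c1_rac _ _ _ _ (Rlt_le _ _ Hab) U2a U2b). }
  assert (HM : forall x, Icc (a e) (b e) x -> Rabs (fst (u e x)) <= M1 + M2 /\ Rabs (snd (u e x)) <= M1 + M2).
  { intros x Hx. specialize (HM1 x Hx). specialize (HM2 x Hx). lra. }
  assert (unif : forall eps, eps > 0 -> exists n0, forall n x, (n0 <= n)%nat -> Icc (a e) (b e) x ->
     Rabs (fst (fn n e x) - fst (Cmul c (u e x))) <= eps /\ Rabs (snd (fn n e x) - snd (Cmul c (u e x))) <= eps).
  { intros eps Hp. destruct (Hc e He eps Hp) as [n0 H0]. exists n0. intros n x Hn Hx.
    specialize (H0 n x Hn Hx). split; (eapply Rle_trans; [|exact H0]).
    - exact (Cnorm_re (Csub (fn n e x) (Cmul c (u e x)))).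
    - exact (Cnorm_im (Csub (fn n e x) (Cmul c (u e x)))). }
  apply tends_of_Un_cv; cbn [fst snd].
  - refine (Un_cv_ext _ _ _ _ (wronskian2_limit (a e) (b e) (q e) lamn sn lam0 1 dl
      (fun n x => fst (fn n e x)) (fun n x => fst (dfn n e x)) (fun n x => snd (fn n e x)) (fun n x => snd (dfn n e x))
      (fun x => fst (u e x)) (fun x => fst (du e x)) (fun x => snd (u e x)) (fun x => snd (du e x))
      P (fun x => Cnorm (u e x) ^ 2) (fst c) _ _ _ U1 U2 HP ac _ Hl)); try lra.
    + intros n. unfold wronskian2, wronskianC, Cscale, Csub, Cadd, Copp, Cmul, Cconj, Rdiv; simpl. ring.
    + intros n; apply (Hf' n).
    + intros n; apply (Hf' n).
    + intros eps Hp. destruct (uniform_mul (a e) (b e) 1 (M1 + M2) (fun n x => fst (fn n e x)) (fun n x => snd (fn n e x))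
        (fun x => fst (Cmul c (u e x))) (fun x => snd (Cmul c (u e x))) (fun x => fst (u e x)) (fun x => snd (u e x))
        Rabs_R1 HM ltac:(lra) unif eps Hp) as [n0 H0].
      exists n0. intros n x Hn Hx. eapply Rle_trans; [|exact (H0 n x Hn Hx)]. right; f_equal.
      rewrite Cnorm_sqr_pow. unfold Cmul; simpl. ring.
  (* Imaginary part: the components of f_n are swapped and s = -1. The combination then tends to
     Im(c u conj(u)), that is [snd c] times |u|^2. *)
  - refine (Un_cv_ext _ _ _ _ (wronskian2_limit (a e) (b e) (q e) lamn sn lam0 (-1) dl
      (fun n x => snd (fn n e x)) (fun n x => snd (dfn n e x)) (fun n x => fst (fn n e x)) (fun n x => fst (dfn n e x))
      (fun x => fst (u e x)) (fun x => fst (du e x)) (fun x => snd (u e x)) (fun x => snd (du e x))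
      P (fun x => Cnorm (u e x) ^ 2) (snd c) _ _ _ U1 U2 HP ac _ Hl)); try lra.
    + intros n. unfold wronskian2, wronskianC, Cscale, Csub, Cadd, Copp, Cmul, Cconj, Rdiv; simpl. ring.
    + intros n; apply (Hf' n).
    + intros n; apply (Hf' n).
    + intros eps Hp. destruct (uniform_mul (a e) (b e) (-1) (M1 + M2) (fun n x => snd (fn n e x)) (fun n x => fst (fn n e x))
        (fun x => snd (Cmul c (u e x))) (fun x => fst (Cmul c (u e x))) (fun x => fst (u e x)) (fun x => snd (u e x))
        ltac:(unfold Rabs; destruct (Rcase_abs (-1)); lra) HM ltac:(lra)
        ltac:(intros ep Hep; destruct (unif ep Hep) as [k Hk]; exists k; intros n x Hn Hx; destruct (Hk n x Hn Hx); auto)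
        eps Hp) as [n0 H0].
      exists n0. intros n x Hn Hx. eapply Rle_trans; [|exact (H0 n x Hn Hx)]. right; f_equal.
      rewrite Cnorm_sqr_pow. unfold Cmul; simpl. ring.
Qed.

(** The scaling used for eigenfunctions: it bounds the initial values on all edges at once and is
    continuous under convergence of traces, so it shows that limits are nonzero. *)
Definition trace_norm m (f df : nat -> R -> Cx) (a b : nat -> R) : R :=
  rsum (2 * m) (fun p => Cnorm (gammaD f a b p) + Cnorm (gammaN df a b p)).

Lemma trace_norm_zero m a b f df p : trace_norm m f df a b = 0 -> (p < 2 * m)%nat ->
  gammaD f a b p = C0 /\ gammaN df a b p = C0.
Proof.
  intros H Hp.
  assert (P : forall i, 0 <= Cnorm (gammaD f a b i) + Cnorm (gammaN df a b i)).
  { intros i. pose proof (Cnorm_ge0 (gammaD f a b i)). pose proof (Cnorm_ge0 (gammaN df a b i)). lra. }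
  pose proof (rsum_zero_inv _ _ (fun i _ => P i) H p Hp) as E. cbv beta in E.
  pose proof (Cnorm_ge0 (gammaD f a b p)). pose proof (Cnorm_ge0 (gammaN df a b p)).
  split; apply Cnorm_eq0; lra.
Qed.

Lemma Linf_bounded m a b q : (forall e, (e < m)%nat -> Linf_on (a e) (b e) (q e)) ->
  forall e, (e < m)%nat -> exists M, ae_on (a e) (b e) (fun x => Rabs (q e x) <= M).
Proof. intros H e He. apply (H e He). Qed.

Lemma gammaD_scale r f a b p : gammaD (fun e x => Cscale r (f e x)) a b p = Cscale r (gammaD f a b p).
Proof. unfold gammaD. destruct (Nat.odd p); reflexivity. Qed.
Lemma gammaN_scale r f a b p : gammaN (fun e x => Cscale r (f e x)) a b p = Cscale r (gammaN f a b p).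
Proof. unfold gammaN. destruct (Nat.odd p); [cx|reflexivity]. Qed.
Lemma Cnorm_scale r x : Cnorm (Cscale r x) = Rabs r * Cnorm x.
Proof. rewrite Cscale_mul, Cnorm_mul, Cnorm_RtoC. reflexivity. Qed.

Lemma trace_normalized_eigfun m a b q A B lam :
  (forall e, (e < m)%nat -> a e < b e) -> (forall e, (e < m)%nat -> Linf_on (a e) (b e) (q e)) ->
  is_eigenvalue m a b q A B lam ->
  exists f df, eigfun m a b q lam f df /\ bc m a b A B f df /\ trace_norm m f df a b = 1.
Proof.
  intros Hab Hq [f [df [Hf [Hbc [e0 [x0 [He0 [Hx0 Nz]]]]]]]].
  set (S := trace_norm m f df a b).
  assert (S0 : 0 <= S).
  { apply rsum_nonneg. intros i _. pose proof (Cnorm_ge0 (gammaD f a b i)). pose proof (Cnorm_ge0 (gammaN df a b i)). lra. }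
  assert (Sn : S <> 0).
  (* Zero trace includes zero initial data at the left end of edge [e0]; uniqueness makes the
     function vanish there, against the witness [x0]. *)
  { intros E. apply Nz. destruct (trace_norm_zero m a b f df (2 * e0) E ltac:(lia)) as [Z1 Z2].
    rewrite gammaD_left in Z1. rewrite gammaN_left in Z2.
    destruct (Linf_bounded m a b q Hq e0 He0) as [M HM].
    rewrite eigfun_rsol in Hf. destruct (Hf e0 He0) as [F1 F2].
    apply Cx_eq.
    - apply (rsol_zero _ _ _ _ _ _ _ HM F1); [rewrite Z1|rewrite Z2|exact Hx0]; reflexivity.
    - apply (rsol_zero _ _ _ _ _ _ _ HM F2); [rewrite Z1|rewrite Z2|exact Hx0]; reflexivity. }
  exists (fun e x => Cscale (/ S) (f e x)), (fun e x => Cscale (/ S) (df e x)). split; [|split].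
  - rewrite eigfun_rsol in *. intros e He. destruct (Hf e He). split; apply rsol_scal; assumption.
  - intros i Hi. specialize (Hbc i Hi). cbv beta in Hbc.
    transitivity (Cmul (RtoC (/ S)) C0); [|ring]. rewrite <- Hbc, <- csum_mul_l.
    apply csum_ext; intros. rewrite gammaD_scale, gammaN_scale, !Cscale_mul. ring.
  - unfold trace_norm. rewrite (rsum_ext _ _ (fun p => / S * (Cnorm (gammaD f a b p) + Cnorm (gammaN df a b p)))).
    + rewrite rsum_mul_l. fold (trace_norm m f df a b). fold S. apply Rinv_l, Sn.
    + intros p _. rewrite gammaD_scale, gammaN_scale, !Cnorm_scale.
      rewrite Rabs_pos_eq by (left; apply Rinv_0_lt_compat; lra). ring.
Qed.

(** A solution is controlled by two complex initial values per edge, so compactness reduces to a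
    common selection from 4m bounded real sequences; [rsol_limit] carries the convergence along each
    edge. *)
Lemma eigfun_compact m a b q (lamn : nat -> R) lam0 (fn dfn : nat -> nat -> R -> Cx) :
  (forall e, (e < m)%nat -> a e < b e) -> (forall e, (e < m)%nat -> Linf_on (a e) (b e) (q e)) ->
  Un_cv lamn lam0 -> (forall n, eigfun m a b q (lamn n) (fn n) (dfn n)) ->
  (forall n e, (e < m)%nat -> Cnorm (fn n e (a e)) <= 1 /\ Cnorm (dfn n e (a e)) <= 1) ->
  exists (phi : nat -> nat) f df, (forall k, (k <= phi k)%nat) /\ eigfun m a b q lam0 f df /\
    forall e, (e < m)%nat -> forall eps, eps > 0 -> exists n0, forall n x, (n0 <= n)%nat ->
     Icc (a e) (b e) x -> Cnorm (Csub (fn (phi n) e x) (f e x)) <= eps /\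
       Cnorm (Csub (dfn (phi n) e x) (df e x)) <= eps.
Proof.
  intros Hab Hq Hl Hf Hn.
  destruct (bolzano_weierstrass_list (flat_map (fun e =>
     (fun n => fst (fn n e (a e))) :: (fun n => snd (fn n e (a e))) ::
     (fun n => fst (dfn n e (a e))) :: (fun n => snd (dfn n e (a e))) :: nil) (seq 0 m)) 1)
    as [phi [P1 P2]].
  { intros v Hv n. apply in_flat_map in Hv. destruct Hv as [e [He Hv]]. apply in_seq in He.
    destruct (Hn n e ltac:(lia)) as [N1 N2].
    pose proof (Cnorm_re (fn n e (a e))). pose proof (Cnorm_im (fn n e (a e))).
    pose proof (Cnorm_re (dfn n e (a e))). pose proof (Cnorm_im (dfn n e (a e))).
    repeat destruct Hv as [Hv|Hv]; subst; try contradiction; cbv beta; lra. }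
  assert (L : forall e, (e < m)%nat -> forall v, In v ((fun n => fst (fn n e (a e))) :: (fun n => snd (fn n e (a e))) ::
     (fun n => fst (dfn n e (a e))) :: (fun n => snd (dfn n e (a e))) :: nil) -> exists l, Un_cv (fun k => v (phi k)) l).
  { intros e He v Hv. apply P2. apply in_flat_map. exists e. split; [apply in_seq; lia|exact Hv]. }
  assert (Hl' := Un_cv_subseq _ _ phi P1 Hl).
  assert (E : forall e, exists fd : (R -> Cx) * (R -> Cx), (e < m)%nat ->
    (rsol (a e) (b e) (q e) lam0 (fun x => fst (fst fd x)) (fun x => fst (snd fd x)) /\
     rsol (a e) (b e) (q e) lam0 (fun x => snd (fst fd x)) (fun x => snd (snd fd x))) /\
    forall eps, eps > 0 -> exists n0, forall n x, (n0 <= n)%nat ->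
     Icc (a e) (b e) x -> Cnorm (Csub (fn (phi n) e x) (fst fd x)) <= eps /\
       Cnorm (Csub (dfn (phi n) e x) (snd fd x)) <= eps).
  (* For e >= m there is no edge and the zero pair is a placeholder. *)
  { intros e. destruct (Compare_dec.lt_dec e m) as [He|Ne]; [|exists ((fun _ => C0), (fun _ => C0)); lia].
    destruct (Linf_bounded m a b q Hq e He) as [M HM].
    assert (Hf' : forall n, _) by (intros n; exact (proj1 (eigfun_rsol _ _ _ _ _ _ _) (Hf n) e He)).
    specialize (Hab e He). assert (Hab' : a e <= b e) by lra.
    destruct (L e He _ (or_introl eq_refl)) as [l1 L1].
    destruct (L e He _ (or_intror (or_introl eq_refl))) as [l2 L2].
    destruct (L e He _ (or_intror (or_intror (or_introl eq_refl)))) as [l3 L3].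
    destruct (L e He _ (or_intror (or_intror (or_intror (or_introl eq_refl))))) as [l4 L4].
    destruct (rsol_limit (a e) (b e) (q e) (fun k => lamn (phi k)) lam0
      (fun k x => fst (fn (phi k) e x)) (fun k x => fst (dfn (phi k) e x)) M l1 l3 Hab' HM
      (fun k => proj1 (Hf' (phi k))) Hl' L1 L3) as [f1 [df1 [S1 U1]]].
    destruct (rsol_limit (a e) (b e) (q e) (fun k => lamn (phi k)) lam0
      (fun k x => snd (fn (phi k) e x)) (fun k x => snd (dfn (phi k) e x)) M l2 l4 Hab' HM
      (fun k => proj2 (Hf' (phi k))) Hl' L2 L4) as [f2 [df2 [S2 U2]]].
    exists ((fun x => (f1 x, f2 x)), (fun x => (df1 x, df2 x))). intros _. cbn [fst snd].
    split; [split; assumption|]. intros eps Hp.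
    destruct (U1 (eps / 2) ltac:(lra)) as [n1 Y1]. destruct (U2 (eps / 2) ltac:(lra)) as [n2 Y2].
    exists (n1 + n2)%nat. intros n x Hn' Hx.
    destruct (Y1 n x ltac:(lia) Hx) as [A1 A2]. destruct (Y2 n x ltac:(lia) Hx) as [B1 B2].
    split; (eapply Rle_trans; [apply Cnorm_le_add|]); unfold Csub, Cadd, Copp; simpl; unfold Rminus in *; lra. }
  destruct (choice _ E) as [fd Hfd].
  exists phi, (fun e => fst (fd e)), (fun e => snd (fd e)). split; [exact P1|]. split.
  - apply eigfun_rsol. intros e He. apply (Hfd e He).
  - intros e He. apply (Hfd e He).
Qed.

Lemma tends_of_uniform (g : nat -> Cx) l :
  (forall eps, eps > 0 -> exists n0, forall n, (n0 <= n)%nat -> Cnorm (Csub (g n) l) <= eps) -> tends evtl g l.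
Proof.
  intros H eps He. destruct (H (eps / 2) ltac:(lra)) as [n0 H0]. exists n0. intros n Hn.
  specialize (H0 n Hn). lra.
Qed.

Lemma trace_tends m a b (fn dfn : nat -> nat -> R -> Cx) f df :
  (forall e, (e < m)%nat -> a e < b e) ->
  (forall e, (e < m)%nat -> forall eps, eps > 0 -> exists n0, forall n x, (n0 <= n)%nat ->
     Icc (a e) (b e) x -> Cnorm (Csub (fn n e x) (f e x)) <= eps /\ Cnorm (Csub (dfn n e x) (df e x)) <= eps) ->
  forall p, (p < 2 * m)%nat -> tends evtl (fun n => gammaD (fn n) a b p) (gammaD f a b p) /\
    tends evtl (fun n => gammaN (dfn n) a b p) (gammaN df a b p).
Proof.
  intros Hab H p Hp. destruct (endpoint_cases m p Hp) as [e [He Hpe]]. specialize (Hab e He).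
  assert (T : forall x, Icc (a e) (b e) x -> tends evtl (fun n => fn n e x) (f e x) /\
     tends evtl (fun n => dfn n e x) (df e x)).
  { intros x Hx. split; apply tends_of_uniform; intros eps Hpos; destruct (H e He eps Hpos) as [n0 H0];
      exists n0; intros n Hn; apply (H0 n x Hn Hx). }
  destruct (T (a e) ltac:(split; lra)) as [Ta1 Ta2]. destruct (T (b e) ltac:(split; lra)) as [Tb1 Tb2].
  pose proof evtl_filter as HF.
  destruct Hpe as [ -> | -> ]; split.
  - rewrite gammaD_left. refine (tends_ext _ HF _ _ _ _ Ta1). intros; symmetry; apply gammaD_left.
  - rewrite gammaN_left. refine (tends_ext _ HF _ _ _ _ Ta2). intros; symmetry; apply gammaN_left.
  - rewrite gammaD_right. refine (tends_ext _ HF _ _ _ _ Tb1). intros; symmetry; apply gammaD_right.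
  - rewrite gammaN_right. refine (tends_ext _ HF _ _ _ _ (tends_opp _ HF _ _ Tb2)).
    intros; symmetry; apply gammaN_right.
Qed.

(** Simplicity yields proportional function values only; proportionality of the derivatives, up to
    the endpoints, follows from uniqueness of derivatives. *)
Lemma eigfun_multiple_trace m a b q lam c f df u du : (forall e, (e < m)%nat -> a e < b e) ->
  eigfun m a b q lam f df -> eigfun m a b q lam u du ->
  (forall e x, (e < m)%nat -> Icc (a e) (b e) x -> f e x = Cmul c (u e x)) ->
  forall p, (p < 2 * m)%nat -> gammaD f a b p = Cmul c (gammaD u a b p) /\
    gammaN df a b p = Cmul c (gammaN du a b p).
Proof.
  intros Hab Hf Hu Hc.
  assert (D : forall e x, (e < m)%nat -> Icc (a e) (b e) x -> df e x = Cmul c (du e x)).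
  { intros e x He Hx. destruct (Hf e He) as [F _]. destruct (Hu e He) as [U _].
    specialize (F x Hx). specialize (U x Hx). specialize (Hab e He).
    assert (G : cderiv_pt (Icc (a e) (b e)) (f e) x (Cadd (Cmul C0 (u e x)) (Cmul c (du e x)))).
    { apply (cderiv_ext _ (fun y => Cmul c (u e y))); [exact Hx| |].
      - intros y Hy. symmetry. apply Hc; assumption.
      - apply (cderiv_mul _ x (fun _ => c)); [apply cderiv_const|exact U]. }
    replace (Cadd (Cmul C0 (u e x)) (Cmul c (du e x))) with (Cmul c (du e x)) in G by ring.
    apply cderiv_rderiv in F, G. destruct F as [F1 F2], G as [G1 G2].
    apply Cx_eq; eapply (rderiv_unique (a e) (b e)); eauto. }
  intros p Hp. destruct (endpoint_cases m p Hp) as [e [He Hpe]]. specialize (Hab e He).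
  assert (Ia : Icc (a e) (b e) (a e)) by (split; lra). assert (Ib : Icc (a e) (b e) (b e)) by (split; lra).
  destruct Hpe as [ -> | -> ].
  - rewrite !gammaD_left, !gammaN_left. auto.
  - rewrite !gammaD_right, !gammaN_right, (Hc e (b e) He Ib), (D e (b e) He Ib). split; ring.
Qed.

Lemma tends_near_seq D x (g : R -> Cx) l (tn : nat -> R) : (forall n, D (tn n)) -> Un_cv tn x ->
  tends (near D x) g l -> tends evtl (fun n => g (tn n)) l.
Proof.
  intros HD Ht H eps He. destruct (H eps He) as [d [Hd Hy]]. destruct (Ht d Hd) as [n0 H0].
  exists n0. intros n Hn. apply Hy; [apply HD|apply H0, Hn].
Qed.

Lemma tends_Cnorm (g : nat -> Cx) l : tends evtl g l -> Un_cv (fun n => Cnorm (g n)) (Cnorm l).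
Proof.
  intros H eps He. destruct (H eps He) as [n0 H0]. exists n0. intros n Hn. specialize (H0 n Hn).
  unfold Rdist. eapply Rle_lt_trans; [|exact H0]. apply Rabs_le.
  pose proof (Cnorm_add (Csub (g n) l) l) as T1. pose proof (Cnorm_add (Csub l (g n)) (g n)) as T2.
  rewrite (Cnorm_sub_sym l (g n)) in T2.
  replace (Cadd (Csub (g n) l) l) with (g n) in T1 by ring.
  replace (Cadd (Csub l (g n)) (g n)) with l in T2 by ring. lra.
Qed.

Lemma Un_cv_rsum k (u : nat -> nat -> R) l : (forall i, (i < k)%nat -> Un_cv (u i) (l i)) ->
  Un_cv (fun n => rsum k (fun i => u i n)) (rsum k l).
Proof.
  induction k as [|k IH]; intros H; simpl; [apply Un_cv_const|].
  apply CV_plus; [apply IH; intros; apply H; lia|apply H; lia].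
Qed.

(** * The derivative of the eigenvalue curve *)

Section EigenvalueDerivative.
Variables (m : nat) (a b : nat -> R) (q : nat -> R -> R) (A B dA dB : R -> mat) (al be t0 : R).
Variables (lam0 : R) (u du : nat -> R -> Cx) (lam : R -> R) (dlam : R) (g : vec).
Hypothesis Hab : forall e, (e < m)%nat -> a e < b e.
Hypothesis Hq : forall e, (e < m)%nat -> Linf_on (a e) (b e) (q e).
Hypothesis HH : hypH (2 * m) A B dA dB al be.
Hypothesis Ht0 : al < t0 < be.
Hypothesis Hsimple : is_simple_eigenvalue m a b q (A t0) (B t0) lam0.
Hypothesis Hu : eigfun m a b q lam0 u du.
Hypothesis Hbc : bc m a b (A t0) (B t0) u du.
Hypothesis Hnorm : normalized m a b u.
Hypothesis Hlam0 : lam t0 = lam0.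
Hypothesis Heig : exists delta, delta > 0 /\ forall t, Rabs (t - t0) < delta -> al < t < be ->
       is_eigenvalue m a b q (A t) (B t) (lam t).
Hypothesis Hdlam : derivable_pt_lim lam t0 dlam.
Hypothesis Hg : v2eq (2 * m) (trace u du a b) (plane_of (2 * m) (A t0) (B t0) g).

Lemma eigenfunctions_converge : exists (tn : nat -> R) (fn dfn : nat -> nat -> R -> Cx) c,
  (forall n, al < tn n < be /\ tn n <> t0) /\ Un_cv tn t0 /\ c <> C0 /\
  (forall n, eigfun m a b q (lam (tn n)) (fn n) (dfn n)) /\
  (forall n, bc m a b (A (tn n)) (B (tn n)) (fn n) (dfn n)) /\
  (forall e, (e < m)%nat -> forall eps, eps > 0 -> exists n0, forall n x, (n0 <= n)%nat ->
     Icc (a e) (b e) x -> Cnorm (Csub (fn n e x) (Cmul c (u e x))) <= eps) /\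
  (forall p, (p < 2 * m)%nat ->
     tends evtl (fun n => gammaD (fn n) a b p) (Cmul c (gammaD u a b p)) /\
     tends evtl (fun n => gammaN (dfn n) a b p) (Cmul c (gammaN du a b p))).
Proof.
  destruct Heig as [delta [Hd He]].
  set (r := Rmin delta (be - t0) / 2).
  assert (r0 : 0 < r /\ r < delta /\ r < be - t0).
  { pose proof (Rmin_pos delta (be - t0) Hd ltac:(lra)). pose proof (Rmin_l delta (be - t0)).
    pose proof (Rmin_r delta (be - t0)). unfold r. lra. }
  (* An approach from the right that stays in (t0, t0 + r], so [lam] is an eigenvalue at each time
     and no time equals t0. *)
  set (sn := fun n => t0 + r * / (INR n + 1)).
  assert (invn : forall n, 0 < / (INR n + 1) <= 1).
  { intros n. pose proof (pos_INR n). split; [apply Rinv_0_lt_compat; lra|].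
    rewrite <- Rinv_1. apply Rinv_le_contravar; lra. }
  assert (sn1 : forall n, t0 < sn n <= t0 + r).
  { intros n. specialize (invn n). unfold sn. nra. }
  assert (sn2 : Un_cv sn t0).
  { intros eps Hp. destruct (archimed_cor1 (eps / r)) as [n0 [H0 H1]]; [apply Rdiv_lt_0_compat; lra|].
    exists n0. intros n Hn. unfold Rdist, sn. replace (t0 + r * / (INR n + 1) - t0) with (r * / (INR n + 1)) by ring.
    specialize (invn n). rewrite Rabs_pos_eq by nra.
    assert (/ (INR n + 1) <= / INR n0).
    { apply Rinv_le_contravar; [apply lt_0_INR; lia|]. apply le_INR in Hn. lra. }
    apply Rle_lt_trans with (r * / INR n0); [nra|].
    apply Rmult_lt_compat_l with (r := r) in H0; [|lra].
    replace (r * (eps / r)) with eps in H0 by (field; lra). exact H0. }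
  assert (En : forall n, exists fd : (nat -> R -> Cx) * (nat -> R -> Cx),
     eigfun m a b q (lam (sn n)) (fst fd) (snd fd) /\ bc m a b (A (sn n)) (B (sn n)) (fst fd) (snd fd) /\
     trace_norm m (fst fd) (snd fd) a b = 1).
  { intros n. specialize (sn1 n).
    destruct (trace_normalized_eigfun m a b q (A (sn n)) (B (sn n)) (lam (sn n)) Hab Hq) as [f [df H]].
    - apply He; [rewrite Rabs_pos_eq; lra|lra].
    - exists (f, df). exact H. }
  destruct (choice _ En) as [fd Hfd].
  assert (lamc : Un_cv (fun n => lam (sn n)) lam0).
  { rewrite <- Hlam0. apply (continuity_seq lam sn t0); [|exact sn2].
    apply derivable_continuous_pt. exists dlam. exact Hdlam. }
  destruct (eigfun_compact m a b q (fun n => lam (sn n)) lam0 (fun n => fst (fd n)) (fun n => snd (fd n))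
    Hab Hq lamc (fun n => proj1 (Hfd n))) as [phi [f [df [P1 [Hf Hcv]]]]].
  { intros n e Hem. destruct (Hfd n) as [_ [_ T]]. unfold trace_norm in T.
    assert (P : forall i, 0 <= Cnorm (gammaD (fst (fd n)) a b i) + Cnorm (gammaN (snd (fd n)) a b i)).
    { intros i. pose proof (Cnorm_ge0 (gammaD (fst (fd n)) a b i)).
      pose proof (Cnorm_ge0 (gammaN (snd (fd n)) a b i)). lra. }
    pose proof (rsum_term_le (2 * m) _ (2 * e) (fun i _ => P i) ltac:(lia)) as Q. rewrite T in Q. cbv beta in Q.
    rewrite gammaD_left, gammaN_left in Q.
    pose proof (Cnorm_ge0 (fst (fd n) e (a e))). pose proof (Cnorm_ge0 (snd (fd n) e (a e))). lra. }
  set (fn := fun n => fst (fd (phi n))). set (dfn := fun n => snd (fd (phi n))).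
  set (tn := fun n => sn (phi n)).
  assert (tn1 : forall n, al < tn n < be /\ tn n <> t0).
  { intros n. specialize (sn1 (phi n)). unfold tn. lra. }
  assert (tn2 : Un_cv tn t0) by exact (Un_cv_subseq sn t0 phi P1 sn2).
  assert (Tr := trace_tends m a b fn dfn f df Hab Hcv).
  pose proof evtl_filter as HF.
  assert (tn3 : forall n, Icc al be (tn n)) by (intros n; specialize (tn1 n); split; lra).
  assert (It0 : Icc al be t0) by (split; lra).
  assert (ABc : forall i j, (i < 2 * m)%nat -> (j < 2 * m)%nat ->
     tends evtl (fun n => A (tn n) i j) (A t0 i j) /\ tends evtl (fun n => B (tn n) i j) (B t0 i j)).
  { intros i j Hi Hj. destruct (proj1 (proj2 HH) i j Hi Hj) as [dA' [_ [dB' _]]].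
    split; [apply (tends_near_seq (Icc al be) t0 (fun t => A t i j))
           |apply (tends_near_seq (Icc al be) t0 (fun t => B t i j))]; auto.
    - exact (cderiv_cont _ _ _ _ (dA' t0 It0)).
    - exact (cderiv_cont _ _ _ _ (dB' t0 It0)). }
  (* The boundary condition at t_n passes to the limit, because the matrix entries and the traces
     converge separately. *)
  assert (bcf : bc m a b (A t0) (B t0) f df).
  { intros i Hi. apply (tends_unique evtl HF (fun n => csum (2 * m) (fun j => Cadd
       (Cmul (A (tn n) i j) (gammaD (fn n) a b j)) (Cmul (B (tn n) i j) (gammaN (dfn n) a b j))))).
    - intros [n0 N]. exact (N n0 (le_n _)).
    - apply (tends_csum _ HF). intros j Hj. destruct (ABc i j Hi Hj). destruct (Tr j Hj).
      apply (tends_add _ HF); apply (tends_mul _ HF); assumption.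
    - apply (tends_ext _ HF (fun _ => C0)); [|apply (tends_const _ HF)].
      intros n. symmetry. exact (proj1 (proj2 (Hfd (phi n))) i Hi). }
  destruct (proj2 Hsimple u du f df Hu Hbc (normalized_nonzero m a b q lam0 u du Hab Hu Hnorm) Hf bcf) as [c Hc].
  assert (Trc := eigfun_multiple_trace m a b q lam0 c f df u du Hab Hf Hu Hc).
  exists tn, fn, dfn, c. split; [exact tn1|]. split; [exact tn2|]. split; [|split; [|split; [|split]]].
  (* If c were 0 the limit would have zero trace, whereas its trace norm is the limit of the
     constant 1. *)
  - intros E.
    assert (T1 : Un_cv (fun n => trace_norm m (fn n) (dfn n) a b) (trace_norm m f df a b)).
    { unfold trace_norm. apply Un_cv_rsum. intros p Hp. destruct (Tr p Hp).
      apply CV_plus; apply tends_Cnorm; assumption. }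
    assert (T2 : trace_norm m f df a b = 1).
    { apply (UL_sequence (fun n => trace_norm m (fn n) (dfn n) a b)); [exact T1|].
      apply (Un_cv_ext (fun _ => 1)); [|apply Un_cv_const]. intros n. symmetry. apply (Hfd (phi n)). }
    assert (trace_norm m f df a b = 0); [|lra].
    unfold trace_norm. rewrite (rsum_ext _ _ (fun _ => 0)); [rewrite rsum_const; ring|].
    intros p Hp. destruct (Trc p Hp) as [-> ->]. rewrite E.
    replace (Cmul C0 (gammaD u a b p)) with C0 by ring. replace (Cmul C0 (gammaN du a b p)) with C0 by ring.
    rewrite Cnorm_0. ring.
  - intros n. apply (Hfd (phi n)).
  - intros n. apply (Hfd (phi n)).
  - intros e Hem eps Hp. destruct (Hcv e Hem eps Hp) as [n0 H0]. exists n0. intros n x Hn Hx.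
    rewrite <- (Hc e x Hem Hx). apply (H0 n x Hn Hx).
  - intros p Hp. destruct (Trc p Hp) as [<- <-]. apply Tr, Hp.
Qed.

(** The sequence [w] has two limits: [dlam] times [c] by [green_limit], and [c] times the right-hand
    side by the boundary conditions. Uniqueness of limits and c <> 0 finish the argument. *)
Lemma eigenvalue_derivative : RtoC dlam =
  cinner (2 * m) (fun i => Cadd (mulmv (2 * m) (dA t0) (gammaD u a b) i)
                                (mulmv (2 * m) (dB t0) (gammaN du a b) i)) g.
Proof.
  destruct eigenfunctions_converge as [tn [fn [dfn [c [tn1 [tn2 [c0 [Hf [Hbcn [Hcv Tr]]]]]]]]]].
  pose proof evtl_filter as HF. set (N := (2 * m)%nat) in *.
  set (Y := cinner N (fun i => Cadd (mulmv N (dA t0) (gammaD u a b) i) (mulmv N (dB t0) (gammaN du a b) i)) g).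
  set (w := fun n => Cscale (/ (tn n - t0)) (omega N (trace (fn n) (dfn n) a b) (trace u du a b))).
  assert (L1 : tends evtl w (Cmul (RtoC dlam) c)).
  { apply (green_limit m a b q (fun n => lam (tn n)) (fun n => tn n - t0) lam0 dlam fn dfn u du c); auto.
    rewrite <- Hlam0. intros eps Hp. destruct (Hdlam eps Hp) as [d Hd].
    destruct (tn2 d (cond_pos d)) as [n0 H0]. exists n0. intros n Hn.
    specialize (Hd (tn n - t0) ltac:(destruct (tn1 n); lra) (H0 n Hn)).
    replace (t0 + (tn n - t0)) with (tn n) in Hd by ring. exact Hd. }
  assert (It0 : Icc al be t0) by (split; lra).
  assert (L2 : tends evtl w (Cmul c Y)).
  { apply (tends_ext _ HF (fun n => cinner N (fun i => Cadd
       (csum N (fun j => Cmul (quot (fun t => A t i j) t0 (tn n)) (gammaD (fn n) a b j)))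
       (csum N (fun j => Cmul (quot (fun t => B t i j) t0 (tn n)) (gammaN (dfn n) a b j)))) g)).
    - intros n. unfold w.
      rewrite (omega_v2eq N _ (trace (fn n) (dfn n) a b) _ (plane_of N (A t0) (B t0) g) ltac:(split; reflexivity) Hg).
      rewrite omega_plane_of. rewrite Cscale_mul. unfold cinner. rewrite <- csum_opp, <- csum_mul_l.
      apply csum_ext; intros i Hi.
      assert (E := Hbcn n i Hi). cbv beta in E. rewrite csum_add in E.
      change (Cadd (mulmv N (A (tn n)) (gammaD (fn n) a b) i) (mulmv N (B (tn n)) (gammaN (dfn n) a b) i) = C0) in E.
      (* The residual at t_n is zero, so it may be added to minus the residual at t0; division by
         t_n - t0 then leaves difference quotients of [A] and [B]. *)
      transitivity (Cmul (Cmul (RtoC (/ (tn n - t0))) (Csub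
        (Cadd (mulmv N (A (tn n)) (gammaD (fn n) a b) i) (mulmv N (B (tn n)) (gammaN (dfn n) a b) i))
        (Cadd (mulmv N (A t0) (gammaD (fn n) a b) i) (mulmv N (B t0) (gammaN (dfn n) a b) i)))) (Cconj (g i))).
      + f_equal. unfold mulmv. rewrite <- !csum_add, <- csum_sub, <- csum_mul_l.
        apply csum_ext; intros j _. unfold quot. rewrite !Cscale_mul. ring.
      + rewrite E. unfold trace; cbn [fst snd]. ring.
    - unfold Y, cinner. rewrite <- csum_mul_l. apply (tends_csum _ HF); intros i Hi.
      replace (Cmul c (Cmul (Cadd (mulmv N (dA t0) (gammaD u a b) i) (mulmv N (dB t0) (gammaN du a b) i)) (Cconj (g i))))
        with (Cmul (Cadd (csum N (fun j => Cmul (dA t0 i j) (Cmul c (gammaD u a b j))))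
                         (csum N (fun j => Cmul (dB t0 i j) (Cmul c (gammaN du a b j))))) (Cconj (g i))).
      2:{ rewrite <- csum_add. unfold mulmv. rewrite <- csum_add.
          transitivity (Cmul (Cmul c (csum N (fun i0 => Cadd (Cmul (dA t0 i i0) (gammaD u a b i0)) (Cmul (dB t0 i i0) (gammaN du a b i0))))) (Cconj (g i))); [|ring].
          f_equal. rewrite <- csum_mul_l. apply csum_ext; intros; ring. }
      assert (Q : forall (M dM : R -> mat) j, cderiv_on (Icc al be) (fun t => M t i j) (fun t => dM t i j) ->
        tends evtl (fun n => quot (fun t => M t i j) t0 (tn n)) (dM t0 i j)).
      { intros M dM j HM. apply (tends_near_seq (punct (Icc al be) t0) t0 (quot (fun t => M t i j) t0)); auto.
        - intros n. destruct (tn1 n). split; [split; lra|assumption].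
        - apply cderiv_tends, HM, It0. }
      apply (tends_mul _ HF); [|apply (tends_const _ HF)].
      apply (tends_add _ HF); apply (tends_csum _ HF); intros j Hj;
        destruct (proj1 (proj2 HH) i j Hi Hj) as [dA' [_ [dB' _]]]; destruct (Tr j Hj) as [TD TN];
        apply (tends_mul _ HF); auto. }
  apply (Cmul_cancel c); [exact c0|].
  rewrite (tends_unique evtl HF w _ _ ltac:(intros [n0 F]; exact (F n0 (le_n _))) L2 L1). ring.
Qed.
End EigenvalueDerivative.

Theorem theorem3p4
  (m : nat) (a b : nat -> R) (q : nat -> R -> R)
  (A B dA dB : R -> mat) (al be t0 : R)
  (lam0 : R) (u du : nat -> R -> Cx) (lam : R -> R) (dlam : R) (Minv : mat) :
  (forall e, (e < m)%nat -> a e < b e) ->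
  (forall e, (e < m)%nat -> Linf_on (a e) (b e) (q e)) ->
  hypH (2 * m) A B dA dB al be ->
  al < t0 < be ->
  is_simple_eigenvalue m a b q (A t0) (B t0) lam0 ->
  eigfun m a b q lam0 u du ->
  bc m a b (A t0) (B t0) u du ->
  normalized m a b u ->
  lam t0 = lam0 ->
  (exists delta, delta > 0 /\ forall t, Rabs (t - t0) < delta -> al < t < be ->
       is_eigenvalue m a b q (A t) (B t) (lam t)) ->
  derivable_pt_lim lam t0 dlam ->
  meq (2 * m) (mulmm (2 * m)
        (msub (mulmm (2 * m) (A t0) (adj (A t0))) (mulmm (2 * m) (B t0) (adj (B t0)))) Minv) idm ->
  meq (2 * m) (mulmm (2 * m) Minv
        (msub (mulmm (2 * m) (A t0) (adj (A t0))) (mulmm (2 * m) (B t0) (adj (B t0))))) idm ->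
  let phi := mulmv (2 * m) Minv
               (vadd (mulmv (2 * m) (B t0) (gammaD u a b))
                     (mulmv (2 * m) (A t0) (gammaN du a b))) in
  RtoC dlam =
    cinner (2 * m)
      (mulmv (2 * m) (msub (mulmm (2 * m) (A t0) (adj (dB t0)))
                           (mulmm (2 * m) (B t0) (adj (dA t0)))) phi) phi /\
  crossing_form_is (2 * m) A B t0 (Kplane m a b q lam0)
    (gammaD u a b, gammaN du a b) (RtoC dlam).
Proof.
  intros Hab Hq HH Ht0 Hsimple Hu Hbc Hnorm Hlam0 Heig Hdlam _ HMinv phi.
  set (N := (2 * m)%nat) in *.
  assert (It0 : Icc al be t0) by (split; lra).
  destruct (Lplane_param N (A t0) (B t0) (trace u du a b)
    (proj1 (proj2 (proj2 HH) t0 It0)) (proj2 (proj2 (proj2 HH) t0 It0)) Hbc) as [g Hg].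
  assert (D := eigenvalue_derivative m a b q A B dA dB al be t0 lam0 u du lam dlam g
     Hab Hq HH Ht0 Hsimple Hu Hbc Hnorm Hlam0 Heig Hdlam Hg).
  change (2 * m)%nat with N in D.
  (* [dlam] is real, so the pairing equals its conjugate; this is the form expected by
     [crossing_value]. *)
  assert (Dc : RtoC dlam = Cconj (cinner N (fun i => Cadd (mulmv N (dA t0) (gammaD u a b) i)
                                (mulmv N (dB t0) (gammaN du a b) i)) g)).
  { rewrite <- D. cx. }
  destruct Hg as [Hg1 Hg2]. cbn [trace plane_of fst snd] in Hg1, Hg2.
  split.
  (* Inserting gammaD u = -B^* g and gammaN u = A^* g in the definition of [phi] gives (A A^* - B
     B^* ) g before [Minv] is applied, so [phi] is the parameter [g] of the trace. *)
  - assert (Ephi : veq N phi g).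
    { unfold phi.
      assert (E : veq N (vadd (mulmv N (B t0) (gammaD u a b)) (mulmv N (A t0) (gammaN du a b)))
        (mulmv N (msub (mulmm N (A t0) (adj (A t0))) (mulmm N (B t0) (adj (B t0)))) g)).
      { intros i Hi.
        transitivity (Cadd (mulmv N (B t0) (vneg (mulmv N (adj (B t0)) g)) i) (mulmv N (A t0) (mulmv N (adj (A t0)) g) i)).
        - unfold vadd. f_equal; apply csum_ext; intros j Hj; [rewrite (Hg1 j Hj)|rewrite (Hg2 j Hj)]; reflexivity.
        - rewrite mulmv_neg, <- 2!(mulmv_assoc N _ _ g i Hi). unfold mulmv at 1 2 3, msub.
          rewrite <- csum_opp, <- csum_add. apply csum_ext; intros; ring. }
      rewrite E, <- mulmv_assoc, HMinv, mulmv_1. reflexivity. }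
    rewrite (cinner_veq N _ (mulmv N (msub (mulmm N (A t0) (adj (dB t0))) (mulmm N (B t0) (adj (dA t0)))) g) phi g)
      by (try assumption; rewrite Ephi; reflexivity).
    rewrite Dc.
    transitivity (Cconj (Cadd (cinner N (mulmv N (dA t0) (gammaD u a b)) g) (cinner N (mulmv N (dB t0) (gammaN du a b)) g))).
    { f_equal. unfold cinner. rewrite <- csum_add. apply csum_ext; intros; ring. }
    rewrite Cconj_add, (cinner_adj N (dA t0)), (cinner_adj N (dB t0)), !cinner_conj.
    rewrite (cinner_veq N _ _ (gammaD u a b) (vneg (mulmv N (adj (B t0)) g)) (reflexivity _) Hg1).
    rewrite (cinner_veq N _ _ (gammaN du a b) (mulmv N (adj (A t0)) g) (reflexivity _) Hg2).
    (* Conjugation has put the differentiated adjoints in the first slot. Moving A^* and B^* back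
       across the inner product leaves A dB^* - B dA^* applied to [g], with the minus sign coming
       from gammaD u = -B^* g. *)
    transitivity (Csub (cinner N (mulmv N (adj (dB t0)) g) (mulmv N (adj (A t0)) g))
      (cinner N (mulmv N (adj (dA t0)) g) (mulmv N (adj (B t0)) g))).
    { unfold cinner. rewrite <- csum_add, <- csum_sub. apply csum_ext; intros.
      unfold vneg. rewrite Cconj_opp. ring. }
    rewrite <- 2!cinner_adj. unfold cinner. rewrite <- csum_sub. apply csum_ext; intros i Hi.
    rewrite <- 2!(mulmv_assoc N _ _ g i Hi).
    transitivity (Cmul (Csub (mulmv N (mulmm N (A t0) (adj (dB t0))) g i) (mulmv N (mulmm N (B t0) (adj (dA t0))) g i)) (Cconj (g i))); [ring|].
    f_equal. unfold mulmv, msub. rewrite <- csum_sub. apply csum_ext; intros; ring.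
  - split; [|split; [|split]].
    + exists u, du. split; [exact Hu|split; reflexivity].
    + exact Hbc.
    + apply (admissible_R_exists N A B dA dB al be t0 HH Ht0).
    + intros Rt dR delta HR.
      apply (crossing_value N A B dA dB al be t0 HH Ht0 _ g _ Rt dR delta); [split; assumption|exact Dc|exact HR].
Qed.
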